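(* Assume the model and Assumptions A1--A4 of the context with $p\ge 3$. Suppose that the sequence $M=M_n\to\infty$ satisfies $$c_1'\left(\frac{n}{\sigma_\varepsilon^2}\right)^{1/(2p+3)}\le M\ll\left(\frac{n}{\sigma_\varepsilon^2\log n}\right)^{1/7}$$ for some constant $c_1'>0$, that $M^{-3/2}\ll\eta_M\ll M^{-1}$, and let $\xi_n=\sqrt{\log n}\;n^{-(p+1)/(2p+3)}$. Then there exist constants $c_2'>0$ (sufficiently small) and $C_0>0$ such that, setting $\bar\alpha_n:=c_2'M^{-2}$ and $$\alpha_n:=C_0M\max\left\{\sigma_\varepsilon\sqrt{\frac{M\log n}{n}},\;M^{-(p+1)},\;\xi_n\right\}$$ (so that $\alpha_n\le\bar\alpha_n$ for large $n$), the following holds with probability tending to one as $n\to\infty$: there exists a local minimum $\widehat{\boldsymbol\beta}$ of the objective function $\tilde L_\delta$, which is also a global minimum of $\tilde L_\delta$ within radius $\bar\alpha_n$ of $\boldsymbol\beta^*$, such that, with $\widehat g:=g_{\widehat{\boldsymbol\beta}}$, $$\int_{x_{0,\delta}}^{x_{1,\delta}}|\widehat g(u)-g(u)|^2\,du=O(\alpha_n^2).$$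
   Context: Notation: $a_n\ll b_n$ means $a_n/b_n\to0$. $\delta\in(0,1/2)$ is a fixed small constant. Model. $X=X_g$ solves $X'(t)=g(X(t))$, $t\in[0,1]$, $X(0)=x_0$, with unknown smooth positive $g$. Put $x_1=X(1)$, $x_{0,\delta}=X(\delta)$, $x_{1,\delta}=X(1-\delta)$. One observes $Y_j=X(T_j)+\varepsilon_j$, $j=1,\dots,n$, with the $\varepsilon_j$ independent of the $T_j$. Endpoint estimates. $\widehat x_0,\widehat x_1$ are (local polynomial, bandwidth of order $n^{-1/(2p+3)}$) estimators of $x_{0,\delta},x_{1,\delta}$ computed from a sample independent of $(T_j,Y_j)_{j\le n}$; with $d_n=\max_{j=0,1}|\widehat x_j-x_{j,\delta}|$ one has $d_n=O_P(n^{-(p+1)/(2p+3)})$ and, for each $\eta>0$, there is $C(\eta)>0$ with $d_n\le C(\eta)\xi_n$ with probability at least $1-n^{-\eta}$. One argues conditionally on $\widehat x_0,\widehat x_1$, treating them as nonrandom sequences converging to $x_{0,\delta},x_{1,\delta}$. For a sequence $\eta_M>0$ put $x_{0,M}=\widehat x_0-\eta_M$, $x_{1,M}=\widehat x_1+\eta_M$, $D_0=[x_{0,M},x_{1,M}]$. Sieve. For basis functions $\phi_{1,M},\dots,\phi_{M,M}$ on $D_0$ and $\boldsymbol\beta\in\mathbb R^M$, $g_{\boldsymbol\beta}=\sum_{k=1}^M\beta_k\phi_{k,M}$ (extended outside $D_0$ by its endpoint values, with differentiability at the endpoints). $X(t;\boldsymbol\beta,a)$ is the solution of $x'(t)=g_{\boldsymbol\beta}(x(t))$,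 $t\in[\delta,1-\delta]$, $x(\delta)=a$; $X(t;\boldsymbol\beta):=X(t;\boldsymbol\beta,x_{0,\delta})$. Objective function: $\tilde L_\delta(\boldsymbol\beta)=\sum_{j=1}^n(Y_j-X(T_j;\boldsymbol\beta,\widehat x_0))^2\,\mathbf 1_{[\delta,1-\delta]}(T_j)$. Assumptions. A1: $g\in C^p(D)$ and $g>0$ on $D$, where $D$ is an open interval containing $[x_0,x_1]$ and $p$ is an integer. A2: (i) each $\phi_{k,M}$ has unit $L^2$ norm; (ii) the combined support of $\{\phi_{k,M}\}_{k=1}^M$ is $D_0$ and each $\phi_{k,M}$ has support of length $O(M^{-1})$; (iii) $\phi_{k,M}\in C^2(D_0)$; (iv) $\sup_{x\in D_0}\sum_{k=1}^M|\phi_{k,M}^{(j)}(x)|^2=O(M^{1+2j})$, $j=0,1,2$; (v) the eigenvalues of the Gram matrix $\big(\int_{D_0}\phi_{k,M}\phi_{l,M}\big)_{k,l}$ lie in $[\underline c,\overline c]$ for constants $0<\underline c\le\overline c<\infty$ not depending on $M$; (vi) for every $M$ there is $\boldsymbol\beta^*\in\mathbb R^M$ with $\sup_{t\in[\delta,1-\delta]}|X_g(t)-X(t;\boldsymbol\beta^* )|=O(M^{-(p+1)})$ and $\sup_{u\in[x_{0,\delta},x_{1,\delta}]}|g^{(j)}(u)-g^{(j)}_{\boldsymbol\beta^*}(u)|=O(M^{-p+j})$, $j=0,1,2$. The vector $\boldsymbol\beta^*$ in the claim is the one in (vi). A3: the $T_j$ are i.i.d. on $[0,1]$ with density $f_T$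 satisfying $\underline c'\le f_T\le\overline c'$ for some $0<\underline c'\le\overline c'<\infty$. A4: the $\varepsilon_j$ are i.i.d. sub-Gaussian with mean $0$ and variance $\sigma_\varepsilon^2>0$. *)

(* Defs.v *)
From HB Require Import structures.
From mathcomp Require Import all_boot all_order all_algebra.
From mathcomp Require Import all_classical all_reals all_analysis.
Set Implicit Arguments.
Unset Strict Implicit.
Unset Printing Implicit Defensive.
Import Order.TTheory GRing.Theory Num.Theory.
Import numFieldNormedType.Exports.
Local Open Scope classical_set_scope.
Local Open Scope ring_scope.

Definition much_less (R : realType) (a b : R^nat) : Prop :=
  a n / b n @[n --> \oo] --> (0 : R).

(* The events A n need not be measurable, hence the measurable minorants. *)
Definition whp (R : realType) (d : measure_display) (Omega : measurableType d)
    (P : probability Omega R) (A : nat -> set Omega) : Prop :=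
  exists E : nat -> set Omega,
    [/\ forall n, measurable (E n), forall n, E n `<=` A n
      & P (E n) @[n --> \oo] --> 1%E].

Definition mutually_independent (R : realType) (d : measure_display)
    (Omega : measurableType d) (P : probability Omega R) (I : eqType)
    (Z : I -> {RV P >-> R}) : Prop :=
  forall (s : seq I) (B : I -> set R), uniq s -> (forall i, measurable (B i)) ->
    P (\bigcap_(i in [set` s]) Z i @^-1` B i)
    = (\prod_(i <- s) P (Z i @^-1` B i))%E.

Definition has_density_on (R : realType) (d : measure_display)
    (Omega : measurableType d) (P : probability Omega R)
    (D : set R) (Z : {RV P >-> R}) (f : R -> R) : Prop :=
  forall B : set R, measurable B ->
    P (Z @^-1` B) = (\int[lebesgue_measure]_(x in B `&` D) (f x)%:E)%E.

Definition identically_distributed (R : realType) (d : measure_display)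
    (Omega : measurableType d) (P : probability Omega R) (I : Type)
    (Z : I -> {RV P >-> R}) : Prop :=
  forall (i j : I) (B : set R), measurable B ->
    P (Z i @^-1` B) = P (Z j @^-1` B).

Definition sub_gaussian (R : realType) (d : measure_display)
    (Omega : measurableType d) (P : probability Omega R)
    (Z : {RV P >-> R}) : Prop :=
  exists2 s : R, 0 < s &
    forall l : R, (mmt_gen_fun P Z l <= (expR (s ^+ 2 * l ^+ 2 / 2))%:E)%E.

(* C^k regularity on an open set D. *)
Definition Ck_on (R : realType) (k : nat) (D : set R) (f : R -> R) : Prop :=
  (forall j x, (j < k)%N -> D x -> derivable (derive1n j f) x 1) /\
  (forall x, D x -> {for x, continuous (derive1n k f)}).

(* C^k regularity on a closed interval [a, b], expressed through an extension
   of f beyond [a, b]: the derivatives of f on [a, b], one-sided at a and b,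
   are those of the extension. *)
Definition Ck_on_cc (R : realType) (k : nat) (a b : R) (f : R -> R) : Prop :=
  exists U : set R, [/\ open U, `[a, b] `<=` U & Ck_on k U f].

(* The right-hand sides g of interest are continuous along x, so that the
   equation also holds at t0 and t1 with one-sided derivatives. *)
Definition solves_ode (R : realType) (g : R -> R) (t0 t1 a : R) (x : R -> R) :
    Prop :=
  [/\ x t0 = a, {within `[t0, t1], continuous x}
    & forall t, t0 < t < t1 -> is_derive t 1 x (g (x t))].

Definition extend_cst (R : realType) (a b : R) (f : R -> R) (x : R) : R :=
  f (Num.max a (Num.min x b)).

Definition gbeta (R : realType) (a b : R) (m : nat) (phi : 'I_m -> R -> R)
    (beta : 'rV[R]_m) : R -> R :=
  extend_cst a b (fun x => \sum_(k < m) beta 0 k * phi k x).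

(* The norm `|v| of the library is the max norm. *)
Definition enorm (R : realType) (m : nat) (v : 'rV[R]_m) : R :=
  Num.sqrt (\sum_(k < m) v 0 k ^+ 2).

Definition supp_in (R : realType) (a b : R) (f : R -> R) : set R :=
  closure (`[a, b] `&` [set x | f x != 0]).

Definition gram (R : realType) (a b : R) (m : nat) (phi : 'I_m -> R -> R) :
    'M[R]_m :=
  \matrix_(k, l) \int[lebesgue_measure]_(x in `[a, b]) (phi k x * phi l x).

(* Conditions on m basis functions on [a, b], whose values outside [a, b] are
   immaterial since gbeta extends their combinations by constants; K is the constant of the O(.)'s,
   cl and cu bound the spectrum of the Gram matrix. *)
Record sieve_basis (R : realType) (K cl cu : R) (a b : R) (m : nat)
    (phi : 'I_m -> R -> R) : Prop := SieveBasis {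
  sieve_unit : forall k,
    \int[lebesgue_measure]_(x in `[a, b]) (phi k x) ^+ 2 = 1 ;
  sieve_support : \bigcup_(k in [set: 'I_m]) supp_in a b (phi k) = `[a, b]%classic ;
  sieve_support_length : forall k,
    (lebesgue_measure (supp_in a b (phi k)) <= (K / m%:R)%:E)%E ;
  sieve_C2 : forall k, Ck_on_cc 2 a b (phi k) ;
  sieve_derivable_ends : forall k,
    derivable (extend_cst a b (phi k)) a 1 /\
    derivable (extend_cst a b (phi k)) b 1 ;
  sieve_deriv_bound : forall (j : nat) (x : R), (j <= 2)%N -> x \in `[a, b] ->
    \sum_(k < m) `|derive1n j (phi k) x| ^+ 2 <= K * m%:R ^+ (1 + 2 * j) ;
  sieve_gram : forall l : R, eigenvalue (gram a b phi) l -> cl <= l <= cu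
}.

Definition local_min (R : realType) (m : nat) (L : 'rV[R]_m -> R)
    (b : 'rV[R]_m) : Prop :=
  \forall b' \near b, L b <= L b'.

Definition global_min_within (R : realType) (m : nat) (L : 'rV[R]_m -> R)
    (c : 'rV[R]_m) (r : R) (b : 'rV[R]_m) : Prop :=
  enorm (b - c) <= r /\ forall b', enorm (b' - c) <= r -> L b <= L b'.

(* flow beta t is the trajectory X(t; beta, a) for the initial value a in use;
   T and Y are the observed design points and responses, indexed from 0. *)
Definition objective (R : realType) (delta : R) (n m : nat)
    (flow : 'rV[R]_m -> R -> R) (T Y : nat -> R) (beta : 'rV[R]_m) : R :=
  \sum_(j < n) (Y j - flow beta (T j)) ^+ 2 * \1_(`[delta, 1 - delta]) (T j).

Definition xi (R : realType) (p n : nat) : R :=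
  Num.sqrt (ln n%:R) * n%:R `^ (- ((p + 1)%:R / (2 * p + 3)%:R)).

Definition alpha (R : realType) (p : nat) (sigma C0 : R) (M : nat -> nat)
    (n : nat) : R :=
  C0 * (M n)%:R *
  Num.max (sigma * Num.sqrt ((M n)%:R * ln n%:R / n%:R))
          (Num.max ((M n)%:R ^- (p + 1)) (xi R p n)).

Definition alpha_bar (R : realType) (c2 : R) (M : nat -> nat) (n : nat) : R :=
  c2 * (M n)%:R ^- 2.

(* Main.v *)
Require Import Defs.
From HB Require Import structures.
From mathcomp Require Import all_boot all_order all_algebra.
From mathcomp Require Import all_classical all_reals all_analysis.
From mathcomp Require Import measurable_realfun.
From mathcomp Require Import ring lra.
Set Implicit Arguments.
Unset Strict Implicit.
Unset Printing Implicit Defensive.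
Import Order.TTheory GRing.Theory Num.Theory.
Import numFieldNormedType.Exports.
Local Open Scope classical_set_scope.
Local Open Scope ring_scope.

(** Write [theta = beta - bstar], and let [D] be the difference of the
    trajectories of [beta] and of [bstar] issued from the estimated left end.
    The objective function is compared on the ball [|theta| <= M^-2] with its
    value at [bstar].

    - Along a trajectory of [x' = h x] a primitive of [1 / h] (its clock) runs at
      unit speed. Clocks replace Gronwall's inequality: they keep all the
      trajectories within [O(M^-2)] of [x0d, x1d], and the difference of two
      clocks is an integral of [g_theta / (g_beta g_bstar)].
    - Integrating the derivative of [g_theta] times this difference gives the
      reverse inequality [|theta|^2 <= C M^2 A] with [A] the integral of [D^2];
      likewise the modulus of continuity of [D] is controlled by [M^2 A].
    - Markov's inequality for second moments of sums over a grid of [q M] cells,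
      each with [n] nodes, shows that with probability [1 - O(1 / ln n + M^2 / n)]
      the empirical sum of [D^2] is at least [c n A] and that its correlation with
      the errors is at most [c n A / 8 + C M ln n], for all [beta] in the ball.
      The moduli of continuity make the sum over the cells sufficient, so no
      union bound over [beta] is needed.

    Hence the objective exceeds its value at [bstar] as soon as [|theta|] reaches
    [alpha], so that its minimum over the compact ball is interior. *)

(** The sample yields a gain of order [n A], so every estimate on [D] must be proportional to [A]
    rather than to [|theta|^2]. This is what the reverse inequality buys: the integral of the square
    of the derivative of [D] is at most a multiple of [|theta|^2 + M^2 A], hence of [M^2 A], and on
    cells of length of order [1 / (q M)] the oscillation of [D] costs a multiple of [A / q^2], which
    a fixed [q] makes small. The sums of errors over cells do not involve [beta]; it enters only
    through values and increments of [D] at nodes, whose squares have sums controlled by [A].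

    In the ball of radius [M^-2] ([c2 = 1]) the fields stay between [gmin / 2] and [2 gmax], their
    slopes are [O(M)] and their clocks are off by [O(M^-2)], which fits into the margin [eta]. That
    [alpha <= M^-2] comes from the rates: the noise term asks for [M^7 ln n = o(n)], the sieve bias
    for [p >= 3], and the lower bound on [M] reduces the endpoint error to the noise. The bound
    [eta << 1 / M] keeps the energy of [g_theta] near the ends of the sieve interval, where no
    trajectory passes, below half of the lower bound [cl |theta|^2] on its total. *)

Lemma is_derive_linear (R : realType) (c z : R) :
  is_derive z 1 (fun x : R => c * x) c.
Proof.
have did : is_derive z 1 (id : R -> R) 1 by exact: is_derive_id.
have -> : (fun x : R => c * x) = c \*: (id : R -> R) by [].
by have := is_deriveZ c did; rewrite /GRing.scale/= mulr1.
Qed.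

(** * Comparison of functions through their derivatives *)

Section Calculus.
Context {R : realType}.
Implicit Types (f F : R -> R) (a b : R).

Lemma derive_ge0_le f (df : R -> R) a b : a <= b ->
  (forall x, x \in `]a, b[ -> is_derive x 1 f (df x)) ->
  {within `[a, b], continuous f} ->
  (forall x, x \in `]a, b[ -> 0 <= df x) -> f a <= f b.
Proof.
rewrite le_eqVlt => /predU1P[->//|ab] dfE cf df0.
have [c cab E] := MVT ab dfE cf.
by rewrite -subr_ge0 E mulr_ge0 ?df0// subr_ge0 ltW.
Qed.

Lemma derive_within_continuous f (df : R -> R) a b :
  (forall x, x \in `[a, b] -> is_derive x 1 f (df x)) ->
  {within `[a, b], continuous f}.
Proof.
move=> dfE; apply: derivable_within_continuous => x xab.
by have [] := dfE _ xab.
Qed.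

(** Stands in for the monotonicity of the integral: most integrals below enter as functions with a
    known derivative, and bounds on them are comparisons of increments. *)
Lemma derive_le f g (df dg : R -> R) a b : a <= b ->
  (forall x, x \in `]a, b[ -> is_derive x 1 f (df x)) ->
  (forall x, x \in `]a, b[ -> is_derive x 1 g (dg x)) ->
  {within `[a, b], continuous f} -> {within `[a, b], continuous g} ->
  (forall x, x \in `]a, b[ -> df x <= dg x) -> f b - f a <= g b - g a.
Proof.
move=> ab df_ dg_ cf cg le_.
have h : (g - f) a <= (g - f) b.
  apply: (@derive_ge0_le _ (dg - df)) => //.
  - by move=> x xab; have := df_ _ xab; have := dg_ _ xab => ? ?; exact: is_deriveB.
  - by move=> x; apply: cvgB; [exact: cg|exact: cf].
  - by move=> x xab; rewrite /GRing.add/= subr_ge0 le_.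
by move: h; rewrite !fctE; lra.
Qed.

Section primitive.
Variables (f : R -> R) (a b : R).
Hypotheses (ab : a < b) (cf : {within `[a, b], continuous f}).

Definition primitive (x : R) := (\int[lebesgue_measure]_(t in `[a, x]) f t)%R.

Let intf : (@lebesgue_measure R).-integrable `[a, b] (EFin \o f).
Proof. by apply: continuous_compact_integrable => //; exact: segment_compact. Qed.

Lemma primitive_derive x : x \in `]a, b[ -> is_derive x 1 primitive (f x).
Proof.
move=> xab; move: (xab); rewrite in_itv/= => /andP[ax xb].
have [] := @continuous_FTC1_closed R f a x b xb intf ax.
  by have /(continuous_within_itvP _ ab)[cf' _ _] := cf; exact: cf'.
by move=> D E; apply: DeriveDef => //; rewrite -E derive1E.
Qed.

Lemma primitive_continuous : {within `[a, b], continuous primitive}.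
Proof. by apply: parameterized_integral_continuous => //; exact: ltW. Qed.

Lemma primitive0 : primitive a = 0.
Proof. by rewrite /primitive set_itv1 Rintegral_set1. Qed.

End primitive.

(** Removes the free weight [nu] from an arithmetic-geometric mean bound, which yields
    Cauchy-Schwarz. The weight [d / p] replaces the optimal [sqrt (q / p)] and needs no root; when
    [p = 0], the weight [(q + 1) / d] gives [d <= d / 2]. *)
Lemma sqr_le_of_amgm (d p q : R) : 0 <= p -> 0 <= q ->
  (forall nu, 0 < nu -> d <= (nu * p + q / nu) / 2) -> 0 <= d -> d ^+ 2 <= p * q.
Proof.
move=> p0 q0 H d0; rewrite leNgt; apply/negP => lt.
have dp : 0 < d.
  by rewrite lt_neqAle d0 andbT; apply/eqP => d0'; move: lt; rewrite -d0' expr0n/= ltNge mulr_ge0.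
have [p00|p00] := eqVneq p 0.
  have q1 : 0 < q + 1 by lra.
  have := H ((q + 1) / d) (divr_gt0 q1 dp); rewrite p00 mulr0 add0r.
  suff : q / ((q + 1) / d) <= d by lra.
  by rewrite invf_div mulrA ler_pdivrMr// mulrC ler_wpM2l; lra.
have pp : 0 < p by rewrite lt_neqAle eq_sym p00.
have := H (d / p) (divr_gt0 dp pp).
rewrite divfK ?gt_eqF// invf_div mulrA ler_pdivlMr// -subr_ge0.
have -> : d + q * p / d - d * 2 = (p * q - d ^+ 2) / d by field; rewrite gt_eqF.
by rewrite pmulr_lge0 ?invr_gt0// subr_ge0 leNgt lt.
Qed.
End Calculus.

(** * Quadratic forms *)

Section QuadraticForms.
Context {R : realType}.

Lemma cvg_sumr {T : Type} (F : set_system T) {FF : Filter F} (I : Type)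
    (r : seq I) (f : I -> T -> R) (l : I -> R) :
  (forall i, f i x @[x --> F] --> l i) ->
  \sum_(i <- r) f i x @[x --> F] --> \sum_(i <- r) l i.
Proof. by move=> h; apply: cvg_big => [|i _]; [exact: add_continuous|exact: h]. Qed.

Definition sqn m (v : 'rV[R]_m) : R := \sum_(k < m) v 0 k ^+ 2.

Lemma sqn_ge0 m (v : 'rV[R]_m) : 0 <= sqn v.
Proof. by apply: sumr_ge0 => k _; rewrite sqr_ge0. Qed.

Lemma sqnZ m (c : R) (v : 'rV[R]_m) : sqn (c *: v) = c ^+ 2 * sqn v.
Proof. by rewrite /sqn big_distrr/=; apply: eq_bigr => k _; rewrite mxE exprMn. Qed.

Lemma sqn_eq0 m (v : 'rV[R]_m) : sqn v = 0 -> v = 0.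
Proof.
move=> /eqP; rewrite psumr_eq0; last by move=> k _; rewrite sqr_ge0.
move=> /allP h; apply/rowP => k; rewrite mxE.
by have := h k (mem_index_enum _); rewrite sqrf_eq0 => /eqP.
Qed.

Lemma coord_le_sqn m (v : 'rV[R]_m) k : v 0 k ^+ 2 <= sqn v.
Proof. by rewrite /sqn (bigD1 k)//= lerDl sumr_ge0// => i _; rewrite sqr_ge0. Qed.

Lemma sqn_continuous m : continuous (@sqn m).
Proof.
move=> v; apply: (@cvg_sumr _ (nbhs v)) => k.
by under eq_fun do rewrite expr2; apply: cvgM; exact: coord_continuous.
Qed.

Lemma rV_norm_le m (v : 'rV[R]_m) (r : R) : 0 <= r ->
  (forall k, `|v 0 k| <= r) -> `|v| <= r.
Proof.
move=> r0 h; rewrite -[`|v|]/(mx_norm v).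
have [->//|] := eqVneq (mx_norm v) 0.
by move=> /mx_norm_neq0[[i k] ->]; rewrite /= ord1.
Qed.

Lemma sqn_bounded_compact m (A : set 'rV[R]_m) (r : R) : closed A ->
  (forall v, A v -> sqn v <= r) -> compact A.
Proof.
move=> cA Ar; apply: bounded_closed_compact => //.
exists (1 + `|r|); split; first by rewrite num_real.
move=> M ltM v /Ar vr; have M1 : 1 + `|r| <= M by exact: ltW.
have r0 := normr_ge0 r; apply: rV_norm_le; first by lra.
move=> k; have := le_trans (coord_le_sqn v k) vr.
rewrite -real_normK ?num_real// => h; have := ler_norm r.
have := normr_ge0 (v 0 k); nra.
Qed.

Lemma closed_sqn_ball m (c : 'rV[R]_m) (r : R) : closed [set v | sqn (v - c) <= r].
Proof.
have -> : [set v | sqn (v - c) <= r] = (fun v => sqn (v - c)) @^-1` [set x | x <= r] by [].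
apply: closed_comp; last exact: closed_le.
move=> v _; apply: (@cvg_sumr _ (nbhs v)) => k.
under eq_fun do rewrite !mxE expr2; rewrite !mxE expr2.
by apply: cvgM; (apply: cvgD; [exact: coord_continuous|exact: cvg_cst]).
Qed.

Section rayleigh.
Variables (m : nat) (A : 'M[R]_m).
Hypothesis symA : A^T = A.

Let b (v w : 'rV[R]_m) : R := (v *m A *m w^T) 0 0.

Let bDl u v w : b (u + v) w = b u w + b v w.
Proof. by rewrite /b !mulmxDl mxE. Qed.
Let bDr u v w : b w (u + v) = b w u + b w v.
Proof. by rewrite /b linearD/= mulmxDr mxE. Qed.
Let bZl c v w : b (c *: v) w = c * b v w.
Proof. by rewrite /b -!scalemxAl mxE. Qed.
Let bZr c v w : b v (c *: w) = c * b v w.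
Proof. by rewrite /b linearZ/= -scalemxAr mxE. Qed.
Let bC v w : b v w = b w v.
Proof.
rewrite /b -[in LHS](trmxK (v *m A *m w^T)) [in LHS]mxE.
by rewrite !trmx_mul trmxK symA mulmxA.
Qed.

Let b_continuous : continuous (fun v => b v v).
Proof.
have E w : b w w = \sum_k (\sum_l w 0 l * A l k) * w 0 k.
  by rewrite /b mxE; apply: eq_bigr => k _; rewrite !mxE.
move=> v; rewrite /continuous_at E; under eq_fun do rewrite E.
apply: (@cvg_sumr _ (nbhs v)) => k; apply: cvgM; last exact: coord_continuous.
apply: (@cvg_sumr _ (nbhs v)) => l; apply: cvgM; last exact: cvg_cst.
exact: coord_continuous.
Qed.

(** Variational argument: a minimiser [u] of the form on the compact unit sphere satisfies a
    first-order condition, which says that [u] is an eigenvector for the minimum value [mu]; the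
    hypothesis on the eigenvalues then gives [c <= mu]. *)
Lemma rayleigh_min (c : R) : (forall l, eigenvalue A l -> c <= l) ->
  forall v, c * sqn v <= b v v.
Proof.
move=> hc v; have [v0|v0] := eqVneq v 0.
  by rewrite v0 -(scale0r v) bZl sqnZ; lra.
have sv : 0 < sqn v.
  by rewrite lt_neqAle sqn_ge0 andbT eq_sym; apply: contra_neq v0; exact: sqn_eq0.
pose S : set 'rV[R]_m := [set w | sqn w = 1].
have vS : S ((Num.sqrt (sqn v))^-1 *: v).
  by rewrite /S/= sqnZ exprVn sqr_sqrtr ?ltW// mulVf ?gt_eqF.
have cS : compact S.
  apply: (@sqn_bounded_compact _ _ 1) => [|w ->//].
  apply: (@closed_comp _ _ (@sqn m) [set x | x = 1]).
    by move=> w _; exact: sqn_continuous.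
  exact: closed_eq.
have [||u /set_mem uS umin] := @compact_EVT_min _ R (fun w => b w w) S _ cS.
- by eexists; exact: vS.
- by apply: continuous_subspaceT => x; exact: b_continuous.
pose mu := b u u.
(* Homogeneity carries minimality from the sphere to all vectors. *)
have psd w : mu * sqn w <= b w w.
  have [->|w0] := eqVneq w 0; first by rewrite -(scale0r v) bZl sqnZ; lra.
  have sw : 0 < sqn w.
    by rewrite lt_neqAle sqn_ge0 andbT eq_sym; apply: contra_neq w0; exact: sqn_eq0.
  have := umin ((Num.sqrt (sqn w))^-1 *: w).
  have wS : (Num.sqrt (sqn w))^-1 *: w \in S.
    by apply/mem_set; rewrite /S/= sqnZ exprVn sqr_sqrtr ?ltW// mulVf ?gt_eqF.
  move=> /(_ wS).
  rewrite bZl bZr mulrA -expr2 exprVn (sqr_sqrtr (ltW sw)) -/mu.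
  by rewrite ler_pdivlMl// mulrC.
have d w t : sqn (u + t *: w) = 1 + 2 * t * (u *m w^T) 0 0 + t ^+ 2 * sqn w.
  rewrite -{1}uS /sqn mxE !big_distrr/= -!big_split/=; apply: eq_bigr => j _.
  by rewrite !mxE; ring.
have orth w : b u w = mu * (u *m w^T) 0 0.
  pose x := b u w - mu * (u *m w^T) 0 0; pose y := b w w - mu * sqn w.
  have y0 : 0 <= y by rewrite subr_ge0.
  (* A quadratic polynomial without constant term that is nonnegative everywhere has no linear term.
     The test value used below has denominator [y + 1] because [y] may vanish. *)
  have h t : 0 <= 2 * t * x + t ^+ 2 * y.
    have := psd (u + t *: w).
    rewrite d bDl !bDr !bZl !bZr (bC w u) -/mu /x /y; nra.
  suff : x = 0 by rewrite /x; lra.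
  have := h (- x / (y + 1)).
  have -> : 2 * (- x / (y + 1)) * x + (- x / (y + 1)) ^+ 2 * y
          = - (x ^+ 2 * ((y + 2) / (y + 1) ^+ 2)).
    by field; lra.
  rewrite oppr_ge0 pmulr_lle0 ?divr_gt0 ?exprn_gt0//; try lra.
  by move=> x2; apply/eqP; rewrite -sqrf_eq0 eq_le x2 sqr_ge0.
have /hc cmu : eigenvalue A mu.
  apply/eigenvalueP; exists u; last first.
    by apply/eqP => u0; move: uS; rewrite /S/= u0 -(scale0r v) sqnZ; lra.
  apply/rowP => k; have := orth (delta_mx 0 k).
  have e (M : 'rV[R]_m) : (M *m (delta_mx 0 k)^T) 0 0 = M 0 k.
    rewrite mxE (bigD1 k)//= !mxE !eqxx mulr1 big1 ?addr0// => j jk.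
    by rewrite !mxE (negbTE jk) andbF mulr0.
  by rewrite /b !e => ->; rewrite mxE.
apply: le_trans (psd v).
by rewrite ler_wpM2r// sqn_ge0.
Qed.

End rayleigh.

Lemma rayleigh m (A : 'M[R]_m) (cl cu : R) : A^T = A ->
  (forall l, eigenvalue A l -> cl <= l <= cu) ->
  forall v : 'rV[R]_m, cl * sqn v <= (v *m A *m v^T) 0 0 <= cu * sqn v.
Proof.
move=> symA h v; apply/andP; split.
  by apply: rayleigh_min => // l /h /andP[].
have : - cu * sqn v <= (v *m (- A) *m v^T) 0 0.
  apply: rayleigh_min; first by rewrite linearN/= symA.
  move=> l /eigenvalueP[w wE w0]; have /h/andP[_] : eigenvalue A (- l).
    by apply/eigenvalueP; exists w => //; rewrite scaleNr -wE mulmxN opprK.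
  by lra.
by rewrite mulmxN mulNmx mxE; lra.
Qed.

Lemma sum_cauchy_schwarz (I : finType) (u v : I -> R) :
  (\sum_i u i * v i) ^+ 2 <= (\sum_i u i ^+ 2) * (\sum_i v i ^+ 2).
Proof.
rewrite -real_normK ?num_real//; apply: sqr_le_of_amgm => //.
- by apply: sumr_ge0 => i _; rewrite sqr_ge0.
- by apply: sumr_ge0 => i _; rewrite sqr_ge0.
move=> nu nu0; apply: le_trans (ler_norm_sum _ _ _) _.
rewrite mulr_sumr mulr_suml -big_split/= mulr_suml; apply: ler_sum => i _.
rewrite normrM -[u i ^+ 2]real_normK ?num_real// -[v i ^+ 2]real_normK ?num_real//.
set p := `|u i|; set q := `|v i|.
rewrite -subr_ge0.
have -> : (nu * p ^+ 2 + q ^+ 2 / nu) / 2 - p * q = (nu * p - q) ^+ 2 / nu / 2.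
  by field; rewrite gt_eqF.
by rewrite !divr_ge0 ?sqr_ge0// ltW.
Qed.

End QuadraticForms.

(** * The sieve *)

Section IntegralsOfContinuousFunctions.
Context {R : realType}.
Variables (a b : R).
Local Notation mu := (@lebesgue_measure R).

Lemma within_integrable (f : R -> R) : {within `[a, b], continuous f} ->
  mu.-integrable `[a, b] (EFin \o f).
Proof.
by move=> cf; apply: continuous_compact_integrable => //; exact: segment_compact.
Qed.

Lemma within_continuous_sum (I : Type) (r : seq I) (f : I -> R -> R) :
  (forall i, {within `[a, b], continuous (f i)}) ->
  {within `[a, b], continuous (fun x => \sum_(i <- r) f i x)}.
Proof. by move=> cf x; apply: (@cvg_sumr _ _ (nbhs x)) => i; exact: cf. Qed.

Lemma within_continuousM (f g : R -> R) :
  {within `[a, b], continuous f} -> {within `[a, b], continuous g} ->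
  {within `[a, b], continuous (fun x => f x * g x)}.
Proof. by move=> cf cg x; apply: cvgM; [exact: cf|exact: cg]. Qed.

Lemma Rintegral_sum (I : Type) (r : seq I) (f : I -> R -> R) :
  (forall i, {within `[a, b], continuous (f i)}) ->
  (\int[mu]_(x in `[a, b]) \sum_(i <- r) f i x)%R =
  \sum_(i <- r) (\int[mu]_(x in `[a, b]) f i x)%R.
Proof.
move=> cf; elim: r => [|i r IH].
  by under eq_Rintegral do rewrite big_nil; rewrite big_nil Rintegral_cst// mul0r.
under eq_Rintegral do rewrite big_cons.
rewrite big_cons RintegralD ?IH//; first exact: within_integrable.
exact/within_integrable/within_continuous_sum.
Qed.

End IntegralsOfContinuousFunctions.

Section Sieve.
Context {R : realType}.
Variables (K cl cu a b : R) (m : nat) (phi : 'I_m -> R -> R).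
Hypotheses (sb : sieve_basis K cl cu a b phi) (ab : a < b) (K0 : 0 < K)
  (m0 : (0 < m)%N).
Local Notation mu := (@lebesgue_measure R).

(** Unlike [gbeta], this combination is not frozen outside [[a, b]], so that up to order two it has
    genuine derivatives at the endpoints as well. Estimates are made with it and transferred to
    [gbeta] inside the interval. *)
Definition scomb (j : nat) (beta : 'rV[R]_m) (x : R) : R :=
  \sum_(k < m) beta 0 k * derive1n j (phi k) x.

Lemma scombB j beta gamma x :
  scomb j (beta - gamma) x = scomb j beta x - scomb j gamma x.
Proof.
by rewrite /scomb -sumrB; apply: eq_bigr => k _; rewrite !mxE mulrBl.
Qed.

Lemma phi_derive j k x : (j < 2)%N -> x \in `[a, b] ->
  is_derive x 1 (derive1n j (phi k)) (derive1n j.+1 (phi k) x).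
Proof.
move=> j2 xab; have [U [oU sU [dU _]]] := sieve_C2 sb k.
apply: DeriveDef; last by rewrite derive1nS derive1E.
by apply: dU => //; exact: sU.
Qed.

Lemma scomb_derive j beta x : (j < 2)%N -> x \in `[a, b] ->
  is_derive x 1 (scomb j beta) (scomb j.+1 beta x).
Proof.
move=> j2 xab.
have -> : scomb j beta = \sum_(k < m) (beta 0 k \*: derive1n j (phi k)).
  by apply/funext => y; rewrite fct_sumE.
apply: is_derive_sum => k; apply: is_deriveZ.
exact: phi_derive.
Qed.

(** The price of a pointwise bound: relative to the [L^2] size [sqn beta], the square loses a factor
    [m], and a further [m ^ 2] for each derivative. *)
Lemma scomb_bound j beta x : (j <= 2)%N -> x \in `[a, b] ->
  scomb j beta x ^+ 2 <= sqn beta * (K * m%:R ^+ (1 + 2 * j)).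
Proof.
move=> j2 xab; apply: le_trans (sum_cauchy_schwarz _ _) _.
rewrite ler_wpM2l ?sqn_ge0//; apply: le_trans (sieve_deriv_bound sb j2 xab).
by apply: ler_sum => k _; rewrite real_normK ?num_real.
Qed.

Lemma phi_continuous j k : (j < 2)%N ->
  {within `[a, b], continuous (derive1n j (phi k))}.
Proof. by move=> j2; apply: derive_within_continuous => x; exact: phi_derive. Qed.

Lemma scomb_continuous j beta : (j < 2)%N ->
  {within `[a, b], continuous (scomb j beta)}.
Proof. by move=> j2; apply: derive_within_continuous => x; exact: scomb_derive. Qed.

Lemma sqr_scomb_continuous j beta : (j < 2)%N ->
  {within `[a, b], continuous (fun x => scomb j beta x ^+ 2)}.
Proof.
move=> j2.
have -> : (fun x => scomb j beta x ^+ 2) = (fun x => scomb j beta x * scomb j beta x).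
  by apply/funext => x; rewrite expr2.
by apply: within_continuousM; exact: scomb_continuous.
Qed.

(** The [L^2] energy accumulated from [a]. With the upper limit as variable it can be
    differentiated, and the energy of a subinterval is a difference of two values. *)
Definition sqprim j beta := primitive (fun x => scomb j beta x ^+ 2) a.

Lemma sqprim_derive j beta x : (j < 2)%N -> x \in `]a, b[ ->
  is_derive x 1 (sqprim j beta) (scomb j beta x ^+ 2).
Proof.
move=> j2 xab; apply: (primitive_derive (f := fun x => scomb j beta x ^+ 2) ab _ xab).
exact: sqr_scomb_continuous.
Qed.

Lemma sqprim_continuous j beta : (j < 2)%N ->
  {within `[a, b], continuous (sqprim j beta)}.
Proof. by move=> j2; apply: primitive_continuous => //; exact: sqr_scomb_continuous. Qed.

Lemma sqprim_le j beta x y (w : R) : (j < 2)%N -> a <= x -> x <= y -> y <= b ->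
  (forall z, z \in `]x, y[ -> scomb j beta z ^+ 2 <= w) ->
  sqprim j beta y - sqprim j beta x <= w * (y - x).
Proof.
move=> j2 ax xy yb hw; pose h z := w * z.
have dh (z : R) : is_derive z (1 : R) h w by exact: is_derive_linear.
have cPh : {within `[x, y], continuous (sqprim j beta)}.
  have cs := @sqprim_continuous _ beta j2.
  by apply: continuous_subspaceW cs; apply: subset_itv; rewrite bnd_simp.
have sub z : z \in `]x, y[ -> z \in `]a, b[.
  by rewrite !in_itv/= => /andP[xz zy]; rewrite (le_lt_trans ax)//= (lt_le_trans zy).
have := @derive_le R (sqprim j beta) h _ _ x y xy
  (fun z zin => sqprim_derive beta j2 (sub z zin)) (fun z _ => dh z) cPh
  (derive_within_continuous (fun z _ => dh z)) hw.
by rewrite /h -mulrBr.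
Qed.

Lemma sqprim_ge0 j beta x y : (j < 2)%N -> a <= x -> x <= y -> y <= b ->
  sqprim j beta x <= sqprim j beta y.
Proof.
move=> j2 ax xy yb.
have d z : z \in `]x, y[ -> is_derive z 1 (sqprim j beta) (scomb j beta z ^+ 2).
  rewrite in_itv/= => /andP[uz zw]; apply: sqprim_derive => //.
  by rewrite in_itv/= (le_lt_trans ax)//= (lt_le_trans zw).
have cs : {within `[x, y], continuous (sqprim j beta)}.
  have cs := @sqprim_continuous _ beta j2.
  by apply: continuous_subspaceW cs; apply: subset_itv; rewrite bnd_simp.
exact: (derive_ge0_le xy d cs (fun z _ => sqr_ge0 (scomb j beta z))).
Qed.

Lemma sqprim_start j beta : sqprim j beta a = 0. Proof. exact: primitive0. Qed.

Lemma sqprim_increment j beta x y : (j < 2)%N -> a <= x -> x <= y -> y <= b ->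
  0 <= sqprim j beta y - sqprim j beta x <= sqprim j beta b.
Proof.
move=> j2 ax xy yb.
have h1 := sqprim_ge0 beta j2 ax xy yb.
have h2 := sqprim_ge0 beta j2 (lexx a) ax (le_trans xy yb).
have h3 := sqprim_ge0 beta j2 (le_trans ax xy) yb (lexx b).
by rewrite sqprim_start in h2; lra.
Qed.

Lemma sqprim0E beta :
  sqprim 0 beta b = (beta *m gram a b phi *m beta^T) 0 0.
Proof.
have cphi k l : {within `[a, b], continuous (fun x => phi k x * phi l x)}.
  by apply: within_continuousM; exact: (@phi_continuous 0).
rewrite /sqprim /primitive.
have E x : scomb 0 beta x ^+ 2 =
    \sum_(l < m) \sum_(k < m) (beta 0 k * beta 0 l) * (phi k x * phi l x).
  rewrite /scomb expr2 big_distrr/=; apply: eq_bigr => l _.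
  by rewrite big_distrl/=; apply: eq_bigr => k _; ring.
under eq_Rintegral do rewrite E.
have cphi' k l : {within `[a, b],
    continuous (fun x => (beta 0 k * beta 0 l) * (phi k x * phi l x))}.
  by apply: within_continuousM => //; exact/continuous_subspaceT/cst_continuous.
rewrite Rintegral_sum; last by move=> l; exact: within_continuous_sum.
rewrite mxE; apply: eq_bigr => l _; rewrite Rintegral_sum//.
rewrite !mxE big_distrl/=; apply: eq_bigr => k _.
rewrite RintegralZl//; last exact: within_integrable.
by rewrite !mxE; ring.
Qed.

Lemma sqprim0_bounds beta : cl * sqn beta <= sqprim 0 beta b <= cu * sqn beta.
Proof.
rewrite sqprim0E; apply: rayleigh; last exact: sieve_gram sb.
apply/matrixP => k l; rewrite !mxE.
by apply: eq_Rintegral => x _; rewrite mulrC.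
Qed.

(** The support is closed, so off it the function vanishes on a whole neighbourhood. The point is
    interior because nothing is known of [phi k] beyond [a] and [b]. *)
Lemma phi_derive_supp k x : x \in `]a, b[ -> x \notin supp_in a b (phi k) ->
  derive1n 1 (phi k) x = 0.
Proof.
move=> xab; rewrite notin_setE => xS.
have opn : \forall y \near x, y \in `]a, b[.
  by apply: near_in_itvoo.
have nS : \forall y \near x, ~ supp_in a b (phi k) y.
  have /closed_openC : closed (supp_in a b (phi k)) by exact: closed_closure.
  by rewrite openE => /(_ _ xS).
rewrite derive1n1 derive1E -[RHS](@derive_cst R R R 0 x 1); apply: near_eq_derive.
near=> y.
apply: contrapT => yN; have : supp_in a b (phi k) y.
  apply: subset_closure; split => /=; last exact/eqP.
  by apply: subset_itv_oo_cc; near: y.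
by near: y.
Unshelve. all: by end_near. Qed.

(* Cauchy-Schwarz against the indicators of the supports: no bound on the
   number of overlapping supports is needed. *)
Lemma scomb1_pointwise beta x : x \in `]a, b[ ->
  scomb 1 beta x ^+ 2 <=
  \sum_(k < m) K * m%:R ^+ 3 * beta 0 k ^+ 2 * \1_(supp_in a b (phi k)) x.
Proof.
move=> xab; have -> : scomb 1 beta x = \sum_(k < m)
    (beta 0 k * \1_(supp_in a b (phi k)) x) * derive1n 1 (phi k) x.
  apply: eq_bigr => k _; rewrite indicE.
  have [xS|xS] := boolP (x \in supp_in a b (phi k)); first by rewrite mulr1.
  by rewrite phi_derive_supp// !mulr0.
apply: le_trans (sum_cauchy_schwarz _ _) _.
have h : \sum_(k < m) derive1n 1 (phi k) x ^+ 2 <= K * m%:R ^+ 3.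
  apply: le_trans (sieve_deriv_bound sb (j := 1) (x := x) _ _) => //.
    by apply: ler_sum => k _; rewrite real_normK ?num_real.
  exact: subset_itv_oo_cc.
apply: le_trans (ler_wpM2l _ h) _.
  by apply: sumr_ge0 => k _; rewrite sqr_ge0.
rewrite mulr_suml; apply: ler_sum => k _; rewrite exprMn indicE.
by case: (_ \in _); rewrite ?expr1n ?expr0n/= ?mulr1 ?mulr0 ?mul0r// mulrC.
Qed.

(** An inverse inequality of Bernstein type: each coefficient contributes [K m^3 beta_k^2] on a
    support of length at most [K / m]. Integrating the bound [scomb_bound] instead would leave
    [m ^ 3] in place of [m ^ 2]. *)
Lemma sqprim1_bound beta : sqprim 1 beta b <= K ^+ 2 * m%:R ^+ 2 * sqn beta.
Proof.
have intf : mu.-integrable `[a, b] (EFin \o (fun x => scomb 1 beta x ^+ 2)).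
  exact/within_integrable/sqr_scomb_continuous.
have mS k : measurable (supp_in a b (phi k)).
  by apply: closed_measurable; exact: closed_closure.
pose c k := K * m%:R ^+ 3 * beta 0 k ^+ 2.
have c0 k : 0 <= c k by rewrite /c mulr_ge0 ?sqr_ge0// mulr_ge0 ?exprn_ge0// ltW.
rewrite -lee_fin /sqprim /primitive /Rintegral fineK; last first.
  exact: integrable_fin_num.
have mf : measurable_fun `]a, b[ (EFin \o (fun x => scomb 1 beta x ^+ 2)).
  apply: measurable_funS (measurable_int _ intf) => //.
  exact: subset_itv_oo_cc.
(* The pointwise bound holds in the open interval only; the endpoints are negligible. *)
rewrite (integral_itv_bndoo _ _ mf).
have mind k : measurable_fun `]a, b[
    (fun x => ((c k)%:E * (\1_(supp_in a b (phi k)) x)%:E)%E : \bar R).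
  apply: measurable_funeM; apply/measurable_EFinP.
  exact/measurable_funTS/measurable_indic.
have ind0 k x : (0 <= (c k)%:E * (\1_(supp_in a b (phi k)) x)%:E :> \bar R)%E.
  by rewrite mule_ge0// lee_fin.
apply: (@le_trans _ _ (\int[mu]_(x in `]a, b[)
    \sum_(k <- index_enum 'I_m) ((c k)%:E * (\1_(supp_in a b (phi k)) x)%:E))%E).
  apply: ge0_le_integral => //.
  - by move=> x _; rewrite lee_fin sqr_ge0.
  - by apply: emeasurable_sum.
  move=> x xab; rewrite sumEFin lee_fin.
  exact: scomb1_pointwise.
rewrite ge0_integral_sum//.
have -> : (K ^+ 2 * m%:R ^+ 2 * sqn beta)%:E =
    (\sum_(k <- index_enum 'I_m) (c k * (K / m%:R))%:E)%E.
  rewrite sumEFin; congr (_%:E).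
  rewrite /sqn big_distrr/=; apply: eq_bigr => k _; rewrite /c.
  by field; rewrite pnatr_eq0 -lt0n.
apply: lee_sum => k _.
rewrite ge0_integralZl_EFin//; last first.
  by apply/measurable_EFinP/measurable_funTS; apply: measurable_indic; exact: mS.
rewrite integral_indic//; last exact: mS.
rewrite (EFinM (c k)); apply: lee_wpmul2l; first by rewrite lee_fin.
apply: le_trans (sieve_support_length sb k).
by apply: le_measure; rewrite ?inE//; try (apply: measurableI => //); exact: mS.
Qed.

Lemma gbetaE beta x : x \in `[a, b] -> gbeta a b phi beta x = scomb 0 beta x.
Proof.
rewrite in_itv/= => /andP[ax xb].
by rewrite /gbeta /extend_cst (min_idPl xb) (max_idPr ax).
Qed.

Lemma near_gbetaE beta x : x \in `]a, b[ ->
  \forall y \near x, gbeta a b phi beta y = scomb 0 beta y.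
Proof.
move=> xab; have : \forall y \near x, y \in `]a, b[ by exact: near_in_itvoo.
by apply: filterS => y yab; apply/gbetaE/subset_itv_oo_cc.
Qed.

Lemma gbeta_derive1 beta x : x \in `]a, b[ ->
  derive1n 1 (gbeta a b phi beta) x = scomb 1 beta x.
Proof.
move=> xab; rewrite derive1n1 derive1E (near_eq_derive _ (near_gbetaE beta xab)).
have := @scomb_derive 0 beta x isT (subset_itv_oo_cc xab).
by move=> h; rewrite derive_val.
Qed.

End Sieve.

(** * Clocks of scalar differential equations *)

Section Clock.
Context {R : realType}.
Implicit Types (F X G f : R -> R).

Lemma extend_cst_continuous (lo hi : R) f : lo <= hi ->
  (forall x, x \in `[lo, hi] -> {for x, continuous f}) ->
  continuous (extend_cst lo hi f).
Proof.
move=> lohi cf x; apply: (@continuous_comp _ _ _ (fun x => Num.max lo (Num.min x hi)) f).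
  apply: (@continuous_max _ _ (cst lo) (fun x => Num.min x hi)); first exact: cst_continuous.
  by apply: (@continuous_min _ _ id (cst hi)); [exact: cvg_id|exact: cst_continuous].
by apply: cf; rewrite in_itv/= le_max lexx/= ge_max lohi ge_min lexx orbT.
Qed.

Lemma stays_inside X (t0 s lo hi : R) : t0 <= s ->
  {within `[t0, s], continuous X} -> lo < X t0 < hi ->
  (forall t, t \in `[t0, s] -> X t != lo /\ X t != hi) -> lo < X s < hi.
Proof.
move=> t0s cX /andP[loX Xhi] h; apply/andP; split; rewrite ltNge; apply/negP => le.
- have [|c cin /eqP cE] := IVT t0s cX (v := lo).
    by rewrite ge_min le orbT/= le_max (ltW loX).
  by have [] := h _ cin; rewrite cE.
- have [|c cin /eqP cE] := IVT t0s cX (v := hi).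
    by rewrite ge_min (ltW Xhi)/= le_max le orbT.
  by have [_] := h _ cin; rewrite cE.
Qed.

(** By the chain rule [F \o X] has derivative [(G X)^-1 * G X = 1]; two comparisons with the
    identity, one in each direction, give the equality. *)
Lemma clock_eq F X G (t0 t1 lo hi v : R) : t0 <= t1 ->
  {within `[t0, t1], continuous X} -> X t0 = v ->
  (forall t, t0 < t < t1 -> is_derive t 1 X (G (X t))) ->
  (forall x, lo <= x <= hi -> 0 < G x) ->
  (forall x, lo <= x <= hi -> is_derive x 1 F (G x)^-1) ->
  (forall t, t \in `[t0, t1] -> lo <= X t <= hi) ->
  F (X t1) = F v + (t1 - t0).
Proof.
move=> t01 cX X0 dX G0 dF hX.
have cFX : {within `[t0, t1], continuous (F \o X)}.
  apply: within_continuous_comp => // _ /set_mem[t /= tin <-].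
  have [/derivable1_diffP/differentiable_continuous h _] := dF _ (hX _ tin).
  exact: h.
have dFX t : t \in `]t0, t1[ -> is_derive t 1 (F \o X) 1.
  move=> tin; have XE := hX _ (subset_itv_oo_cc tin).
  move: tin; rewrite in_itv/= => tin.
  have /= := is_derive1_comp (dF _ XE) (dX _ tin).
  by rewrite mulVf// gt_eqF// G0.
have := @derive_le R (F \o X) id (cst 1) (cst 1) t0 t1 t01 dFX _ cFX _ _.
have := @derive_le R id (F \o X) (cst 1) (cst 1) t0 t1 t01 _ dFX _ cFX _.
have did t : t \in `]t0, t1[ -> is_derive t 1 id (1 : R) by move=> _; exact: is_derive_id.
have cid : {within `[t0, t1], continuous (id : R -> R)}.
  by apply: continuous_subspaceT => x; exact: cvg_id.
move=> /(_ did cid (fun _ _ => lexx _)) /= h1 /(_ did cid (fun _ _ => lexx _)) /= h2.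
by rewrite -X0; lra.
Qed.

(* X cannot leave ]lo, hi[: the clock F runs at unit speed along X, and it would
   need more than the available time to reach hi. *)
Lemma clock F X G (t0 t1 lo hi v : R) : t0 <= t1 ->
  solves_ode G t0 t1 v X ->
  (forall x, lo <= x <= hi -> 0 < G x) ->
  (forall x, lo <= x <= hi -> is_derive x 1 F (G x)^-1) ->
  lo < v < hi -> F v + (t1 - t0) < F hi ->
  forall t, t \in `[t0, t1] -> lo < X t < hi /\ F (X t) = F v + (t - t0).
Proof.
move=> t01 [X0 cX dX] G0 dF /andP[lov vhi] Fhi.
have lohi : lo < hi by exact: lt_trans vhi.
have sub t s : t \in `[t0, t1] -> s \in `[t0, t] -> s \in `[t0, t1].
  rewrite !in_itv/= => /andP[_ tt1] /andP[-> st]; exact: le_trans tt1.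
have cXt t : t \in `[t0, t1] -> {within `[t0, t], continuous X}.
  by move=> tin; apply: continuous_subspaceW cX => s /=; exact: sub.
have dXt t : t \in `[t0, t1] -> forall s, t0 < s < t -> is_derive s 1 X (G (X s)).
  rewrite in_itv/= => /andP[_ tt1] s /andP[t0s st]; apply: dX.
  by rewrite t0s (lt_le_trans st).
(* The times at which [X] meets [lo] or [hi] form a compact set. Up to its least element [tm] the
   path stays in [[lo, hi]], so the clock can be read at [tm], and each of the two values that [X]
   may take there is contradictory. *)
have noexit t : t \in `[t0, t1] -> X t != lo /\ X t != hi.
  move=> tin; apply: contrapT => bad.
  pose S := [set s | s \in `[t0, t1] /\ (X s = lo \/ X s = hi)].
  have tS : S t.
    split => //; have [|lo'] := eqVneq (X t) lo; first by left.
    by have [|hi'] := eqVneq (X t) hi; [right|exfalso; exact: bad].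
  have cS : compact S.
    have clC : closed [set x : R | x = lo \/ x = hi].
      by apply: closedU; exact: closed_eq.
    have /continuous_closedP/(_ _ clC)/closed_subspaceP[V cV VE] := cX.
    have -> : S = V `&` `[t0, t1].
      rewrite VE; apply/seteqP; split => s /=; last by move=> [? ?]; split.
      by move=> [? ?]; split.
    rewrite setIC; apply: subclosed_compact (@segment_compact _ t0 t1) _.
      by apply: closedI => //; exact: itv_closed.
    exact: subIsetl.
  have [||tm /set_mem[tmin tmE] tmS] := @compact_EVT_min _ R id S _ cS.
  - by exists t.
  - by apply: continuous_subspaceT => x; exact: cvg_id.
  have before s : s \in `[t0, t1] -> s < tm -> lo < X s < hi.
    move=> sin stm; apply: stays_inside (cXt _ sin) _ _.
    - by move: sin; rewrite in_itv/= => /andP[].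
    - by rewrite X0 lov vhi.
    move=> r rin; have rin' := sub _ _ sin rin.
    have rtm : r < tm by apply: le_lt_trans stm; move: rin; rewrite in_itv/= => /andP[].
    have nS : ~ S r.
      by move=> /mem_set/tmS /=; rewrite leNgt rtm.
    by split; apply/eqP => E; apply: nS; split => //; [left|right].
  have t0tm : t0 <= tm by move: tmin; rewrite in_itv/= => /andP[].
  have inside s : s \in `[t0, tm] -> lo <= X s <= hi.
    move=> sin; have sin' := sub _ _ tmin sin.
    move: sin; rewrite in_itv/= => /andP[_]; rewrite le_eqVlt => /predU1P[->|stm].
      by case: tmE => ->; rewrite lexx (ltW lohi).
    by have /andP[/ltW -> /ltW ->] := before _ sin' stm.
  have Ftm := clock_eq t0tm (cXt _ tmin) X0 (dXt _ tmin) G0 dF inside.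
  case: tmE => E; rewrite E in Ftm.
    (* Exit at [lo] would mean that the clock at [lo] is at least the clock at [v], although [F]
       increases strictly from [lo] to [v]. Exit at [hi] is excluded by the time available. *)
    have [||c] := @MVT R F (fun x => (G x)^-1) lo v lov.
    - move=> x; rewrite in_itv/= => /andP[lox xv]; apply: dF.
      by rewrite ltW//= ltW// (lt_trans xv).
    - apply: derive_within_continuous => x; rewrite in_itv/= => /andP[lox xv].
      by apply: dF; rewrite lox/= (le_trans xv)// ltW.
    rewrite in_itv/= => /andP[loc cv] Fc.
    have : 0 < (G c)^-1 * (v - lo).
      by rewrite mulr_gt0 ?subr_gt0// invr_gt0 G0// ltW//= ltW// (lt_trans cv).
    by rewrite -Fc; lra.
  by move: tmin; rewrite in_itv/= => /andP[_ ?]; lra.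
have inside t : t \in `[t0, t1] -> lo < X t < hi.
  move=> tin; apply: stays_inside (cXt _ tin) _ _.
  - by move: tin; rewrite in_itv/= => /andP[].
  - by rewrite X0 lov vhi.
  - by move=> s /(sub _ _ tin)/noexit.
move=> t tin; split; first exact: inside.
have t0t : t0 <= t by move: tin; rewrite in_itv/= => /andP[].
apply: clock_eq (cXt _ tin) X0 (dXt _ tin) G0 dF _ => // s /(sub _ _ tin)/inside.
by move=> /andP[/ltW -> /ltW ->].
Qed.

(** Cauchy-Schwarz for the integral of the derivative of [f], where [B] plays the role of a
    primitive of its square. For each weight [nu], both [f] and [- f] are compared with
    [nu / 2 * x + nu^-1 / 2 * B x]. *)
Lemma sqr_increment_le f (df B dB : R -> R) (t0 t1 s t : R) :
  t0 <= s -> s <= t -> t <= t1 ->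
  {within `[t0, t1], continuous f} -> {within `[t0, t1], continuous B} ->
  (forall x, x \in `]t0, t1[ -> is_derive x 1 f (df x)) ->
  (forall x, x \in `]t0, t1[ -> is_derive x 1 B (dB x)) ->
  (forall x, x \in `]t0, t1[ -> df x ^+ 2 <= dB x) ->
  (f t - f s) ^+ 2 <= (t - s) * (B t - B s).
Proof.
move=> t0s st tt1 cf cB hf hB hle.
have subo x : x \in `]s, t[ -> x \in `]t0, t1[.
  by rewrite !in_itv/= => /andP[sx xt]; rewrite (le_lt_trans t0s)//= (lt_le_trans xt).
have subc : `[s, t] `<=` `[t0, t1].
  by apply: subset_itv; rewrite bnd_simp.
have cf' : {within `[s, t], continuous f} by exact: continuous_subspaceW cf.
have cB' : {within `[s, t], continuous B} by exact: continuous_subspaceW cB.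
have B0 : 0 <= B t - B s.
  have := @derive_ge0_le R B dB s t st (fun x xin => hB _ (subo _ xin)) cB'.
  rewrite subr_ge0; apply => x /subo xin.
  by apply: le_trans (hle _ xin); rewrite sqr_ge0.
rewrite -real_normK ?num_real//; apply: sqr_le_of_amgm => //.
  by rewrite subr_ge0.
move=> nu nu0.
pose g x := nu / 2 * x + nu^-1 / 2 * B x.
have gE : g = (nu / 2) \*: id + (nu^-1 / 2) \*: B by exact/funext.
have dg x : x \in `]s, t[ -> is_derive x 1 g ((nu / 2) *: 1 + (nu^-1 / 2) *: dB x).
  move=> /subo xin; have dBx := hB _ xin.
  have did : is_derive x 1 (id : R -> R) 1 by exact: is_derive_id.
  by rewrite gE; apply: is_deriveD; exact: is_deriveZ.
have cg : {within `[s, t], continuous g}.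
  rewrite gE => x; apply: cvgD; apply: cvgZr; [exact: (continuous_subspaceT (fun=> cvg_id))|exact: cB'].
have key x : x \in `]s, t[ -> `|df x| <= (nu / 2) *: 1 + (nu^-1 / 2) *: dB x.
  move=> /subo xin; have := hle _ xin; rewrite -real_normK ?num_real// => h.
  rewrite /GRing.scale/= mulr1; set d := `|df x| in h *.
  have : nu^-1 / 2 * d ^+ 2 <= nu^-1 / 2 * dB x.
    by rewrite ler_wpM2l// divr_ge0// invr_ge0 ltW.
  have : 0 <= nu^-1 / 2 * (nu - d) ^+ 2.
    by rewrite mulr_ge0 ?sqr_ge0// divr_ge0// invr_ge0 ltW.
  have -> : nu^-1 / 2 * (nu - d) ^+ 2 = nu / 2 - d + nu^-1 / 2 * d ^+ 2.
    by field; rewrite gt_eqF.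
  lra.
have := @derive_le R f g df _ s t st (fun x xin => hf _ (subo _ xin)) dg cf' cg.
have := @derive_le R (- f) g (- df) _ s t st _ dg _ cg _.
have dNf x : x \in `]s, t[ -> is_derive x 1 (- f) ((- df) x).
  by move=> /subo xin; apply: is_deriveN; exact: hf.
have cNf : {within `[s, t], continuous (- f)}.
  by move=> x; apply: cvgN; exact: cf'.
move=> /(_ dNf cNf) h1 h2.
have {}h2 : f t - f s <= g t - g s.
  by apply: h2 => x xin; apply: le_trans (key _ xin); rewrite ler_norm.
have {}h1 : (- f) t - (- f) s <= g t - g s.
  by apply: h1 => x xin; apply: le_trans (key _ xin); rewrite -normrN ler_norm.
have -> : (nu * (t - s) + (B t - B s) / nu) / 2 = g t - g s.
  by rewrite /g; field; rewrite gt_eqF.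
rewrite ler_norml h2 andbT; move: h1; rewrite !fctE; lra.
Qed.

End Clock.

(** * Comparison of two trajectories *)

Section Trajectories.
Context {R : realType}.
Variables (K cl cu a b : R) (m : nat) (phi : 'I_m -> R -> R).
Hypotheses (sb : sieve_basis K cl cu a b phi) (ab : a < b) (K0 : 0 < K)
  (m0 : (0 < m)%N).
Variables (lo hi gam Gam t0 t1 : R).
Hypotheses (alo : a < lo) (lohi : lo < hi) (hib : hi < b) (gam0 : 0 < gam)
  (gamGam : gam <= Gam) (t01 : t0 < t1).

Let Gam0 : 0 < Gam. Proof. exact: lt_le_trans gamGam. Qed.

Local Notation s := (scomb phi 0).

Lemma sub_lohi x : x \in `[lo, hi] -> x \in `]a, b[.
Proof.
by rewrite !in_itv/= => /andP[lox xhi]; rewrite (lt_le_trans alo)//= (le_lt_trans xhi).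
Qed.

Let sub_c x : x \in `[lo, hi] -> x \in `[a, b].
Proof. by move=> /sub_lohi; exact: subset_itv_oo_cc. Qed.

Definition admissible (beta : 'rV[R]_m) :=
  forall x, x \in `[lo, hi] -> gam <= s beta x <= Gam.

Lemma admissible_gt0 beta x : admissible beta -> x \in `[lo, hi] -> 0 < s beta x.
Proof. by move=> adm /adm /andP[h _]; exact: lt_le_trans h. Qed.

(** The integrand is extended by constants and the base point lies one unit below [lo], so that the
    clock is differentiable on both sides at every point of the closed interval, endpoints
    included. *)
Definition clockf (beta : 'rV[R]_m) :=
  primitive (extend_cst lo hi (fun x => (s beta x)^-1)) (lo - 1).

Lemma clockf_derive beta x : admissible beta -> x \in `[lo, hi] ->
  is_derive x 1 (clockf beta) (s beta x)^-1.
Proof.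
move=> adm xin; have sE : (s beta x)^-1 = extend_cst lo hi (fun x => (s beta x)^-1) x.
  move: xin; rewrite in_itv/= => /andP[lox xhi].
  by rewrite /extend_cst (min_idPl xhi) (max_idPr lox).
rewrite sE; apply: (@primitive_derive _ _ _ (hi + 1)).
- by move: lohi; lra.
- apply/continuous_subspaceT/extend_cst_continuous; first exact: ltW.
  move=> y yin; apply: cvgV; first by rewrite gt_eqF// admissible_gt0.
  have [/derivable1_diffP/differentiable_continuous h _] :=
    scomb_derive sb beta (j := 0) isT (sub_c yin).
  exact: h.
- by move: xin; rewrite !in_itv/=; lra.
Qed.

Lemma clockf_increment beta x y : admissible beta -> lo <= x -> x <= y -> y <= hi ->
  (y - x) / Gam <= clockf beta y - clockf beta x <= (y - x) / gam.
Proof.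
move=> adm lox xy yhi.
have sub z : z \in `[x, y] -> z \in `[lo, hi].
  by rewrite !in_itv/= => /andP[xz zy]; rewrite (le_trans lox)//= (le_trans zy).
have [c /sub cin ->] := MVT_segment xy
  (fun z zin => clockf_derive adm (sub z (subset_itv_oo_cc zin)))
  (derive_within_continuous (fun z zin => clockf_derive adm (sub z zin))).
have sp := admissible_gt0 adm cin; have /andP[h1 h2] := adm _ cin.
by rewrite ![(y - x) / _]mulrC !ler_wpM2r ?subr_ge0// lef_pV2.
Qed.

Lemma clockf_dist beta x y : admissible beta ->
  x \in `[lo, hi] -> y \in `[lo, hi] ->
  `|y - x| <= Gam * `|clockf beta y - clockf beta x| /\
  gam * `|clockf beta y - clockf beta x| <= `|y - x|.
Proof.
move=> adm; wlog xy : x y / x <= y => [th xin yin|].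
  have [xy|/ltW yx] := leP x y; first exact: th.
  by rewrite distrC [`|clockf _ _ - _|]distrC; exact: th.
rewrite !in_itv/= => /andP[lox xhi] /andP[loy yhi].
have /andP[h1 h2] := clockf_increment adm lox xy yhi.
have yx0 : 0 <= y - x by rewrite subr_ge0.
have F0 : 0 <= clockf beta y - clockf beta x.
  by apply: le_trans h1; rewrite divr_ge0// ltW.
by rewrite !ger0_norm//; split; rewrite mulrC; [rewrite -ler_pdivrMr|rewrite -ler_pdivlMr].
Qed.

(** The field needs more than the observation time to carry [v] to [hi]; this is what [clock]
    requires to confine the trajectory. *)
Definition exits_late beta v := clockf beta v + (t1 - t0) < clockf beta hi.

Lemma traj_clock beta v X : admissible beta -> exits_late beta v -> lo < v < hi ->
  solves_ode (gbeta a b phi beta) t0 t1 v X ->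
  forall t, t \in `[t0, t1] ->
  lo < X t < hi /\ clockf beta (X t) = clockf beta v + (t - t0).
Proof.
move=> adm late vin ode t tin.
have gE x : lo <= x <= hi -> gbeta a b phi beta x = s beta x.
  by move=> xin; apply: gbetaE; apply: sub_c; rewrite in_itv.
apply: clock (ltW t01) ode _ _ vin late _ tin.
- by move=> x xin; rewrite gE//; apply: admissible_gt0 => //; rewrite in_itv.
- by move=> x xin; rewrite gE//; apply: clockf_derive => //; rewrite in_itv.
Qed.

(** Along two trajectories of the same field the difference of the clocks is constant. Position and
    clock are comparable with constants [gam] and [Gam], so an initial error grows at most by the
    ratio of the two and not exponentially. *)
Lemma traj_shift beta v v' X X' : admissible beta ->
  exits_late beta v -> lo < v < hi -> exits_late beta v' -> lo < v' < hi ->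
  solves_ode (gbeta a b phi beta) t0 t1 v X ->
  solves_ode (gbeta a b phi beta) t0 t1 v' X' ->
  forall t, t \in `[t0, t1] -> `|X t - X' t| <= Gam / gam * `|v - v'|.
Proof.
have io x : lo < x < hi -> x \in `[lo, hi].
  by rewrite in_itv/= => /andP[/ltW -> /ltW ->].
move=> adm lv vin lv' vin' oX oX' t tin.
have [Xin XE] := traj_clock adm lv vin oX tin.
have [Xin' XE'] := traj_clock adm lv' vin' oX' tin.
have [h _] := clockf_dist adm (io _ Xin') (io _ Xin).
have [_ h'] := clockf_dist adm (io _ vin') (io _ vin).
apply: le_trans h _; rewrite -mulrA ler_wpM2l ?(ltW Gam0)// mulrC ler_pdivlMr//.
rewrite mulrC; apply: le_trans h'; rewrite ler_wpM2l ?(ltW gam0)//.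
by rewrite XE XE' opprD addrACA subrr addr0.
Qed.

Section pair.
Variables (v : R) (beta beta' : 'rV[R]_m) (X X' : R -> R).
Hypotheses (vin : lo < v < hi)
  (adm : admissible beta) (adm' : admissible beta')
  (late : exits_late beta v) (late' : exits_late beta' v)
  (oX : solves_ode (gbeta a b phi beta) t0 t1 v X)
  (oX' : solves_ode (gbeta a b phi beta') t0 t1 v X').

Local Notation theta := (beta - beta').
Let D t := X t - X' t.

Let vc : v \in `[lo, hi].
Proof. by move: vin; rewrite in_itv/= => /andP[/ltW -> /ltW ->]. Qed.

Lemma traj_in t : t \in `[t0, t1] -> X t \in `[lo, hi].
Proof.
by move=> /(traj_clock adm late vin oX)[]; rewrite in_itv/= => /andP[/ltW -> /ltW ->].
Qed.

Lemma traj_in' t : t \in `[t0, t1] -> X' t \in `[lo, hi].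
Proof.
by move=> /(traj_clock adm' late' vin oX')[]; rewrite in_itv/= => /andP[/ltW -> /ltW ->].
Qed.

Lemma traj_ge t : t \in `[t0, t1] -> v <= X' t.
Proof.
move=> tin; have [/andP[lX Xh] XE] := traj_clock adm' late' vin oX' tin.
rewrite leNgt; apply/negP => lt.
have /andP[h _] := clockf_increment adm' (ltW lX) (ltW lt) (ltW (proj2 (andP vin))).
have : 0 < (v - X' t) / Gam by rewrite divr_gt0// subr_gt0.
by move: tin; rewrite in_itv/= XE in h * => /andP[]; lra.
Qed.

(* The delay, at position x, between the clocks of the two vector fields. *)
Definition lag x := (clockf beta' x - clockf beta' v) - (clockf beta x - clockf beta v).

Lemma lag_start : lag v = 0. Proof. by rewrite /lag !subrr. Qed.

Lemma lag_derive x : x \in `[lo, hi] ->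
  is_derive x 1 lag (s theta x / (s beta x * s beta' x)).
Proof.
move=> xin; have dF := clockf_derive adm xin; have dF' := clockf_derive adm' xin.
have sp := admissible_gt0 adm xin; have sp' := admissible_gt0 adm' xin.
have -> : s theta x / (s beta x * s beta' x) = ((s beta' x)^-1 - 0) - ((s beta x)^-1 - 0).
  by rewrite scombB; field; rewrite !gt_eqF.
have -> : lag = (clockf beta' - cst (clockf beta' v)) - (clockf beta - cst (clockf beta v)).
  by apply/funext.
by apply: is_deriveB; apply: is_deriveB => //; exact: is_derive_cst.
Qed.

(** Cauchy-Schwarz along [[v, x]]: the derivative of [lag] has square at most
    [gam ^- 4 * s theta ^ 2], and the Gram matrix bounds the energy of [s theta]. *)
Lemma lag_bound x : x \in `[v, hi] ->
  lag x ^+ 2 <= (b - a) * (gam ^- 4 * (cu * sqn theta)).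
Proof.
rewrite in_itv/= => /andP[vx xhi].
have sub z : z \in `[v, hi] -> z \in `[lo, hi].
  by move: vc; rewrite !in_itv/= => /andP[lov _] /andP[vz ->]; rewrite (le_trans lov).
have subo z : z \in `]v, hi[ -> z \in `[lo, hi] by move=> /subset_itv_oo_cc/sub.
pose B z := gam ^- 4 * sqprim a phi 0 theta z.
have BE : B = gam ^- 4 \*: sqprim a phi 0 theta by apply/funext.
have dB z : z \in `[lo, hi] -> is_derive z 1 B (gam ^- 4 *: s theta z ^+ 2).
  by move=> zin; rewrite BE; apply: is_deriveZ; apply: (sqprim_derive sb ab) => //; exact: sub_lohi.
have := @sqr_increment_le R lag _ B _ v hi v x (lexx _) vx xhi
  (derive_within_continuous (fun z zin => lag_derive (sub z zin)))
  (derive_within_continuous (fun z zin => dB z (sub z zin)))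
  (fun z zin => lag_derive (subo z zin)) (fun z zin => dB z (subo z zin)).
rewrite lag_start subr0 => h; apply: le_trans (h _) _.
  move=> z /subo zin; have /andP[g1 _] := adm zin; have /andP[g2 _] := adm' zin.
  rewrite /GRing.scale/= expr_div_n mulrC ler_wpM2r ?sqr_ge0//.
  rewrite lef_pV2 ?posrE ?exprn_gt0 ?mulr_gt0 ?admissible_gt0//.
  have gg : gam * gam <= s beta z * s beta' z by rewrite ler_pM// ltW.
  have -> : gam ^+ 4 = (gam * gam) ^+ 2 by ring.
  have gg0 : 0 <= gam * gam by rewrite mulr_ge0// ltW.
  by rewrite ler_pXn2r// nnegrE (le_trans gg0).
have va : v \in `[a, b] by exact: sub_c.
have xa : x \in `[a, b] by apply/sub_c/sub; rewrite in_itv/= vx.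
move: va xa; rewrite !in_itv/= => /andP[av _] /andP[_ xb].
have /andP[h1 h2] := sqprim_increment sb ab theta (j := 0) isT av vx xb.
have /andP[_ h3] := sqprim0_bounds sb theta.
rewrite /B -mulrBr ler_pM ?subr_ge0//.
- by rewrite mulr_ge0// invr_ge0 exprn_ge0// ltW.
- by case/andP: vin; move: alo hib xhi; lra.
- by rewrite ler_wpM2l ?invr_ge0 ?exprn_ge0 ?(ltW gam0)//; lra.
Qed.

(** At time [t] both clocks have advanced by [t - t0]. The lag at the point [X' t] is therefore the
    clock of [beta] between [X' t] and [X t], which is comparable with their distance. *)
Lemma lag_traj t : t \in `[t0, t1] ->
  gam * `|lag (X' t)| <= `|D t| /\ `|D t| <= Gam * `|lag (X' t)|.
Proof.
move=> tin; have [_ XE] := traj_clock adm late vin oX tin.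
have [_ XE'] := traj_clock adm' late' vin oX' tin.
have [h1 h2] := clockf_dist adm (traj_in' tin) (traj_in tin).
have -> : lag (X' t) = clockf beta (X t) - clockf beta (X' t).
  by rewrite /lag XE XE'; ring.
by split.
Qed.

Lemma traj_sqdist t : t \in `[t0, t1] ->
  D t ^+ 2 <= Gam ^+ 2 * ((b - a) * (gam ^- 4 * (cu * sqn theta))).
Proof.
move=> tin; have [_ h] := lag_traj tin.
have Xv : X' t \in `[v, hi].
  by move: (traj_in' tin); rewrite !in_itv/= traj_ge// => /andP[].
apply: le_trans (ler_wpM2l (sqr_ge0 Gam) (lag_bound Xv)).
rewrite -exprMn -[D t ^+ 2]real_normK ?num_real//.
rewrite -[(Gam * _) ^+ 2]real_normK ?num_real// normrM (gtr0_norm Gam0).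
by rewrite ler_pXn2r// nnegrE// mulr_ge0// ltW.
Qed.

Lemma gbeta_traj t : t \in `[t0, t1] ->
  gbeta a b phi beta (X t) - gbeta a b phi beta' (X' t) =
  (s beta (X t) - s beta (X' t)) + s theta (X' t).
Proof.
move=> tin; rewrite (gbetaE _ _ (sub_c (traj_in tin))) (gbetaE _ _ (sub_c (traj_in' tin))).
by rewrite scombB; ring.
Qed.

Lemma diff_continuous : {within `[t0, t1], continuous D}.
Proof.
have [_ cX _] := oX; have [_ cX' _] := oX'.
by move=> x; apply: cvgB; [exact: cX|exact: cX'].
Qed.

Lemma diff_derive t : t \in `]t0, t1[ ->
  is_derive t 1 D (gbeta a b phi beta (X t) - gbeta a b phi beta' (X' t)).
Proof.
rewrite in_itv/= => tin; have [_ _ /(_ _ tin) dX] := oX.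
by have [_ _ /(_ _ tin) dX'] := oX'; exact: is_deriveB.
Qed.

Definition sqdist := primitive (fun t => (X t - X' t) ^+ 2) t0.

Let cD2 : {within `[t0, t1], continuous (fun t => (X t - X' t) ^+ 2)}.
Proof.
have -> : (fun t => (X t - X' t) ^+ 2) = (fun t => D t * D t).
  by apply/funext => t; rewrite expr2.
by apply: within_continuousM; exact: diff_continuous.
Qed.

Lemma sqdist_derive t : t \in `]t0, t1[ -> is_derive t 1 sqdist (D t ^+ 2).
Proof. by move=> tin; apply: (primitive_derive t01 cD2). Qed.

Lemma sqdist_continuous : {within `[t0, t1], continuous sqdist}.
Proof. exact: primitive_continuous. Qed.

Lemma sqdist_start : sqdist t0 = 0. Proof. exact: primitive0. Qed.

Lemma sqdist_mean l r : t0 <= l -> l < r -> r <= t1 ->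
  exists2 c, c \in `[l, r] & sqdist r - sqdist l = (r - l) * D c ^+ 2.
Proof.
move=> t0l lr rt1.
have [||c cin ->] := @MVT R sqdist (fun t => D t ^+ 2) l r lr.
- move=> x; rewrite in_itv/= => /andP[lx xr]; apply: sqdist_derive.
  by rewrite in_itv/= (le_lt_trans t0l)//= (lt_le_trans xr).
- have cs := sqdist_continuous; apply: continuous_subspaceW cs.
  by apply: subset_itv; rewrite bnd_simp.
by exists c; [exact: subset_itv_oo_cc|rewrite mulrC].
Qed.

(** * Reverse inequality: the coefficients are controlled by the distance of the trajectories *)

Section lower_bound.
Variable kap : R.
Hypotheses (kap0 : 0 < kap) (cl0 : 0 < cl).
Local Notation M := (m%:R : R).
Local Notation y1 := (X' t1).
Hypotheses (short : v <= y1 - kap / M)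
  (lost : K * M * ((v - a) + (b - y1) + kap / M) <= cl / 2).

Let M0 : 0 < M. Proof. by rewrite ltr0n. Qed.

Let t1in : t1 \in `[t0, t1]. Proof. by rewrite in_itv/= lexx ltW. Qed.

Definition lagsq := primitive (fun x => lag x ^+ 2) lo.

Let lag_continuous : {within `[lo, hi], continuous (fun x => lag x ^+ 2)}.
Proof.
have -> : (fun x => lag x ^+ 2) = (fun x => lag x * lag x).
  by apply/funext => x; rewrite expr2.
apply: within_continuousM;
  exact: (derive_within_continuous (fun x xin => lag_derive xin)).
Qed.

Let lagsq_derive x : x \in `]lo, hi[ -> is_derive x 1 lagsq (lag x ^+ 2).
Proof. by move=> xin; apply: primitive_derive lohi lag_continuous _ xin. Qed.

Let y1in : lo < y1 < hi.
Proof. by have [] := traj_clock adm' late' vin oX' t1in. Qed.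

Let vy1 : v < y1.
Proof. by apply: le_lt_trans short _; rewrite ltrBlDr ltrDl divr_gt0. Qed.

Let in_oo x : v <= x -> x <= y1 -> x \in `]lo, hi[.
Proof.
move=> vx xy; rewrite in_itv/=; case/andP: vin => lov _; case/andP: y1in => _ yhi.
by rewrite (lt_le_trans lov)//= (le_lt_trans xy).
Qed.

Let lagsq_mono x y : v <= x -> x <= y -> y <= y1 -> lagsq x <= lagsq y.
Proof.
move=> vx xy yy1.
have d z : z \in `[x, y] -> is_derive z 1 lagsq (lag z ^+ 2).
  rewrite in_itv/= => /andP[xz zy]; apply: lagsq_derive; apply: in_oo.
    exact: le_trans xz.
  exact: le_trans yy1.
exact: (derive_ge0_le xy (fun z zin => d z (subset_itv_oo_cc zin))
  (derive_within_continuous d) (fun z _ => sqr_ge0 (lag z))).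
Qed.

(* the change of variable x = X' t *)
Let lagsq_le : lagsq y1 - lagsq v <= Gam * gam ^- 2 * sqdist t1.
Proof.
have [X0 cX' dX'] := oX'.
have Xoo t : t \in `[t0, t1] -> X' t \in `]lo, hi[.
  by move=> /(traj_clock adm' late' vin oX')[].
have cP : {within `[t0, t1], continuous (lagsq \o X')}.
  apply: within_continuous_comp => // _ /set_mem[t /= tin <-].
  have [/derivable1_diffP/differentiable_continuous h _] := lagsq_derive (Xoo _ tin).
  exact: h.
pose B := (Gam * gam ^- 2) \*: sqdist.
have cB : {within `[t0, t1], continuous B}.
  by move=> x; apply: cvgZr; exact: sqdist_continuous.
have := @derive_le R (lagsq \o X') B _ _ t0 t1 (ltW t01)
  (fun t tin => is_derive1_comp (lagsq_derive (Xoo _ (subset_itv_oo_cc tin))) (dX' _ tin))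
  (fun t tin => is_deriveZ _ (sqdist_derive tin)) cP cB.
rewrite /B /= X0 sqdist_start /GRing.scale/= mulr0 subr0; apply.
move=> t /[dup] tino /subset_itv_oo_cc tin.
have [h _] := lag_traj tin.
rewrite gbetaE; last exact/sub_c/traj_in'.
have /andP[_ h2] := adm' (traj_in' tin).
have := admissible_gt0 adm' (traj_in' tin).
have {}h : lag (X' t) ^+ 2 <= gam ^- 2 * D t ^+ 2.
  rewrite -[D t ^+ 2]real_normK ?num_real// -[lag _ ^+ 2]real_normK ?num_real//.
  rewrite mulrC ler_pdivlMr ?exprn_gt0// mulrC -exprMn ler_pXn2r// nnegrE//.
  by rewrite mulr_ge0// ltW.
move=> s0; rewrite mulrC -mulrA; apply: ler_pM => //.
- exact: ltW.
- exact: sqr_ge0.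
Qed.

(* Integrate the derivative of [s theta * lag] from [v] to a point near [y1]
   where [lag] is at most its mean square. *)
Lemma theta_le_sqdist :
  sqn theta <= 8 * Gam ^+ 4 / cl ^+ 2 * (K ^+ 2 + K / kap) * (Gam * gam ^- 2)
               * M ^+ 2 * sqdist t1.
Proof.
have k0 : 0 < kap / M by rewrite divr_gt0.
(* On the last stretch, of length [kap / M], some point [c] has [lag c ^ 2] at most [M / kap] times
   the integral [Pd]. This controls the boundary term of the integration by parts; at [v] the lag
   vanishes. *)
have [|||c] := @MVT R lagsq (fun x => lag x ^+ 2) (y1 - kap / M) y1.
- by rewrite ltrBlDr ltrDl.
- move=> x; rewrite in_itv/= => /andP[kx xy]; apply: lagsq_derive; apply: in_oo.
    by apply: le_trans short _; exact: ltW.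
  exact: ltW.
- apply: derive_within_continuous => x; rewrite in_itv/= => /andP[kx xy].
  apply: lagsq_derive; apply: in_oo => //; exact: le_trans kx.
rewrite in_itv/= => /andP[kc cy1]; rewrite opprB addrCA subrr addr0 => lagc.
have vc' : v < c by exact: le_lt_trans kc.
set T := sqn theta; set Pd := lagsq y1 - lagsq v.
have T0 : 0 <= T by exact: sqn_ge0.
have Gc : lag c ^+ 2 * (kap / M) <= Pd.
  rewrite -lagc /Pd lerD2l lerN2; apply: lagsq_mono => //.
  by rewrite lerBlDr lerDl ltW.
have Pd0 : 0 <= Pd by rewrite subr_ge0; apply: lagsq_mono => //; exact: ltW.
(* Proportional to [M ^- 2], so that by the inverse inequality the term with the derivative of
   [s theta] takes only a quarter of the main term [cl / (2 * Gam ^ 2) * T]. *)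
pose nu := cl / (4 * K ^+ 2 * Gam ^+ 2) / M ^+ 2.
have nu0 : 0 < nu by rewrite !divr_gt0 ?mulr_gt0 ?exprn_gt0.
pose Ph := sqprim a phi 0 theta; pose Ph1 := sqprim a phi 1 theta.
pose f x := Gam ^- 2 * Ph x - nu / 2 * Ph1 x - nu^-1 / 2 * lagsq x.
have fE : f = (Gam ^- 2 \*: Ph - (nu / 2) \*: Ph1) - (nu^-1 / 2) \*: lagsq by exact/funext.
pose g := s theta * lag.
have inE' x : x \in `[v, c] -> x \in `]lo, hi[.
  by rewrite in_itv/= => /andP[vx xc]; apply: in_oo => //; apply: le_trans (ltW cy1).
have df x : x \in `[v, c] -> is_derive x 1 f
   ((Gam ^- 2 *: s theta x ^+ 2 - (nu / 2) *: scomb phi 1 theta x ^+ 2)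
     - (nu^-1 / 2) *: lag x ^+ 2).
  move=> /inE' xin; have xab := sub_lohi (subset_itv_oo_cc xin).
  rewrite fE; apply: is_deriveB; [apply: is_deriveB|]; apply: is_deriveZ.
  - exact: (sqprim_derive sb ab).
  - exact: (sqprim_derive sb ab).
  - exact: lagsq_derive.
have dg x : x \in `[v, c] -> is_derive x 1 g
   (s theta x *: (s theta x / (s beta x * s beta' x)) + lag x *: scomb phi 1 theta x).
  move=> /inE' xin; apply: is_deriveM.
    by apply: (scomb_derive sb) => //; exact/sub_c/subset_itv_oo_cc.
  by apply: lag_derive; exact: subset_itv_oo_cc.
have := @derive_le R f g _ _ v c (ltW vc')
  (fun x xin => df x (subset_itv_oo_cc xin)) (fun x xin => dg x (subset_itv_oo_cc xin))
  (derive_within_continuous df) (derive_within_continuous dg).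
have -> : g c - g v = s theta c * lag c.
  by rewrite /g !fctE lag_start mulr0 subr0.
have -> : f c - f v = Gam ^- 2 * (Ph c - Ph v) - nu / 2 * (Ph1 c - Ph1 v)
                      - nu^-1 / 2 * (lagsq c - lagsq v).
  by rewrite /f; ring.
move=> ibp.
have {}ibp : Gam ^- 2 * (Ph c - Ph v) - nu / 2 * (Ph1 c - Ph1 v)
      - nu^-1 / 2 * (lagsq c - lagsq v) <= s theta c * lag c.
  apply: ibp => x /subset_itv_oo_cc/inE'/subset_itv_oo_cc xin; rewrite /GRing.scale/=.
  have /andP[_ u1] := adm xin; have /andP[_ u2] := adm' xin.
  have s1 := admissible_gt0 adm xin; have s2 := admissible_gt0 adm' xin.
  have e1 : Gam ^- 2 * s theta x ^+ 2 <= s theta x * (s theta x / (s beta x * s beta' x)).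
    rewrite mulrA -expr2 mulrC ler_wpM2l ?sqr_ge0// lef_pV2 ?posrE ?mulr_gt0 ?exprn_gt0//.
    by rewrite expr2 ler_pM// ltW.
  (* Completing the square bounds the cross term of the product rule from below. *)
  have e2 : 0 <= nu^-1 / 2 * (nu * scomb phi 1 theta x + lag x) ^+ 2.
    by rewrite mulr_ge0 ?sqr_ge0// divr_ge0// invr_ge0 ltW.
  have e3 : nu^-1 / 2 * (nu * scomb phi 1 theta x + lag x) ^+ 2 =
    nu / 2 * scomb phi 1 theta x ^+ 2 + nu^-1 / 2 * lag x ^+ 2 + lag x * scomb phi 1 theta x.
    by field; rewrite gt_eqF.
  by rewrite e3 in e2; lra.
have /andP[av vb] : a <= v <= b by have := sub_c vc; rewrite in_itv.
have ca : c \in `[a, b].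
  by apply/sub_c/subset_itv_oo_cc/inE'; rewrite in_itv/= lexx ltW.
have /andP[ac cb] : a <= c <= b by move: ca; rewrite in_itv.
have lip x y : a <= x -> x <= y -> y <= b -> Ph y - Ph x <= T * (K * M) * (y - x).
  move=> ax xy yb; apply: (sqprim_le sb ab) => // z.
  rewrite in_itv/= => /andP[xz zy].
  have zab : z \in `[a, b] by rewrite in_itv/= !ltW ?(le_lt_trans ax)// (lt_le_trans zy).
  by have := scomb_bound sb theta (j := 0) isT zab; rewrite expr1.
have /andP[lowT _] := sqprim0_bounds sb theta.
have Pha : Ph a = 0 by exact: primitive0.
(* The total energy is at least [cl * T]. Outside [[v, c]] the square of [s theta] is at most
   [T * K * M], and by [lost] the length left out there costs at most half of that total. *)
have E1 : cl / 2 * T <= Ph c - Ph v.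
  have l1 := lip _ _ (lexx a) av vb; have l2 := lip _ _ ac cb (lexx b).
  move: l1 l2; rewrite Pha -/Ph -/T in lowT *.
  have : T * (K * M * (v - a + (b - y1) + kap / M)) <= T * (cl / 2) by rewrite ler_wpM2l.
  have : 0 <= T * (K * M) * (c - (y1 - kap / M)).
    by rewrite mulr_ge0 ?mulr_ge0 ?subr_ge0// ltW.
  lra.
have /andP[_ E2] := sqprim_increment sb ab theta (j := 1) isT av (ltW vc') cb.
have E3 := le_trans E2 (sqprim1_bound sb K0 m0 theta).
have E4 : lagsq c - lagsq v <= Pd.
  by rewrite lerD2r; apply: lagsq_mono => //; exact: ltW.
have E5 : s theta c ^+ 2 <= T * (K * M).
  by have := scomb_bound sb theta (j := 0) isT ca; rewrite expr1.
(* Proportional to [1 / M], so that the boundary term takes another quarter of the main term. *)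
pose mu := cl / (4 * K * Gam ^+ 2) / M.
have mu0 : 0 < mu by rewrite !divr_gt0 ?mulr_gt0 ?exprn_gt0.
have E6 : s theta c * lag c <= mu / 2 * (T * (K * M)) + mu^-1 / 2 * (Pd / (kap / M)).
  have : mu / 2 * s theta c ^+ 2 <= mu / 2 * (T * (K * M)).
    by rewrite ler_wpM2l// divr_ge0// ltW.
  have : mu^-1 / 2 * lag c ^+ 2 <= mu^-1 / 2 * (Pd / (kap / M)).
    by rewrite ler_wpM2l ?divr_ge0 ?invr_ge0 ?(ltW mu0)// ler_pdivlMr.
  have : 0 <= mu^-1 / 2 * (mu * s theta c - lag c) ^+ 2.
    by rewrite mulr_ge0 ?sqr_ge0// divr_ge0// invr_ge0 ltW.
  have -> : mu^-1 / 2 * (mu * s theta c - lag c) ^+ 2 =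
     mu / 2 * s theta c ^+ 2 + mu^-1 / 2 * lag c ^+ 2 - s theta c * lag c.
    by field; rewrite gt_eqF.
  lra.
have F1 : Gam ^- 2 * (cl / 2 * T) <= Gam ^- 2 * (Ph c - Ph v).
  by rewrite ler_wpM2l// invr_ge0 exprn_ge0// ltW.
have F2 : nu / 2 * (Ph1 c - Ph1 v) <= nu / 2 * (K ^+ 2 * M ^+ 2 * T).
  by rewrite ler_wpM2l// divr_ge0// ltW.
have F3 : nu^-1 / 2 * (lagsq c - lagsq v) <= nu^-1 / 2 * Pd.
  by rewrite ler_wpM2l// divr_ge0// invr_ge0 ltW.
have G1 : nu / 2 * (K ^+ 2 * M ^+ 2 * T) = cl / (8 * Gam ^+ 2) * T.
  by rewrite /nu; field; rewrite !gt_eqF.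
have G2 : nu^-1 / 2 * Pd = 2 * Gam ^+ 2 / cl * K ^+ 2 * (M ^+ 2 * Pd).
  by rewrite /nu; field; rewrite !gt_eqF.
have G3 : mu / 2 * (T * (K * M)) = cl / (8 * Gam ^+ 2) * T.
  by rewrite /mu; field; rewrite !gt_eqF.
have G4 : mu^-1 / 2 * (Pd / (kap / M)) = 2 * Gam ^+ 2 / cl * (K / kap) * (M ^+ 2 * Pd).
  by rewrite /mu; field; rewrite !gt_eqF.
have G5 : Gam ^- 2 * (cl / 2 * T) = cl / (2 * Gam ^+ 2) * T.
  by field; rewrite !gt_eqF.
(* Half of the main term survives; what is left on the right is a multiple of [M ^ 2 * Pd], and
   [lagsq_le] turns [Pd] into the squared distance of the trajectories. *)
have H1 : cl / (4 * Gam ^+ 2) * T <=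
    2 * Gam ^+ 2 / cl * (K ^+ 2 + K / kap) * (M ^+ 2 * Pd).
  have -> : cl / (4 * Gam ^+ 2) * T = cl / (2 * Gam ^+ 2) * T
      - cl / (8 * Gam ^+ 2) * T - cl / (8 * Gam ^+ 2) * T.
    by field; rewrite !gt_eqF.
  rewrite G1 in F2; rewrite G2 in F3; rewrite G3 G4 in E6; rewrite G5 in F1.
  by rewrite [_ * (K ^+ 2 + _)]mulrDr mulrDl; lra.
have : 4 * Gam ^+ 2 / cl * (cl / (4 * Gam ^+ 2) * T) <=
       4 * Gam ^+ 2 / cl * (2 * Gam ^+ 2 / cl * (K ^+ 2 + K / kap) * (M ^+ 2 * Pd)).
  by rewrite ler_wpM2l// divr_ge0 ?mulr_ge0 ?exprn_ge0// ltW.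
have -> : 4 * Gam ^+ 2 / cl * (cl / (4 * Gam ^+ 2) * T) = T.
  by field; rewrite !gt_eqF.
move=> H2; apply: le_trans H2 _.
have := lagsq_le; rewrite -/Pd => H3.
have -> : 4 * Gam ^+ 2 / cl * (2 * Gam ^+ 2 / cl * (K ^+ 2 + K / kap) * (M ^+ 2 * Pd))
  = 8 * Gam ^+ 4 / cl ^+ 2 * (K ^+ 2 + K / kap) * M ^+ 2 * Pd.
  by field; rewrite !gt_eqF.
have -> : 8 * Gam ^+ 4 / cl ^+ 2 * (K ^+ 2 + K / kap) * (Gam / gam ^+ 2) * M ^+ 2 * sqdist t1
  = 8 * Gam ^+ 4 / cl ^+ 2 * (K ^+ 2 + K / kap) * M ^+ 2 * (Gam / gam ^+ 2 * sqdist t1).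
  by ring.
rewrite ler_wpM2l// !mulr_ge0 ?addr_ge0 ?invr_ge0 ?divr_ge0 ?exprn_ge0 ?(ltW Gam0)
  ?(ltW cl0) ?(ltW K0) ?(ltW kap0)//.
Qed.

End lower_bound.

(** * Moduli of continuity of the difference of two trajectories *)

Section lipschitz.
Variable L : R.
Hypothesis hL : forall x, x \in `[lo, hi] -> `|scomb phi 1 beta x| <= L.

Lemma scomb_lipschitz x y : x \in `[lo, hi] -> y \in `[lo, hi] ->
  (s beta y - s beta x) ^+ 2 <= L ^+ 2 * (y - x) ^+ 2.
Proof.
wlog xy : x y / x <= y => [th xin yin|].
  have [xy|/ltW yx] := leP x y; first exact: th.
  by rewrite -sqrrN opprB -[(y - x) ^+ 2]sqrrN opprB; exact: th.
rewrite !in_itv/= => /andP[lox xhi] /andP[loy yhi].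
have sub z : z \in `[x, y] -> z \in `[lo, hi].
  by rewrite !in_itv/= => /andP[xz zy]; rewrite (le_trans lox)//= (le_trans zy).
have d z (zin : z \in `[x, y]) := @scomb_derive _ _ _ _ _ _ _ _ sb 0 beta z isT (sub_c (sub z zin)).
have [c /sub/hL h ->] := MVT_segment xy (fun z zin => d z (subset_itv_oo_cc zin))
  (derive_within_continuous d).
rewrite exprMn ler_wpM2r ?sqr_ge0// -real_normK ?num_real//.
by rewrite ler_pXn2r// nnegrE// (le_trans _ h).
Qed.

Lemma diff_derive_sqr t : t \in `]t0, t1[ ->
  (gbeta a b phi beta (X t) - gbeta a b phi beta' (X' t)) ^+ 2 <=
  2 * s theta (X' t) ^+ 2 + 2 * L ^+ 2 * D t ^+ 2.
Proof.
move=> /subset_itv_oo_cc tin; rewrite gbeta_traj//.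
have := scomb_lipschitz (traj_in' tin) (traj_in tin).
have := sqr_ge0 (s beta (X t) - s beta (X' t) - s theta (X' t)).
by rewrite -/(D t); nra.
Qed.

(** [B] is a primitive in time of a bound on the squared derivative of [D]. Since [X'] moves at
    speed at least [gam], the time integral of [s theta (X') ^ 2] is at most [gam^-1] times the
    energy in space; no pointwise bound on [s theta], with its extra factor [M], is involved. *)
Lemma diff_modulus : exists2 B : R -> R,
  forall u t, t0 <= u -> u <= t -> t <= t1 ->
    (D t - D u) ^+ 2 <= (t - u) * (B t - B u)
  & B t1 - B t0 <= 2 * gam^-1 * (cu * sqn theta) + 2 * L ^+ 2 * sqdist t1.
Proof.
have [X0 cX' dX'] := oX'.
pose Ph := sqprim a phi 0 theta.
have dPh t : t \in `[t0, t1] -> is_derive (X' t) 1 Ph (s theta (X' t) ^+ 2).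
  by move=> tin; apply: (sqprim_derive sb ab) => //; apply/sub_lohi/traj_in'.
have cP : {within `[t0, t1], continuous (Ph \o X')}.
  apply: within_continuous_comp => // _ /set_mem[t /= tin <-].
  have [/derivable1_diffP/differentiable_continuous h _] := dPh _ tin.
  exact: h.
pose B := (2 * gam^-1) \*: (Ph \o X') + (2 * L ^+ 2) \*: sqdist.
have cB : {within `[t0, t1], continuous B}.
  by move=> x; apply: cvgD; apply: cvgZr; [exact: cP|exact: sqdist_continuous].
have dB t (tin : t \in `]t0, t1[) : is_derive t 1 B
   ((2 * gam^-1) *: (gbeta a b phi beta' (X' t) *: s theta (X' t) ^+ 2) + (2 * L ^+ 2) *: D t ^+ 2).
  apply: is_deriveD; apply: is_deriveZ; last exact: sqdist_derive.
  have := is_derive1_comp (dPh _ (subset_itv_oo_cc tin)) (dX' _ tin).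
  by rewrite /GRing.scale/= mulrC.
exists B.
  move=> u t t0u ut tt1.
  apply: (sqr_increment_le t0u ut tt1 diff_continuous cB (fun x xin => diff_derive xin) dB).
  move=> x xin; apply: le_trans (diff_derive_sqr xin) _; rewrite lerD2r /GRing.scale/=.
  have tin := subset_itv_oo_cc xin.
  rewrite gbetaE; last exact/sub_c/traj_in'.
  have /andP[h _] := adm' (traj_in' tin).
  rewrite mulrA ler_wpM2r ?sqr_ge0// -mulrA ler_peMr// mulrC ler_pdivlMr// mul1r//.
have t0in : t0 \in `[t0, t1] by rewrite in_itv/= lexx ltW.
have t1in : t1 \in `[t0, t1] by rewrite in_itv/= lexx ltW.
rewrite /B !fctE /= /GRing.scale/= sqdist_start mulr0 addr0 addrAC -mulrBr lerD2r.
rewrite ler_wpM2l ?mulr_ge0 ?invr_ge0 ?(ltW gam0)//.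
have vX : X' t0 <= X' t1 by rewrite X0; exact: traj_ge.
have /andP[a0 _] : a <= X' t0 <= b by have := sub_c (traj_in' t0in); rewrite in_itv.
have /andP[_ b1] : a <= X' t1 <= b by have := sub_c (traj_in' t1in); rewrite in_itv.
have /andP[_ h] := sqprim_increment sb ab theta (j := 0) isT a0 vX b1.
apply: le_trans h _.
by have /andP[] := sqprim0_bounds sb theta.
Qed.

(** Here [s theta] and [D] are bounded pointwise, which is cruder in powers of [M]; the bound serves
    only below the finest nodes, where the small step makes up for it. *)
Lemma diff_lipschitz u t : t0 <= u -> u <= t -> t <= t1 ->
  (D t - D u) ^+ 2 <= (t - u) ^+ 2 * (2 * (sqn theta * (K * m%:R))
    + 2 * L ^+ 2 * (Gam ^+ 2 * ((b - a) * (gam ^- 4 * (cu * sqn theta))))).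
Proof.
move=> t0u ut tt1; set Q := (2 * _ + _).
pose B z := Q * z.
have dB (z : R) : is_derive z (1 : R) B Q by exact: is_derive_linear.
have cB : {within `[t0, t1], continuous B} := derive_within_continuous (fun z _ => dB z).
have := sqr_increment_le t0u ut tt1 diff_continuous cB
  (fun x xin => diff_derive xin) (fun z _ => dB z).
rewrite /B -mulrBr mulrCA -expr2 mulrC; apply => x xin.
apply: le_trans (diff_derive_sqr xin) _; rewrite /Q; apply: lerD.
  rewrite ler_wpM2l//; have := scomb_bound sb theta (j := 0) isT
    (sub_c (traj_in' (subset_itv_oo_cc xin))).
  by rewrite expr1.
have h := traj_sqdist (subset_itv_oo_cc xin).
by rewrite ler_wpM2l// mulr_ge0// sqr_ge0.
Qed.

End lipschitz.
End pair.
End Trajectories.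

(** * Moments of masked sums *)

Section Independence.
Context {R : realType} {d : measure_display} {Omega : measurableType d}.
Variable P : probability Omega R.
Local Open Scope ereal_scope.

(** The joint law agrees with the product of the marginals on rectangles, hence everywhere, and
    Fubini factorises the integral. *)
Lemma integral_indep_prod (X Y : {RV P >-> R}) :
  (forall A B : set R, measurable A -> measurable B ->
    P (X @^-1` A `&` Y @^-1` B) = P (X @^-1` A) * P (Y @^-1` B)) ->
  P.-integrable setT (EFin \o X) -> P.-integrable setT (EFin \o Y) ->
  P.-integrable setT (fun w => (X w * Y w)%:E) ->
  \int[P]_w (X w * Y w)%:E = \int[P]_w (X w)%:E * \int[P]_w (Y w)%:E.
Proof.
move=> indep iX iY iXY.
have mXY : measurable_fun [set: Omega] (fun w => (X w, Y w)).
  exact: measurable_fun_pair.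
pose XY : {RV P >-> (R * R)%type} := mfun_Sub (mem_set mXY).
pose f (z : R * R) : \bar R := (z.1 * z.2)%:E.
have mf : measurable_fun [set: R * R] f.
  by apply/measurable_EFinP; apply: measurable_funM; [exact: measurable_fst|exact: measurable_snd].
have E1 : \int[distribution P XY]_z f z = \int[P]_w (X w * Y w)%:E.
  by rewrite integral_distribution.
have prodE (S : set (R * R)) : measurable S ->
    (distribution P X \x distribution P Y) S = distribution P XY S.
  apply: (@product_measure_unique _ _ _ _ _ (distribution P X) (distribution P Y)
    (distribution P XY)) => A B mA mB.
  by rewrite /distribution/= /pushforward -indep//; congr (P _).
have iXYd : (distribution P X \x distribution P Y).-integrable setT f.
  have : (distribution P XY).-integrable setT f.
    exact: (integrable_pushforward (phi := XY)).
  move=> /integrableP[_ fin]; apply/integrableP; split=> //.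
  apply: le_lt_trans fin; rewrite le_eqVlt; apply/orP; left; apply/eqP.
  by apply: eq_measure_integral => S mS _; exact: prodE.
have -> : \int[P]_w (X w * Y w)%:E = \int[distribution P X \x distribution P Y]_z f z.
  by rewrite -E1; apply: eq_measure_integral => S mS _; exact/esym/prodE.
rewrite -integral12_prod_meas1//.
have iYd : (distribution P Y).-integrable setT EFin.
  by apply: (integrable_pushforward (phi := Y)) => //; exact/measurable_EFinP.
have iXd : (distribution P X).-integrable setT EFin.
  by apply: (integrable_pushforward (phi := X)) => //; exact/measurable_EFinP.
have EY : \int[distribution P Y]_y y%:E = \int[P]_w (Y w)%:E.
  by rewrite integral_distribution//; exact/measurable_EFinP.
have EX : \int[distribution P X]_y y%:E = \int[P]_w (X w)%:E.
  by rewrite integral_distribution//; exact/measurable_EFinP.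
rewrite /fubini_F /f /=.
transitivity (\int[distribution P X]_x (x%:E * \int[P]_w (Y w)%:E)).
  apply: eq_integral => x _; under eq_integral do rewrite EFinM.
  by rewrite integralZl// EY.
have finY : \int[P]_w (Y w)%:E \is a fin_num by exact: integrable_fin_num.
by rewrite -(fineK finY) integralZr// EX.
Qed.

Lemma integrable_of_sqr (f : Omega -> R) : measurable_fun setT f ->
  P.-integrable setT (fun w => (f w ^+ 2)%:E) -> P.-integrable setT (EFin \o f).
Proof.
move=> mf if2.
have i1 : P.-integrable setT (cst 1%:E : Omega -> \bar R).
  exact: finite_measure_integrable_cst.
apply: (le_integrable _ _ _ (integrableD _ i1 if2)) => //.
  exact/measurable_EFinP.
move=> w _ /=; rewrite lee_fin [leRHS]ger0_norm ?addr_ge0 ?sqr_ge0//.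
rewrite -[(f w ^+ 2)%R]real_normK ?num_real//.
by have := sqr_ge0 (`|f w| - 1)%R; nra.
Qed.

Lemma integrable_mul_of_sqr (f g : Omega -> R) :
  measurable_fun setT f -> measurable_fun setT g ->
  P.-integrable setT (fun w => (f w ^+ 2)%:E) ->
  P.-integrable setT (fun w => (g w ^+ 2)%:E) ->
  P.-integrable setT (fun w => (f w * g w)%:E).
Proof.
move=> mf mg if2 ig2.
apply: (le_integrable _ _ _ (integrableD _ if2 ig2)) => //.
  by apply/measurable_EFinP; exact: measurable_funM.
move=> w _ /=; rewrite lee_fin [leRHS]ger0_norm ?addr_ge0 ?sqr_ge0//.
rewrite normrM -[(f w ^+ 2)%R]real_normK ?num_real// -[(g w ^+ 2)%R]real_normK ?num_real//.
by have := sqr_ge0 (`|f w| - `|g w|)%R; nra.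
Qed.

Lemma second_moment_sum (n : nat) (Z : nat -> Omega -> R) (v : R) :
  (forall i, measurable_fun setT (Z i)) ->
  (forall i, P.-integrable setT (fun w => (Z i w ^+ 2)%:E)) ->
  (forall i, \int[P]_w (Z i w ^+ 2)%:E <= v%:E) ->
  (forall i j, i != j -> \int[P]_w (Z i w * Z j w)%:E = 0) ->
  \int[P]_w ((\sum_(i < n) Z i w) ^+ 2)%:E <= (n%:R * v)%:E.
Proof.
move=> mZ iZ vZ oZ.
have iZZ i j : P.-integrable setT (fun w => (Z i w * Z j w)%:E).
  exact: integrable_mul_of_sqr.
have -> : \int[P]_w ((\sum_(i < n) Z i w) ^+ 2)%:E =
    \int[P]_w (\sum_(i < n) \sum_(j < n) (Z i w * Z j w)%:E).
  apply: eq_integral => w _; rewrite expr2 big_distrl/= -sumEFin.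
  by apply: eq_bigr => i _; rewrite big_distrr/= sumEFin.
rewrite integral_sum//; last by move=> i; apply: integrable_sum.
have -> : (n%:R * v)%:E = \sum_(i < n) v%:E.
  by rewrite sumEFin sumr_const card_ord mulr_natl.
apply: lee_sum => i _; rewrite integral_sum// (bigD1 i)//= big1 ?adde0; last first.
  by move=> j ji; apply: oZ; rewrite eq_sym; apply: contra ji => /eqP/val_inj->.
by under eq_integral do rewrite -expr2.
Qed.

Section sampling.
Variables (T eps : nat -> {RV P >-> R}) (sigma : R).
Hypothesis hind : mutually_independent
  (fun i : nat + nat => match i with inl j => T j | inr j => eps j end).
Hypothesis hmean : forall j, 'E_P[eps j] = 0.
Hypothesis hvar : forall j, 'V_P[eps j] = (sigma ^+ 2)%:E.

Let Zi (i : nat + nat) : {RV P >-> R} :=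
  match i with inl j => T j | inr j => eps j end.

Let preim_meas (X : {RV P >-> R}) (A : set R) : measurable A -> measurable (X @^-1` A).
Proof. by move=> mA; rewrite -[X in measurable X]setTI; exact: measurable_funPT. Qed.

Lemma indep_pair k l (A B : set R) : k != l -> measurable A -> measurable B ->
  P (Zi k @^-1` A `&` Zi l @^-1` B) = P (Zi k @^-1` A) * P (Zi l @^-1` B).
Proof.
move=> kl mA mB.
pose C i := if i == k then A else B.
have lk : (l == k) = false by rewrite eq_sym (negbTE kl).
have := hind (s := [:: k; l]) (B := C).
rewrite !big_cons big_nil mule1 /C eqxx lk /= => <-; first last.
- by move=> i; case: ifP.
- by rewrite inE kl.
congr (P _); apply/seteqP; split => w /=.
  by move=> [Aw Bw] i /=; rewrite !inE => /orP[/eqP->|/eqP->]; rewrite ?eqxx ?lk.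
move=> h; split.
  by have := h k; rewrite /= eqxx; apply; rewrite inE eqxx.
by have := h l; rewrite /= lk; apply; rewrite !inE eqxx orbT.
Qed.

Lemma indep_quad i j (A B A' B' : set R) : i != j ->
  measurable A -> measurable B -> measurable A' -> measurable B' ->
  P ((T i @^-1` A `&` eps i @^-1` B) `&` (T j @^-1` A' `&` eps j @^-1` B')) =
  P (T i @^-1` A `&` eps i @^-1` B) * P (T j @^-1` A' `&` eps j @^-1` B').
Proof.
move=> ij mA mB mA' mB'.
have ji : (j == i) = false by rewrite eq_sym (negbTE ij).
rewrite (indep_pair (k := inl i) (l := inr i))// (indep_pair (k := inl j) (l := inr j))//.
pose C (k : nat + nat) := match k with
  | inl a => if a == i then A else A' | inr a => if a == i then B else B' end.
have := hind (s := [:: inl i; inr i; inl j; inr j]) (B := C).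
rewrite !big_cons big_nil mule1 /C /= eqxx ji !muleA => <-; first last.
- by move=> [] a; case: ifP.
- have e : (inl i == inl j :> nat + nat) = false by apply/negP => /eqP[]/eqP; apply/negP.
  have e' : (inr i == inr j :> nat + nat) = false by apply/negP => /eqP[]/eqP; apply/negP.
  by rewrite !inE e e'.
congr (P _); apply/seteqP; split => w /=.
  move=> [[Aw Bw] [Aw' Bw']] k /=; rewrite !inE.
  by move=> /or4P[] /eqP->; rewrite ?eqxx ?ji.
move=> h; split; split.
- by have := h (inl i); rewrite /= eqxx; apply; rewrite !inE eqxx.
- by have := h (inr i); rewrite /= eqxx; apply; rewrite !inE eqxx ?orbT.
- by have := h (inl j); rewrite /= ji; apply; rewrite !inE eqxx ?orbT.
- by have := h (inr j); rewrite /= ji; apply; rewrite !inE eqxx ?orbT.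
Qed.

Let icst (c : R) : P.-integrable setT (cst c%:E : Omega -> \bar R).
Proof. exact: finite_measure_integrable_cst. Qed.

Let meps j : measurable_fun setT (eps j). Proof. exact: measurable_funPT. Qed.

Lemma noise_second_moment j : \int[P]_w (eps j w ^+ 2)%:E = (sigma ^+ 2)%:E.
Proof.
rewrite -(hvar j) /variance unlock (hmean j) /= unlock.
apply: eq_integral => w _.
by rewrite -[RHS]/(((eps j w - 0) * (eps j w - 0))%R%:E) subr0 expr2.
Qed.

Lemma noise_sqr_integrable j : P.-integrable setT (fun w => (eps j w ^+ 2)%:E).
Proof.
apply/integrableP; split.
  by apply/measurable_EFinP; exact: measurable_funX.
under eq_integral do rewrite gee0_abs ?lee_fin ?sqr_ge0//.
by rewrite noise_second_moment ltry.
Qed.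

Lemma noise_integrable j : P.-integrable setT (EFin \o eps j).
Proof. exact: integrable_of_sqr (noise_sqr_integrable j). Qed.

Lemma noise_mean j : \int[P]_w (eps j w)%:E = 0.
Proof. by rewrite -(hmean j) unlock. Qed.

(** * Errors and design points seen through the indicator of one set *)

Section masked.
Variables (A : set R) (mA : measurable A).

Let mind j : measurable_fun setT (fun w => \1_A (T j w) : R).
Proof. by apply: (measurableT_comp (f := \1_A : R -> R)) => //; exact: measurable_indic. Qed.

Definition masked j (w : Omega) : R := (eps j w * \1_A (T j w))%R.

Lemma measurable_masked j : measurable_fun setT (masked j).
Proof. exact: measurable_funM. Qed.

Lemma integral_preim_indic j : \int[P]_w (\1_A (T j w))%:E = P (T j @^-1` A).
Proof.
have -> : P (T j @^-1` A) = P (T j @^-1` A `&` setT) by rewrite setIT.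
by rewrite -integral_indic//; exact: preim_meas.
Qed.

Let mC (f : R -> R) B : measurable_fun setT f -> measurable B ->
  measurable (f @^-1` B).
Proof. by move=> mf mB; rewrite -[X in measurable X]setTI; exact: mf. Qed.

Let indic_integrable j : P.-integrable setT (fun w => (\1_A (T j w))%:E).
Proof.
apply: (le_integrable _ _ _ (icst 1)) => //.
  exact/measurable_EFinP.
by move=> w _; rewrite /= !lee_fin indicE; case: (_ \in _); rewrite ?normr0 ?normr1.
Qed.

Let prodE (f : R -> R) j : measurable_fun setT f ->
  P.-integrable setT (fun w => (f (eps j w))%:E) ->
  P.-integrable setT (fun w => (f (eps j w) * \1_A (T j w))%:E) ->
  \int[P]_w (f (eps j w) * \1_A (T j w))%:E =
  \int[P]_w (f (eps j w))%:E * P (T j @^-1` A).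
Proof.
move=> mf if_ ifA.
have mfe : measurable_fun setT (f \o eps j) by exact: measurableT_comp.
pose X : {RV P >-> R} := mfun_Sub (mem_set mfe).
pose Y : {RV P >-> R} := mfun_Sub (mem_set (mind j)).
rewrite -integral_preim_indic; apply: (integral_indep_prod (X := X) (Y := Y)) => //;
  last exact: indic_integrable.
move=> B C mB mC'.
have -> : X @^-1` B = eps j @^-1` (f @^-1` B) by [].
have -> : Y @^-1` C = T j @^-1` ((\1_A : R -> R) @^-1` C) by [].
by apply: (indep_pair (k := inr j) (l := inl j)) => //; apply: mC => //;
  exact: measurable_indic.
Qed.

Lemma masked_sqr j w : (masked j w ^+ 2 = eps j w ^+ 2 * \1_A (T j w))%R.
Proof.
by rewrite /masked exprMn indicE; case: (_ \in _); rewrite ?expr1n ?expr0n.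
Qed.

Lemma masked_sqr_integrable j : P.-integrable setT (fun w => (masked j w ^+ 2)%:E).
Proof.
apply: (le_integrable _ _ _ (noise_sqr_integrable j)) => //.
  by apply/measurable_EFinP; apply: measurable_funX; exact: measurable_masked.
move=> w _; rewrite /= masked_sqr !lee_fin normrM ler_piMr//.
by rewrite indicE; case: (_ \in _); rewrite ?normr0 ?normr1.
Qed.

Lemma masked_second_moment j :
  \int[P]_w (masked j w ^+ 2)%:E = (sigma ^+ 2)%:E * P (T j @^-1` A).
Proof.
under eq_integral do rewrite masked_sqr.
rewrite (prodE (f := fun x => (x ^+ 2)%R)) ?noise_second_moment//.
- exact: noise_sqr_integrable.
- have := masked_sqr_integrable j.
  by under eq_fun do rewrite masked_sqr.
Qed.

Lemma masked_integrable j : P.-integrable setT (EFin \o masked j).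
Proof. exact: integrable_of_sqr (measurable_masked j) (masked_sqr_integrable j). Qed.

Lemma masked_mean j : \int[P]_w (masked j w)%:E = 0.
Proof.
rewrite (prodE (f := id))//; first by rewrite noise_mean mul0e.
- exact: noise_integrable.
- exact: masked_integrable.
Qed.

(** When the design point misses [A] the masked error is 0, so whether it lies in [B] no longer
    depends on the error. The condition is written as an event on [eps j], the whole line or the
    empty set, to keep rectangles in [(T j, eps j)]. *)
Let zpart (B : set R) : set R := [set _ | B 0%R].

Let mzpart B : measurable (zpart B).
Proof.
have [B0|B0] := pselect (B 0%R).
  by rewrite (_ : zpart B = setT)//; apply/seteqP; split.
by rewrite (_ : zpart B = set0)//; apply/seteqP; split.
Qed.

Let masked_split j B : masked j @^-1` B =
  (T j @^-1` A `&` eps j @^-1` B) `|` (T j @^-1` (~` A) `&` eps j @^-1` (zpart B)).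
Proof.
apply/seteqP; split => w /=; rewrite /masked indicE.
  have [wA|wA] := boolP (T j w \in A).
    by rewrite mulr1 => ?; left; split=> //; exact: set_mem.
  by rewrite mulr0 => ?; right; split=> //; rewrite notin_setE in wA.
case=> -[wA wB]; first by rewrite mem_set// mulr1.
by rewrite memNset// mulr0.
Qed.

Let P_split j B F : measurable B -> measurable F ->
  P (masked j @^-1` B `&` F) =
  P ((T j @^-1` A `&` eps j @^-1` B) `&` F) +
  P ((T j @^-1` (~` A) `&` eps j @^-1` (zpart B)) `&` F).
Proof.
move=> mB mF; rewrite masked_split setIUl measureU//.
- by apply: measurableI => //; apply: measurableI; exact: preim_meas.
- apply: measurableI => //; apply: measurableI; apply: preim_meas => //.
  exact: measurableC.
- by apply/seteqP; split => w //= -[[[wA _] _] [[wA' _] _]].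
Qed.

(** An event on [masked i] is a disjoint union of two rectangles in [(T i, eps i)], and likewise for
    [j]. Four uses of [indep_quad] give the independence of the two variables, which have mean
    zero. *)
Lemma masked_uncorrelated i j : i != j ->
  \int[P]_w (masked i w * masked j w)%:E = 0.
Proof.
move=> ij.
pose X : {RV P >-> R} := mfun_Sub (mem_set (measurable_masked i)).
pose Y : {RV P >-> R} := mfun_Sub (mem_set (measurable_masked j)).
have -> := @integral_indep_prod X Y.
- by rewrite /= !masked_mean mule0.
- move=> B C mB mC'.
  have mA' : measurable (~` A) by exact: measurableC.
  have mY : measurable (Y @^-1` C) by exact: preim_meas.
  have mX : measurable (X @^-1` B) by exact: preim_meas.
  have -> : X @^-1` B = masked i @^-1` B by [].
  have -> : Y @^-1` C = masked j @^-1` C by [].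
  pose U k E := T k @^-1` A `&` eps k @^-1` E.
  pose V k E := T k @^-1` (~` A) `&` eps k @^-1` (zpart E).
  have mU k E : measurable E -> measurable (U k E).
    by move=> mE; apply: measurableI; exact: preim_meas.
  have mV k E : measurable E -> measurable (V k E).
    by move=> mE; apply: measurableI; exact: preim_meas.
  have PE k E : measurable E -> P (masked k @^-1` E) = P (U k E) + P (V k E).
    by move=> mE; rewrite -(setIT (masked k @^-1` E)) P_split// !setIT.
  have PF F : measurable F -> P (F `&` masked j @^-1` C) = P (F `&` U j C) + P (F `&` V j C).
    by move=> mF; rewrite setIC P_split// 2!(setIC F).
  rewrite P_split// -/(U i B) -/(V i B) !PF ?PE//; try by [exact: mU|exact: mV].
  rewrite /U /V !indep_quad// -/(U i B) -/(V i B) -/(U j C) -/(V j C).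
  by rewrite ge0_muleDr// !ge0_muleDl// addeACA.
- exact: masked_integrable.
- exact: masked_integrable.
- by apply: integrable_mul_of_sqr; try exact: measurable_masked; exact: masked_sqr_integrable.
Qed.

Variable pi : R.
Hypothesis hpi : forall j, P (T j @^-1` A) = pi%:E.

Definition centred j (w : Omega) : R := (\1_A (T j w) - pi)%R.

Lemma measurable_centred j : measurable_fun setT (centred j).
Proof. by apply: measurable_funB. Qed.

Let pi01 : (0 <= pi <= 1)%R.
Proof. by rewrite -!lee_fin -(hpi 0) probability_le1 ?measure_ge0//; exact: preim_meas. Qed.

Lemma centred_sqr j w : (centred j w ^+ 2 = (1 - 2 * pi) * \1_A (T j w) + pi ^+ 2)%R.
Proof. by rewrite /centred indicE; case: (_ \in _); rewrite /=; ring. Qed.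

Lemma centred_sqr_integrable j : P.-integrable setT (fun w => (centred j w ^+ 2)%:E).
Proof.
apply: (le_integrable _ _ _ (icst 1)) => //.
  by apply/measurable_EFinP; apply: measurable_funX; exact: measurable_centred.
move=> w _ /=; rewrite lee_fin normr1 ger0_norm ?sqr_ge0// /centred indicE.
by case/andP: pi01 => p0 p1; case: (_ \in _); rewrite /=; nra.
Qed.

Lemma centred_mean j : \int[P]_w (centred j w)%:E = 0.
Proof.
under eq_integral do rewrite EFinB.
rewrite integralB//; last exact: finite_measure_integrable_cst.
by rewrite integral_preim_indic hpi integral_cst//= probability_setT mule1 subee.
Qed.

Lemma centred_second_moment j : \int[P]_w (centred j w ^+ 2)%:E <= pi%:E.
Proof.
under eq_integral do rewrite centred_sqr EFinD EFinM.
rewrite integralD//; last 2 first.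
  exact: integrableZl.
  exact: finite_measure_integrable_cst.
rewrite integralZl// integral_preim_indic hpi integral_cst//= probability_setT mule1.
rewrite -EFinM -EFinD lee_fin; case/andP: pi01 => p0 p1; nra.
Qed.

Lemma centred_uncorrelated i j : i != j ->
  \int[P]_w (centred i w * centred j w)%:E = 0.
Proof.
move=> ij.
pose X : {RV P >-> R} := mfun_Sub (mem_set (measurable_centred i)).
pose Y : {RV P >-> R} := mfun_Sub (mem_set (measurable_centred j)).
have -> := @integral_indep_prod X Y.
- by rewrite /= !centred_mean mule0.
- move=> B C mB mC'.
  pose f t : R := (\1_A t - pi)%R.
  have mf : measurable_fun setT f by apply: measurable_funB.
  have -> : X @^-1` B = T i @^-1` (f @^-1` B) by [].
  have -> : Y @^-1` C = T j @^-1` (f @^-1` C) by [].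
  by apply: (indep_pair (k := inl i) (l := inl j)) => //; exact: mC.
- exact: integrable_of_sqr (measurable_centred i) (centred_sqr_integrable i).
- exact: integrable_of_sqr (measurable_centred j) (centred_sqr_integrable j).
- apply: integrable_mul_of_sqr; try exact: measurable_centred;
    exact: centred_sqr_integrable.
Qed.

Lemma masked_sum_second_moment n :
  \int[P]_w ((\sum_(j < n) masked j w) ^+ 2)%:E <= (n%:R * (sigma ^+ 2 * pi))%:E.
Proof.
apply: second_moment_sum.
- exact: measurable_masked.
- exact: masked_sqr_integrable.
- by move=> j; rewrite masked_second_moment hpi.
- exact: masked_uncorrelated.
Qed.

Lemma centred_sum_second_moment n :
  \int[P]_w ((\sum_(j < n) centred j w) ^+ 2)%:E <= (n%:R * pi)%:E.
Proof.
apply: second_moment_sum.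
- exact: measurable_centred.
- exact: centred_sqr_integrable.
- exact: centred_second_moment.
- exact: centred_uncorrelated.
Qed.

End masked.
End sampling.

End Independence.

(** * Sums over a grid *)

Lemma telescope_pred (V : zmodType) (F : nat -> V) (q : nat) : (0 < q)%N ->
  \sum_(1 <= i < q) (F i - F i.-1) = F q.-1 - F 0%N.
Proof. by case: q => // q _; rewrite big_add1 telescope_sumr. Qed.

Section Grid.
Context {R : realType}.
Variables (t0 t1 : R) (N q : nat).
Hypotheses (t01 : t0 < t1) (N0 : (0 < N)%N) (q0 : (0 < q)%N).

Definition mesh : R := (t1 - t0) / N%:R.
Definition node (k i : nat) : R := t0 + (k%:R + i%:R / q%:R) * mesh.
(** For [i > 0] this is not the [i]-th piece of cell [k] but everything in it to the right of its
    [i]-th inner node, the shape produced by Abel summation of a step function. Being open on the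
    left, the sets with [i = 0] tile []t0, t1]]. *)
Definition cell (k i : nat) : set R := `]node k i, node k.+1 0]%classic.

Let N0' : 0 < N%:R :> R. Proof. by rewrite ltr0n. Qed.
Let q0' : 0 < q%:R :> R. Proof. by rewrite ltr0n. Qed.

Lemma mesh_gt0 : 0 < mesh. Proof. by rewrite divr_gt0// subr_gt0. Qed.

Lemma node_start : node 0 0 = t0. Proof. by rewrite /node mul0r addr0 mul0r addr0. Qed.

Lemma node_stop : node N 0 = t1.
Proof. by rewrite /node /mesh; field; rewrite !gt_eqF. Qed.

Lemma node_next k : node k q = node k.+1 0.
Proof. by rewrite /node -natr1; field; rewrite !gt_eqF. Qed.

Lemma node_step k i : node k i.+1 - node k i = mesh / q%:R.
Proof. by rewrite /node -natr1; field; rewrite !gt_eqF. Qed.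

Lemma node_mesh k : node k.+1 0 - node k 0 = mesh.
Proof. by rewrite /node -natr1; ring. Qed.

Lemma node_le k i j : (i <= j)%N -> node k i <= node k j.
Proof.
move=> ij; rewrite /node lerD2l ler_wpM2r ?(ltW mesh_gt0)// lerD2l.
by rewrite ler_wpM2r ?invr_ge0 ?ler0n// ler_nat.
Qed.

Lemma node_mono k l : (k <= l)%N -> node k 0 <= node l 0.
Proof.
move=> kl; rewrite /node lerD2l ler_wpM2r ?(ltW mesh_gt0)//.
by rewrite !mul0r !addr0 ler_nat.
Qed.

Lemma node_ge k i : t0 <= node k i.
Proof.
rewrite -{1}node_start; apply: le_trans (node_mono (leq0n k)) _.
exact: node_le.
Qed.

Lemma node_le_stop k : (k < N)%N -> node k.+1 0 <= t1.
Proof. by move=> kN; rewrite -node_stop; exact: node_mono. Qed.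

Definition after (x t : R) : R := (x < t)%R%:R.

Lemma cell_indic k i t : (i <= q)%N -> \1_(cell k i) t = after (node k i) t - after (node k.+1 0) t.
Proof.
move=> iq; rewrite indicE /after /cell.
have le : node k i <= node k.+1 0 by rewrite -node_next; exact: node_le.
have [|] := boolP (t \in _); rewrite ?inE ?notin_setE /= in_itv/=.
  by move=> /andP[-> /le_gtF ->]; rewrite subr0.
by move=> /negP; rewrite negb_and -leNgt -ltNge => /orP[h|h];
  [rewrite (le_gtF h) (le_gtF (le_trans h le)) subrr|rewrite h (le_lt_trans le h) subrr].
Qed.

Lemma sum_cell_indic t : \sum_(k < N) \1_(cell k 0) t = after t0 t - after t1 t.
Proof.
under eq_bigr do rewrite cell_indic// -opprB.
rewrite sumrN -(big_mkord xpredT (fun k => after (node k.+1 0) t - after (node k 0) t)).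
by rewrite telescope_sumr// node_start node_stop opprB.
Qed.

Section functions.
Variables (D H B : R -> R) (Q A2 BB : R).
Hypotheses (D0 : D t0 = 0)
  (meanH : forall l r, t0 <= l -> l < r -> r <= t1 ->
     exists2 c, c \in `[l, r] & H r - H l = (r - l) * D c ^+ 2)
  (modD : forall u t, t0 <= u -> u <= t -> t <= t1 ->
     (D t - D u) ^+ 2 <= (t - u) * (B t - B u))
  (lipD : forall u t, t0 <= u -> u <= t -> t <= t1 ->
     (D t - D u) ^+ 2 <= (t - u) ^+ 2 * Q)
  (HA : H t1 - H t0 = A2) (BBE : B t1 - B t0 <= BB).

Let Bmono u t : t0 <= u -> u <= t -> t <= t1 -> B u <= B t.
Proof.
move=> t0u; rewrite le_eqVlt => /predU1P[->//|ut] tt1.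
have := le_trans (sqr_ge0 _) (modD t0u (ltW ut) tt1).
by rewrite pmulr_rge0 ?subr_gt0// subr_ge0.
Qed.

(** Comparing two squares within a cell costs only the increment of [B] over that cell, so that the
    errors telescope when summed over the cells. *)
Let osc k x y : (k < N)%N -> x \in `[node k 0, node k.+1 0] ->
  y \in `[node k 0, node k.+1 0] ->
  D x ^+ 2 <= 2 * D y ^+ 2 + 2 * (mesh * (B (node k.+1 0) - B (node k 0))).
Proof.
move=> kN; rewrite !in_itv/= => /andP[lx xr] /andP[ly yr].
have g0 := node_ge k 0; have g1 := node_le_stop kN.
have h : (D x - D y) ^+ 2 <= mesh * (B (node k.+1 0) - B (node k 0)).
  rewrite -(node_mesh k).
  have [xy|/ltW yx] := leP x y.
    rewrite -sqrrN opprB; apply: le_trans (modD _ xy _) _.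
    - exact: le_trans lx.
    - exact: le_trans g1.
    have b1 : B (node k 0) <= B x by apply: Bmono => //; apply: le_trans xr g1.
    have b2 : B x <= B y by apply: Bmono => //; [exact: le_trans lx|exact: le_trans g1].
    have b3 : B y <= B (node k.+1 0) by apply: Bmono => //; exact: le_trans ly.
    by apply: ler_pM; lra.
  apply: le_trans (modD _ yx _) _.
  - exact: le_trans ly.
  - exact: le_trans g1.
  have b1 : B (node k 0) <= B y by apply: Bmono => //; apply: le_trans yr g1.
  have b2 : B y <= B x by apply: Bmono => //; [exact: le_trans ly|exact: le_trans g1].
  have b3 : B x <= B (node k.+1 0) by apply: Bmono => //; exact: le_trans lx.
  by apply: ler_pM; lra.
by have := sqr_ge0 (D x - 2 * D y); move: h; nra.
Qed.

Let meanC k : (k < N)%N -> exists2 c, c \in `[node k 0, node k.+1 0] &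
  H (node k.+1 0) - H (node k 0) = mesh * D c ^+ 2.
Proof.
move=> kN; rewrite -(node_mesh k); apply: meanH; first exact: node_ge.
  by rewrite -subr_gt0 node_mesh mesh_gt0.
exact: node_le_stop.
Qed.

Let tele (F : R -> R) : \sum_(k < N) (F (node k.+1 0) - F (node k 0)) = F t1 - F t0.
Proof.
rewrite -(big_mkord xpredT (fun k => F (node k.+1 0) - F (node k 0))).
by rewrite (telescope_sumr (fun k => F (node k 0)))// node_start node_stop.
Qed.

(** A Riemann sum against its integral: in each cell the mean of the square is attained at some [c],
    and [osc] moves from [c] to the node. The increments of [H] and [B] then telescope. *)
Lemma sum_node_sqr : mesh * \sum_(k < N) D (node k 0) ^+ 2 <= 2 * A2 + 2 * (mesh ^+ 2 * BB).
Proof.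
have m0 := mesh_gt0.
apply: (@le_trans _ _ (2 * (H t1 - H t0) + 2 * (mesh ^+ 2 * (B t1 - B t0)))); last first.
  by rewrite HA lerD2l ler_wpM2l// ler_wpM2l// exprn_ge0// ltW.
rewrite -!tele !mulr_sumr -big_split/=; apply: ler_sum => k _.
have [c cin ->] := meanC (ltn_ord k).
have nin : node k 0 \in `[node k 0, node k.+1 0].
  by rewrite in_itv/= lexx -subr_ge0 node_mesh ltW.
have := osc (ltn_ord k) nin cin; rewrite -(ler_pM2l m0).
set b := B _ - B _; nra.
Qed.

Lemma cell_lower k t : (k < N)%N -> cell k 0 t ->
  (H (node k.+1 0) - H (node k 0)) / (2 * mesh)
    - mesh * (B (node k.+1 0) - B (node k 0)) <= D t ^+ 2.
Proof.
move=> kN; rewrite /cell/= in_itv/= => /andP[/ltW lt tr].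
have [c cin ->] := meanC kN.
have tin : t \in `[node k 0, node k.+1 0] by rewrite in_itv/= lt.
have := osc kN cin tin; set b := B _ - B _.
have -> : mesh * D c ^+ 2 / (2 * mesh) = D c ^+ 2 / 2.
  by field; rewrite gt_eqF// mesh_gt0.
lra.
Qed.

Section sample.
Variables (n : nat) (t e : nat -> R) (c lam : R).
Hypotheses (c0 : 0 <= c)
  (count : forall k, (k < N)%N -> c * n%:R * mesh <= \sum_(j < n) \1_(cell k 0) (t j))
  (noise0 : \sum_(k < N) (\sum_(j < n) e j * \1_(cell k 0) (t j)) ^+ 2 <= lam)
  (noise1 : \sum_(k < N) \sum_(i < q) (\sum_(j < n) e j * \1_(cell k i) (t j)) ^+ 2
            <= q%:R * lam)
  (noise2 : \sum_(j < n) e j ^+ 2 <= lam).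

Let inside (x : R) : R := \1_(`[t0, t1]) x.

(** The observation window is closed at [t0] while the cells miss that point; the discrepancy is
    harmless because [D t0 = 0]. *)
Let insideE x : D x * inside x = D x * (after t0 x - after t1 x).
Proof.
rewrite /inside indicE /after; have [|] := boolP (x \in _); rewrite ?inE ?notin_setE /= in_itv/=.
  move=> /andP[]; rewrite le_eqVlt => /predU1P[<- _|-> /le_gtF ->]; last by rewrite subr0.
  by rewrite D0 !mul0r.
move=> /negP; rewrite negb_and -!ltNge => /orP[h|h].
  by rewrite (lt_gtF h) (lt_gtF (lt_trans h t01)) subrr.
by rewrite h (lt_trans t01 h) subrr.
Qed.

Lemma design_lower :
  c * n%:R * (A2 / 2 - mesh ^+ 2 * BB) <= \sum_(j < n) D (t j) ^+ 2 * inside (t j).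
Proof.
have m0 := mesh_gt0.
have -> : \sum_(j < n) D (t j) ^+ 2 * inside (t j) =
    \sum_(k < N) \sum_(j < n) D (t j) ^+ 2 * \1_(cell k 0) (t j).
  rewrite exchange_big/=; apply: eq_bigr => j _.
  by rewrite -mulr_sumr sum_cell_indic expr2 -!mulrA insideE.
pose dd k := (H (node k.+1 0) - H (node k 0)) / (2 * mesh)
    - mesh * (B (node k.+1 0) - B (node k 0)).
apply: (@le_trans _ _ (\sum_(k < N) c * n%:R * mesh * dd k)).
  have -> : \sum_(k < N) c * n%:R * mesh * dd k =
      c * n%:R * ((H t1 - H t0) / 2 - mesh ^+ 2 * (B t1 - B t0)).
    rewrite -!tele mulr_suml mulr_sumr -sumrB mulr_sumr; apply: eq_bigr => k _.
    by rewrite /dd; field; rewrite gt_eqF.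
  by rewrite HA ler_wpM2l ?mulr_ge0// lerB// ler_wpM2l// exprn_ge0// ltW.
apply: ler_sum => k _.
(* The count is bounded from below only, so it can multiply [dd k] only when this is positive;
   otherwise the cell contributes a nonnegative sum and is dropped. *)
have [d0|d0] := leP (dd k) 0.
  apply: (@le_trans _ _ 0); last first.
    by apply: sumr_ge0 => j _; rewrite mulr_ge0 ?sqr_ge0.
  by apply: mulr_ge0_le0 => //; rewrite -mulrA mulr_ge0// mulr_ge0// ltW.
apply: (@le_trans _ _ (\sum_(j < n) \1_(cell k 0) (t j) * dd k)).
  by rewrite -mulr_suml ler_wpM2r ?(ltW d0)//; exact: count.
apply: ler_sum => j _; rewrite indicE.
have [tin|_] := boolP (_ \in _); last by rewrite mul0r mulr0.
by rewrite mul1r mulr1; apply: cell_lower => //; exact: set_mem.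
Qed.

Let dD k i := D (node k i) - D (node k i.-1).
Let fine k x := D (node k 0) + \sum_(1 <= i < q) after (node k i) x * dD k i.

(* [fine] is the step function with value [D] at the last node before [x]. *)
Let fine_node k x r : (0 < r)%N -> node k 0 < x ->
  exists i, [/\ (i < r)%N, node k i < x,
    D (node k 0) + \sum_(1 <= i < r) after (node k i) x * dD k i = D (node k i)
    & forall i', (i < i' < r)%N -> x <= node k i'].
Proof.
move=> r0 kx; elim: r r0 => // -[_ _|r /(_ isT)[i [ir ix E after_i]] _].
  by exists 0; split => //; [rewrite big_geq ?addr0|case].
have [rx|xr] := ltP (node k r.+1) x.
  have ir' : i = r.
    apply/eqP; rewrite eqn_leq -ltnS ir/= leqNgt; apply/negP => lt.
    have /after_i : (i < r < r.+1)%N by rewrite lt ltnSn.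
    by rewrite leNgt (le_lt_trans _ rx)// node_le.
  exists r.+1; split => //.
    rewrite big_nat_recr//= addrA E ir' /after rx mul1r /dD /=.
    by rewrite addrC subrK.
  by move=> i' /andP[a b]; move: (leq_trans a b); rewrite ltnn.
exists i; split => //.
- by rewrite ltnS ltnW.
- by rewrite big_nat_recr//= addrA E /after (le_gtF xr) mul0r addr0.
- move=> i' /andP[ii']; rewrite ltnS leq_eqVlt => /predU1P[->//|i'r].
  by apply: after_i; rewrite ii'.
Qed.

Let fine_close k x : (k < N)%N -> cell k 0 x ->
  (D x - fine k x) ^+ 2 <= (mesh / q%:R) ^+ 2 * Q.
Proof.
move=> kN; rewrite /cell/= in_itv/= => /andP[kx xk].
have [i [iq ix E hi]] := fine_node q0 kx; rewrite /fine E.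
have xi : x <= node k i.+1.
  have [lt|ge] := ltnP i.+1 q; first by apply: hi; rewrite ltnSn.
  have -> : i.+1 = q by apply/eqP; rewrite eqn_leq iq.
  by rewrite node_next.
have xt1 : x <= t1 by apply: le_trans xk _; exact: node_le_stop.
have h := lipD (node_ge k i) (ltW ix) xt1.
have xn : 0 < x - node k i by rewrite subr_gt0.
have Q0 : 0 <= Q.
  by have := le_trans (sqr_ge0 _) h; rewrite pmulr_rge0// exprn_gt0.
apply: le_trans h _; rewrite ler_wpM2r// ler_pXn2r ?nnegrE ?(ltW xn)//.
  by rewrite -(node_step k i) lerD2r.
by rewrite divr_ge0// ltW// mesh_gt0.
Qed.

Let steps x := \sum_(k < N) \1_(cell k 0) x * fine k x.

Let steps_close x : 0 <= Q ->
  (D x * inside x - steps x) ^+ 2 <= (mesh / q%:R) ^+ 2 * Q.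
Proof.
move=> Q0; rewrite insideE -sum_cell_indic.
have [[k kx]|nok] := pselect (exists k : 'I_N, cell k 0 x).
  (* Disjointness of the cells is read off from the sum of their indicators, which is at most 1. *)
  have one l : l != k -> \1_(cell l 0) x = 0 :> R.
    move=> lk; have := sum_cell_indic x.
    have le1 : after t0 x - after t1 x <= 1.
      by rewrite /after; case: (t0 < x); case: (t1 < x); rewrite /=; lra.
    move=> E; move: le1; rewrite -E (bigD1 k)//= (bigD1 l)//=.
    rewrite {1}indicE (mem_set kx)/= addrA => h.
    have : 0 <= \sum_(i < N | (i != k) && (i != l)) \1_(cell i 0) x :> R.
      by apply: sumr_ge0 => i _; rewrite indicE.
    by move: h; rewrite indicE; case: (_ \in _) => //=; lra.
  have E1 : \sum_(l < N) \1_(cell l 0) x = 1 :> R.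
    by rewrite (bigD1 k)//= big1 ?addr0 ?indicE ?(mem_set kx)// => l lk; exact: one.
  have E2 : steps x = fine k x.
    rewrite /steps (bigD1 k)//= big1 ?addr0 ?indicE ?(mem_set kx) ?mul1r// => l lk.
    by rewrite one// mul0r.
  rewrite E1 E2 mulr1.
  exact: fine_close.
rewrite big1; last first.
  move=> k _; rewrite indicE memNset// => kx; apply: nok; by exists k.
rewrite /steps big1; last first.
  by move=> k _; rewrite indicE memNset ?mul0r// => kx; apply: nok; exists k.
by rewrite mulr0 subrr expr0n/= mulr_ge0// sqr_ge0.
Qed.

Let W k i := \sum_(j < n) e j * \1_(cell k i) (t j).

(** Abel summation: inside cell [k], being after node [i] is the same as being in [cell k i]. The
    errors are thereby separated from [D], which appears only through its node values and
    increments. *)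
Let steps_sum : \sum_(j < n) e j * steps (t j) =
  \sum_(k < N) D (node k 0) * W k 0 + \sum_(k < N) \sum_(1 <= i < q) dD k i * W k i.
Proof.
rewrite -big_split/= /steps.
under eq_bigr do rewrite mulr_sumr.
rewrite exchange_big/=; apply: eq_bigr => k _.
have -> : \sum_(1 <= i < q) dD k i * W k i =
    \sum_(j < n) \sum_(1 <= i < q) dD k i * (e j * \1_(cell k i) (t j)).
  by rewrite exchange_big/=; apply: eq_bigr => i _; rewrite mulr_sumr.
rewrite /W mulr_sumr -big_split/=; apply: eq_bigr => j _.
rewrite /fine !mulrDr; congr (_ + _); first by ring.
rewrite !mulr_sumr; apply: eq_big_nat => i /andP[i0 iq].
rewrite !cell_indic// 1?ltnW//.
have : node k 0 <= node k i by exact: node_le.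
have : node k i <= node k.+1 0 by rewrite -node_next node_le// ltnW.
rewrite /after => h1 h2.
case: (ltP (node k i) (t j)) => [lt|le]; last first.
  by rewrite (le_gtF (le_trans le h1)) /=; ring.
by rewrite (le_lt_trans h2 lt) /=; ring.
Qed.

Let amgm (nu x y : R) : 0 < nu -> `|x * y| <= (nu * x ^+ 2 + y ^+ 2 / nu) / 2.
Proof.
move=> nu0; rewrite normrM -[x ^+ 2]real_normK ?num_real// -[y ^+ 2]real_normK ?num_real//.
rewrite -subr_ge0; set p := `|x|; set r := `|y|.
have -> : (nu * p ^+ 2 + r ^+ 2 / nu) / 2 - p * r = (nu * p - r) ^+ 2 / nu / 2.
  by field; rewrite gt_eqF.
by rewrite !divr_ge0 ?sqr_ge0// ltW.
Qed.

Let sum_dD_sqr : \sum_(k < N) \sum_(1 <= i < q) dD k i ^+ 2 <= mesh / q%:R * BB.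
Proof.
apply: (@le_trans _ _ (\sum_(k < N) mesh / q%:R * (B (node k.+1 0) - B (node k 0)))).
  apply: ler_sum => k _.
  apply: (@le_trans _ _ (\sum_(1 <= i < q) mesh / q%:R * (B (node k i) - B (node k i.-1)))).
    apply: ler_sum_nat => -[//|i] /andP[_ iq]; rewrite /dD /= -(node_step k i).
    apply: modD; [exact: node_ge|exact: node_le|].
    apply: le_trans (node_le_stop (ltn_ord k)); rewrite -node_next.
    by apply: node_le; exact: ltnW.
  rewrite -mulr_sumr; have := telescope_pred (fun i => B (node k i)) q0; rewrite /= => ->.
  apply: ler_wpM2l; first by rewrite divr_ge0// ltW// mesh_gt0.
  rewrite lerD2r; apply: Bmono.
  - exact: node_ge.
  - by rewrite -node_next node_le// leq_pred.
  - exact: node_le_stop.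
by rewrite -mulr_sumr tele ler_wpM2l// divr_ge0// ltW// mesh_gt0.
Qed.

(** Three scales, each with its own weight: values at the ends of the cells, increments between
    inner nodes, and the remainder below the inner nodes, where the errors are paired one by one
    with a uniform bound. *)
Lemma noise_upper (nu nu' mu : R) : 0 < nu -> 0 < nu' -> 0 < mu -> 0 <= Q ->
  `|\sum_(j < n) e j * (D (t j) * inside (t j))| <=
  (nu * (2 * A2 + 2 * (mesh ^+ 2 * BB)) + lam / (nu * mesh)) / 2
  + (nu' * (mesh / q%:R * BB) + q%:R * lam / nu') / 2
  + (mu * lam + n%:R * ((mesh / q%:R) ^+ 2 * Q) / mu) / 2.
Proof.
move=> nu0 nu'0 mu0 Q0; have m0 := mesh_gt0.
have -> : \sum_(j < n) e j * (D (t j) * inside (t j)) =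
    \sum_(j < n) e j * steps (t j) +
    \sum_(j < n) e j * (D (t j) * inside (t j) - steps (t j)).
  by rewrite -big_split/=; apply: eq_bigr => j _; rewrite -mulrDr addrC subrK.
rewrite steps_sum; apply: le_trans (ler_normD _ _) _; apply: lerD; last first.
  apply: le_trans (ler_norm_sum _ _ _) _.
  apply: (@le_trans _ _ (\sum_(j < n) (mu * e j ^+ 2 + ((mesh / q%:R) ^+ 2 * Q) / mu) / 2)).
    apply: ler_sum => j _; apply: le_trans (amgm _ _ mu0) _.
    rewrite ler_wpM2r// lerD2l ler_wpM2r ?invr_ge0 ?(ltW mu0)//.
    exact: steps_close.
  rewrite -mulr_suml ler_wpM2r// big_split/= -mulr_sumr sumr_const card_ord.
  by rewrite -[_ *+ n]mulr_natl mulrA lerD2r ler_wpM2l// ltW.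
apply: le_trans (ler_normD _ _) _; apply: lerD.
  apply: le_trans (ler_norm_sum _ _ _) _.
  apply: (@le_trans _ _ (\sum_(k < N) (nu * mesh * D (node k 0) ^+ 2 + W k 0 ^+ 2 / (nu * mesh)) / 2)).
    by apply: ler_sum => k _; apply: amgm; rewrite mulr_gt0.
  rewrite -mulr_suml ler_wpM2r// big_split/= -mulr_sumr -mulr_suml -mulrA; apply: lerD.
    by rewrite ler_wpM2l ?(ltW nu0)//; exact: sum_node_sqr.
  by rewrite ler_wpM2r// invr_ge0 ltW// mulr_gt0.
apply: le_trans (ler_norm_sum _ _ _) _.
apply: (@le_trans _ _ (\sum_(k < N) \sum_(1 <= i < q) (nu' * dD k i ^+ 2 + W k i ^+ 2 / nu') / 2)).
  apply: ler_sum => k _; apply: le_trans (ler_norm_sum _ _ _) _.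
  by apply: ler_sum => i _; exact: amgm.
under eq_bigr do rewrite -mulr_suml big_split/= -mulr_sumr -mulr_suml.
rewrite -mulr_suml ler_wpM2r// big_split/= -mulr_sumr -mulr_suml; apply: lerD.
  by rewrite ler_wpM2l ?(ltW nu'0)//; exact: sum_dD_sqr.
rewrite ler_wpM2r ?invr_ge0 ?(ltW nu'0)//; apply: le_trans noise1.
apply: ler_sum => k _; rewrite -(big_mkord xpredT (fun i => W k i ^+ 2)).
by rewrite [leRHS](big_cat_nat (n := 1))//= lerDr sumr_ge0// => i _; rewrite sqr_ge0.
Qed.

End sample.
End functions.
End Grid.

(** * The favourable event *)

Section GoodEvent.
Context {R : realType} {d : measure_display} {Omega : measurableType d}.
Variable P : probability Omega R.

(** Measurability and sign accompany the bound because integrals of nonnegative functions add and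
    scale without integrability conditions, and Markov's inequality applies to them directly. *)
Definition mean_le (f : Omega -> R) (c : R) : Prop :=
  [/\ measurable_fun setT f, forall w, 0 <= f w & (\int[P]_w (f w)%:E <= c%:E)%E].

Lemma mean_leD f g a b : mean_le f a -> mean_le g b ->
  mean_le (fun w => f w + g w) (a + b).
Proof.
move=> [mf f0 fa] [mg g0 gb]; split.
- exact: measurable_funD.
- by move=> w; rewrite addr_ge0.
under eq_integral do rewrite EFinD.
rewrite ge0_integralD//; first by rewrite EFinD leeD.
- by move=> w _; rewrite lee_fin.
- exact/measurable_EFinP.
- by move=> w _; rewrite lee_fin.
- exact/measurable_EFinP.
Qed.

Lemma mean_leZ f k a : 0 <= k -> mean_le f a -> mean_le (fun w => k * f w) (k * a).
Proof.
move=> k0 [mf f0 fa]; split.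
- exact: measurable_funM.
- by move=> w; rewrite mulr_ge0.
under eq_integral do rewrite EFinM.
rewrite ge0_integralZl_EFin//; last 2 first.
- by move=> w _; rewrite lee_fin.
- exact/measurable_EFinP.
by rewrite EFinM; apply: lee_wpmul2l; rewrite ?lee_fin.
Qed.

Lemma mean_le_sum n (f : 'I_n -> Omega -> R) (a : 'I_n -> R) :
  (forall i, mean_le (f i) (a i)) ->
  mean_le (fun w => \sum_(i < n) f i w) (\sum_(i < n) a i).
Proof.
elim: n f a => [|n IH] f a h.
  rewrite big_ord0; split.
  - by under eq_fun do rewrite big_ord0; exact: measurable_cst.
  - by move=> w; rewrite big_ord0.
  - by under eq_integral do rewrite big_ord0; rewrite integral0.
rewrite big_ord_recl; have -> : (fun w => \sum_(i < n.+1) f i w) =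
    (fun w => f ord0 w + \sum_(i < n) f (lift ord0 i) w).
  by apply/funext => w; rewrite big_ord_recl.
by apply: mean_leD; [exact: h|apply: IH => i; exact: h].
Qed.

Lemma mean_leW f a b : a <= b -> mean_le f a -> mean_le f b.
Proof. by move=> ab [mf f0 fa]; split => //; apply: le_trans fa _; rewrite lee_fin. Qed.

Lemma mean_le_markov f a : mean_le f a ->
  measurable [set w | f w <= 1] /\ ((1 - a)%:E <= P [set w | (f w <= 1)%R])%E.
Proof.
move=> [mf f0 fa].
have mE : measurable [set w | f w <= 1].
  have -> : [set w | f w <= 1] = f @^-1` `]-oo, 1%R]%classic.
    by apply/seteqP; split => w /=; rewrite in_itv.
  by rewrite -[X in measurable X]setTI; apply: mf.
split => //; pose E := [set w | f w <= 1]; rewrite -/E in mE *.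
have mC : measurable (~` E) by exact: measurableC.
have PC : (P (~` E) <= a%:E)%E.
  apply: le_trans fa; rewrite -[X in (P X <= _)%E]setIT -integral_indic//.
  apply: ge0_le_integral => //.
  - by apply/measurable_EFinP; exact: measurable_indic.
  - exact/measurable_EFinP.
  move=> w _; rewrite lee_fin indicE; have [|_] := boolP (w \in ~` E) => //=.
  by rewrite inE /E/= => /negP; rewrite -ltNge => /ltW.
have PE : P E = (1 - P (~` E))%E.
  by rewrite -[E in LHS]setCK probability_setC.
rewrite PE EFinB leeB//.
Qed.

Variables (T eps : nat -> {RV P >-> R}) (sigma : R).
Hypothesis hind : mutually_independent
  (fun i : nat + nat => match i with inl j => T j | inr j => eps j end).
Hypothesis hmean : forall j, ('E_P[eps j] = 0)%E.
Hypothesis hvar : forall j, ('V_P[eps j] = (sigma ^+ 2)%:E)%E.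
Variables (fT : R -> R) (cT cT' : R).
Hypotheses (hfT : measurable_fun (`[0, 1]%classic : set R) fT)
  (hcT : 0 < cT <= cT')
  (hfTb : forall t : R, t \in `[0, 1] -> cT <= fT t <= cT')
  (hT : forall j, has_density_on `[0, 1] (T j) fT).

(** The law of [T 0] represents them all, since every [T j] has density [fT]. *)
Definition design_prob (A : set R) : R := fine (P (T 0 @^-1` A)).

Lemma design_probE A j : measurable A -> P (T j @^-1` A) = (design_prob A)%:E.
Proof.
move=> mA; rewrite /design_prob fineK; last first.
  apply: fin_num_measure; rewrite -[X in measurable X]setTI; exact: measurable_funPT.
by rewrite (hT j mA) (hT 0 mA).
Qed.

Lemma design_prob_itv l r : 0 <= l -> l <= r -> r <= 1 ->
  cT * (r - l) <= design_prob `]l, r]%classic <= cT' * (r - l).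
Proof.
move=> l0 lr r1.
have sub : `]l, r] `<=` `[0%R, 1%R].
  by move=> x /=; rewrite !in_itv/= => /andP[lx xr]; rewrite (le_trans l0 (ltW lx)) (le_trans xr).
have bnd x : x \in `]l, r]%classic -> cT <= fT x <= cT'.
  by rewrite inE => xin; apply: hfTb; exact: sub.
have c0 : 0 <= cT by case/andP: hcT => /ltW.
have mf : measurable_fun `]l, r] fT by apply: measurable_funS hfT.
have mE : lebesgue_measure `]l, r] = (r - l)%:E.
  rewrite lebesgue_measure_itv/= lte_fin.
  by move: lr; rewrite le_eqVlt => /predU1P[->|->] //; rewrite ltxx subrr.
have PE : (design_prob `]l, r]%classic)%:E = (\int[lebesgue_measure]_(x in `]l, r]) (fT x)%:E)%E.
  rewrite -(design_probE 0)// (hT 0)//; congr integral.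
  by apply/setIidPl.
have cstE (c : R) : ((c * (r - l))%:E = \int[lebesgue_measure]_(x in `]l, r]) c%:E)%E.
  by rewrite integral_cst//= mE EFinM.
rewrite -!lee_fin PE !cstE; apply/andP; split; apply: ge0_le_integral => //.
- exact/measurable_EFinP.
- by move=> x xin; rewrite lee_fin; have /andP[] := bnd x (mem_set xin).
- by move=> x xin; rewrite lee_fin; have /andP[h _] := bnd x (mem_set xin); exact: le_trans h.
- exact/measurable_EFinP.
- by move=> x xin; rewrite lee_fin; have /andP[] := bnd x (mem_set xin).
Qed.

Section size.
Variables (t0 t1 : R) (n N q : nat) (lam : R).
Hypotheses (t00 : 0 <= t0) (t01 : t0 < t1) (t11 : t1 <= 1)
  (n0 : (0 < n)%N) (N0 : (0 < N)%N) (q0 : (0 < q)%N) (lam0 : 0 < lam).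

Local Notation nod := (node t0 t1 N q).
Local Notation cel := (cell t0 t1 N q).
Local Notation msh := (mesh t0 t1 N).

Let m0 : 0 < msh. Proof. exact: mesh_gt0. Qed.
Let mcell k i : measurable (cel k i). Proof. exact: measurable_itv. Qed.

Let cell_prob (k i : nat) : (k < N)%N -> (i <= q)%N ->
  design_prob (cel k i) <= cT' * msh.
Proof.
move=> kN iq.
have h0 : nod k 0 <= nod k i by exact: node_le.
have h1 : nod k i <= nod k.+1 0 by rewrite -(node_next t0 t1 N q0) node_le.
have g0 : 0 <= nod k i by apply: le_trans t00 _; exact: node_ge.
have g1 : nod k.+1 0 <= 1 by apply: le_trans t11; exact: node_le_stop.
have /andP[_ h] := design_prob_itv g0 h1 g1.
apply: le_trans h _; case/andP: hcT => c0 c1.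
rewrite ler_wpM2l//; first by rewrite (le_trans (ltW c0)).
by rewrite -(node_mesh t0 t1 N q k); lra.
Qed.

Let cell_prob_ge (k : nat) : (k < N)%N -> cT * msh <= design_prob (cel k 0).
Proof.
move=> kN.
have h1 : nod k 0 <= nod k.+1 0 by rewrite -subr_ge0 node_mesh ltW.
have g0 : 0 <= nod k 0 by apply: le_trans t00 _; exact: node_ge.
have g1 : nod k.+1 0 <= 1 by apply: le_trans t11; exact: node_le_stop.
by have /andP[h _] := design_prob_itv g0 h1 g1; rewrite -(node_mesh t0 t1 N q k).
Qed.

Let W k i w := \sum_(j < n) eps j w * \1_(cel k i) (T j w).
Let V k w := \sum_(j < n) (\1_(cel k 0) (T j w) - design_prob (cel k 0)).

Let W_mean (k : 'I_N) i : (i <= q)%N ->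
  mean_le (fun w => W k i w ^+ 2) (n%:R * (sigma ^+ 2 * (cT' * msh))).
Proof.
move=> iq; split.
- apply: measurable_funX; apply: measurable_sum => j.
  exact: (measurable_masked T eps (mcell k i)).
- by move=> w; exact: sqr_ge0.
have := masked_sum_second_moment hind hmean hvar (mcell k i)
  (fun j => design_probE j (mcell k i)) n.
move=> h; apply: le_trans h _; rewrite lee_fin ler_wpM2l// ler_wpM2l ?sqr_ge0//.
exact: cell_prob.
Qed.

Let V_mean (k : 'I_N) : mean_le (fun w => V k w ^+ 2) (n%:R * (cT' * msh)).
Proof.
split.
- apply: measurable_funX; apply: measurable_sum => j.
  exact: (measurable_centred T (mcell k 0)).
- by move=> w; exact: sqr_ge0.
have := centred_sum_second_moment hind (mcell k 0)
  (fun j => design_probE j (mcell k 0)) n.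
move=> h; apply: le_trans h _; rewrite lee_fin ler_wpM2l//.
exact: cell_prob.
Qed.

Let eps_mean (j : 'I_n) : mean_le (fun w => eps j w ^+ 2) (sigma ^+ 2).
Proof.
split.
- exact: measurable_funX.
- by move=> w; exact: sqr_ge0.
by rewrite (noise_second_moment hmean hvar).
Qed.

(** A single nonnegative statistic: each sum to be controlled is divided by its allowed size, so
    that one use of Markov's inequality to [U <= 1] gives all the bounds. The count may deviate by
    half of the lower bound [cT * n * mesh] on its mean. *)
Let U w := lam^-1 * (\sum_(k < N) W k 0 w ^+ 2
   + q%:R^-1 * (\sum_(k < N) \sum_(i < q) W k i w ^+ 2) + \sum_(j < n) eps j w ^+ 2)
   + ((cT * n%:R * msh / 2) ^+ 2)^-1 * \sum_(k < N) V k w ^+ 2.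

Let U_mean : mean_le U (n%:R / lam * (sigma ^+ 2 * (2 * (cT' * (t1 - t0)) + 1))
  + 4 * cT' / (cT ^+ 2 * (t1 - t0)) * (N%:R ^+ 2 / n%:R)).
Proof.
have N0' : 0 < N%:R :> R by rewrite ltr0n.
have q0' : 0 < q%:R :> R by rewrite ltr0n.
have n0' : 0 < n%:R :> R by rewrite ltr0n.
have [c0 c1] := andP hcT.
have t010 : 0 < t1 - t0 by rewrite subr_gt0.
apply: (mean_leW (a := lam^-1 * (\sum_(k < N) (n%:R * (sigma ^+ 2 * (cT' * msh)))
   + q%:R^-1 * (\sum_(k < N) \sum_(i < q) (n%:R * (sigma ^+ 2 * (cT' * msh))))
   + \sum_(j < n) sigma ^+ 2)
   + ((cT * n%:R * msh / 2) ^+ 2)^-1 * \sum_(k < N) (n%:R * (cT' * msh)))).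
  have cE m (x : R) : \sum_(i < m) x = m%:R * x.
    by rewrite sumr_const card_ord mulr_natl.
  rewrite !cE.
  rewrite le_eqVlt; apply/orP; left; apply/eqP; rewrite /mesh.
  by field; rewrite !gt_eqF.
apply: mean_leD; apply: mean_leZ.
- by rewrite invr_ge0 ltW.
- apply: mean_leD; last exact: mean_le_sum.
  apply: mean_leD; first by apply: mean_le_sum => k; exact: W_mean.
  apply: mean_leZ; first by rewrite invr_ge0 ltW.
  apply: mean_le_sum => k; apply: mean_le_sum => i; apply: W_mean.
  exact: ltnW.
- by rewrite invr_ge0 sqr_ge0.
- exact: mean_le_sum.
Qed.

Lemma good_event : exists E : set Omega, [/\ measurable E,
  ((1 - (n%:R / lam * (sigma ^+ 2 * (2 * (cT' * (t1 - t0)) + 1))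
    + 4 * cT' / (cT ^+ 2 * (t1 - t0)) * (N%:R ^+ 2 / n%:R)))%:E <= P E)%E &
  forall w, E w -> [/\
    forall k, (k < N)%N -> cT / 2 * n%:R * msh <= \sum_(j < n) \1_(cel k 0) (T j w),
    \sum_(k < N) (\sum_(j < n) eps j w * \1_(cel k 0) (T j w)) ^+ 2 <= lam,
    \sum_(k < N) \sum_(i < q) (\sum_(j < n) eps j w * \1_(cel k i) (T j w)) ^+ 2
      <= q%:R * lam &
    \sum_(j < n) eps j w ^+ 2 <= lam]].
Proof.
have [mE PE] := mean_le_markov U_mean.
exists [set w | U w <= 1]; split => // w /=.
have q0' : 0 < q%:R :> R by rewrite ltr0n.
have n0' : 0 < n%:R :> R by rewrite ltr0n.
have [c0 c1] := andP hcT.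
rewrite /U; set a := \sum_(k < N) W k 0 w ^+ 2.
set b := \sum_(k < N) \sum_(i < q) W k i w ^+ 2; set e := \sum_(j < n) eps j w ^+ 2.
set v := \sum_(k < N) V k w ^+ 2; set s := cT * n%:R * msh / 2.
have s0 : 0 < s by rewrite divr_gt0// mulr_gt0// mulr_gt0.
have a0 : 0 <= a by apply: sumr_ge0 => k _; exact: sqr_ge0.
have b0 : 0 <= b by apply: sumr_ge0 => k _; apply: sumr_ge0 => i _; exact: sqr_ge0.
have e0 : 0 <= e by apply: sumr_ge0 => k _; exact: sqr_ge0.
have v0 : 0 <= v by apply: sumr_ge0 => k _; exact: sqr_ge0.
have qb0 : 0 <= q%:R^-1 * b by rewrite mulr_ge0// invr_ge0 ltW.
move=> U1.
have h1 : lam^-1 * (a + q%:R^-1 * b + e) <= 1.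
  by apply: le_trans U1; rewrite lerDl mulr_ge0// invr_ge0 sqr_ge0.
have h2 : v <= s ^+ 2.
  have : (s ^+ 2)^-1 * v <= 1.
    by apply: le_trans U1; rewrite lerDr mulr_ge0// ?invr_ge0 ?(ltW lam0)// !addr_ge0.
  by rewrite ler_pdivrMl ?exprn_gt0// mulr1.
have {}h1 : a + q%:R^-1 * b + e <= lam.
  by move: h1; rewrite ler_pdivrMl// mulr1.
split.
- move=> k kN.
  have : V k w ^+ 2 <= s ^+ 2.
    apply: le_trans h2; rewrite /v (bigD1 (Ordinal kN))//= lerDl.
    by apply: sumr_ge0 => i _; exact: sqr_ge0.
  rewrite -real_normK ?num_real// ler_pXn2r ?nnegrE ?(ltW s0)//.
  rewrite ler_norml => /andP[+ _]; rewrite /V sumrB sumr_const card_ord -[design_prob _ *+ n]mulr_natl.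
  have := cell_prob_ge kN; rewrite -(ler_pM2l n0'); rewrite /s; lra.
- by apply: (le_trans _ h1); rewrite -addrA lerDl addr_ge0.
- by rewrite -ler_pdivrMl//; apply: le_trans h1; rewrite [a + _]addrC -addrA lerDl addr_ge0.
- by apply: le_trans h1; rewrite lerDr addr_ge0.
Qed.

End size.
End GoodEvent.

(** * Trajectories of the vector fields near the drift *)

Section Localization.
Context {R : realType}.
Variables (K cl cu a b : R) (m : nat) (phi : 'I_m -> R -> R).
Hypotheses (sb : sieve_basis K cl cu a b phi) (K0 : 0 < K) (cl0 : 0 < cl)
  (clcu : cl <= cu) (m0 : (0 < m)%N).
Variables (u0 u1 t0 t1 gmin gmax G1 : R) (g Fg : R -> R) (bstar : 'rV[R]_m).
Local Notation M := (m%:R : R).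
Local Notation s := (scomb phi 0).

Hypotheses (u01 : u0 < u1) (t01 : t0 < t1) (gmin0 : 0 < gmin)
  (hg : forall u, u \in `[u0, u1] -> gmin <= g u <= gmax)
  (hg1 : forall u, u \in `[u0, u1] -> `|derive1n 1 g u| <= G1)
  (hFg : forall u, u \in `[u0, u1] -> is_derive u 1 Fg (g u)^-1)
  (Fgt : Fg u1 - Fg u0 = t1 - t0)
  (app0 : forall u, u \in `[u0, u1] -> `|g u - s bstar u| <= K / M ^+ 2)
  (app1 : forall u, u \in `[u0, u1] -> `|derive1n 1 g u - scomb phi 1 bstar u| <= K).

Definition bstar_bd : R := 8 * gmax ^+ 2 * (u1 - u0) / cl.
(** In units of [M ^- 2], how much faster than the true drift a field of the ball may cross
    [[u0, u1]]. *)
Definition time_cst : R := (gmin / 2) ^- 2 * ((K + 2^-1) * (u1 - u0) + cu / 2).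
(** At speed at most [2 * gmax], a margin of [marg / M ^ 2] takes at least [(time_cst + 2) / M ^ 2]
    to cross: [time_cst] for the error of the clock, one unit for the error of the starting point,
    one for strictness. *)
Definition marg : R := 2 * gmax * (time_cst + 2).
Definition lip_cst : R := G1 + 2 * K + 2 + marg ^+ 2 * bstar_bd * K.

Local Notation lo := (u0 - marg / M ^+ 2).
Local Notation hi := (u1 + marg / M ^+ 2).

Hypotheses (alo : a < lo) (hib : hi < b)
  (outside : K * M * ((u0 - a) + (b - u1)) <= cl / 2)
  (big0 : K <= M * (gmin / 8)) (big1 : K <= M * (gmin / 8) ^+ 2)
  (big2 : bstar_bd * K * marg ^+ 2 <= M * (gmin / 8) ^+ 2).

Let M1 : 1 <= M. Proof. by rewrite ler1n. Qed.
Let M0 : 0 < M. Proof. exact: lt_le_trans M1. Qed.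
Let cu0 : 0 < cu. Proof. exact: lt_le_trans clcu. Qed.
Let u0in : u0 \in `[u0, u1]. Proof. by rewrite in_itv/= lexx ltW. Qed.
Let u1in : u1 \in `[u0, u1]. Proof. by rewrite in_itv/= lexx ltW. Qed.
Let gmax0 : 0 < gmax.
Proof. by have /andP[h1 h2] := hg u0in; exact: lt_le_trans (le_trans h1 h2). Qed.

Let L0 : 0 < u1 - u0. Proof. by rewrite subr_gt0. Qed.
Lemma time_cst_gt0 : 0 < time_cst.
Proof.
by rewrite mulr_gt0 ?invr_gt0 ?exprn_gt0 ?divr_gt0// addr_gt0 ?mulr_gt0 ?divr_gt0// addr_gt0.
Qed.
Lemma marg_gt0 : 0 < marg.
Proof. by rewrite !mulr_gt0// addr_gt0// time_cst_gt0. Qed.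
Let bstar_bd0 : 0 < bstar_bd.
Proof. by rewrite divr_gt0// !mulr_gt0// exprn_gt0. Qed.

Let lam0 : 0 < marg / M ^+ 2. Proof. by rewrite divr_gt0 ?marg_gt0// exprn_gt0. Qed.
Let ab : a < b. Proof. by move: alo hib lam0 u01; lra. Qed.
Lemma lo_lt_hi : lo < hi. Proof. by move: lam0 u01; lra. Qed.
Let lohi_ab u : u \in `[lo, hi] -> u \in `[a, b].
Proof. by rewrite !in_itv/=; move: alo hib; lra. Qed.

Lemma app_le : K / M ^+ 2 <= gmin / 8.
Proof.
rewrite ler_pdivrMr ?exprn_gt0// expr2 mulrA.
apply: le_trans big0 _; rewrite mulrC -subr_ge0.
have -> : gmin / 8 * M * M - gmin / 8 * M = gmin / 8 * M * (M - 1) by ring.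
by rewrite mulr_ge0 ?subr_ge0// ?mulr_ge0// ?divr_ge0// ltW.
Qed.

(** On [[u0, u1]] the combination is at most [2 * gmax], being close to [g]; elsewhere it carries at
    most half of the lower bound [cl * sqn bstar] on the energy, by [outside]. The other half is
    thus bounded by the energy on [[u0, u1]]. *)
Lemma bstar_bound : sqn bstar <= bstar_bd.
Proof.
pose Ph := sqprim a phi 0 bstar.
have sq x : x \in `[a, b] -> s bstar x ^+ 2 <= sqn bstar * (K * M).
  by move=> xin; have := scomb_bound sb bstar (j := 0) isT xin; rewrite expr1.
have au : a <= u0 by move: alo lam0; lra.
have ub : u1 <= b by move: hib lam0; lra.
have h1 : Ph u0 - Ph a <= sqn bstar * (K * M) * (u0 - a).
  apply: (sqprim_le sb ab) => //; first by rewrite (le_trans _ ub)// ltW.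
  by move=> z; rewrite in_itv/= => /andP[az zu]; apply: sq;
    rewrite in_itv/= ltW//= ltW// (lt_le_trans zu)// (le_trans _ ub)// ltW.
have h2 : Ph b - Ph u1 <= sqn bstar * (K * M) * (b - u1).
  apply: (sqprim_le sb ab) => //; first by rewrite (le_trans au)// ltW.
  by move=> z; rewrite in_itv/= => /andP[uz zb]; apply: sq;
    rewrite in_itv/= (ltW zb) andbT ltW// (le_lt_trans _ uz)// (le_trans au)// ltW.
have h3 : Ph u1 - Ph u0 <= 4 * gmax ^+ 2 * (u1 - u0).
  apply: (sqprim_le sb ab) => //; first exact: ltW.
  move=> z /subset_itv_oo_cc zin; have := app0 zin; have /andP[g0 g1] := hg zin.
  have := app_le; set e := K / M ^+ 2.
  rewrite ler_norml => e1 /andP[h4 h5].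
  have s2 : s bstar z <= 2 * gmax by move: (le_trans g0 g1); lra.
  have s3 : 0 <= s bstar z by lra.
  have -> : 4 * gmax ^+ 2 = (2 * gmax) ^+ 2 by ring.
  by rewrite ler_pXn2r// nnegrE// mulr_ge0// ltW.
have Pa : Ph a = 0 by exact: sqprim_start.
have /andP[h4 _] := sqprim0_bounds sb bstar; rewrite -/Ph in h4.
have h5 : sqn bstar * (K * M * (u0 - a + (b - u1))) <= sqn bstar * (cl / 2).
  by rewrite ler_wpM2l// sqn_ge0.
rewrite /bstar_bd ler_pdivlMr//; lra.
Qed.

(** The approximation of [g] is known on [[u0, u1]] only. The mean value theorem carries it over the
    margin, at the price of one more derivative of the sieve. *)
Lemma scomb_near j beta x : (j < 2)%N -> x \in `[lo, hi] ->
  exists2 u, u \in `[u0, u1] &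
  (scomb phi j beta x - scomb phi j beta u) ^+ 2 <=
  (marg / M ^+ 2) ^+ 2 * (sqn beta * (K * M ^+ (3 + 2 * j))).
Proof.
move=> j2 xin.
have key y z : y \in `[lo, hi] -> z \in `[lo, hi] -> y <= z -> z - y <= marg / M ^+ 2 ->
    (scomb phi j beta z - scomb phi j beta y) ^+ 2 <=
    (marg / M ^+ 2) ^+ 2 * (sqn beta * (K * M ^+ (3 + 2 * j))).
  move=> yin zin yz zy.
  have sub w : w \in `[y, z] -> w \in `[a, b].
    by move: yin zin; rewrite !in_itv/=; move: alo hib; lra.
  have [c /sub cin ->] := MVT_segment yz
    (fun w win => scomb_derive sb beta j2 (sub w (subset_itv_oo_cc win)))
    (derive_within_continuous (fun w win => scomb_derive sb beta j2 (sub w win))).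
  have := scomb_bound sb beta (j := j.+1) j2 cin.
  have -> : (1 + 2 * j.+1 = 3 + 2 * j)%N by rewrite mulnS addnA.
  move=> h; rewrite exprMn mulrC; apply: ler_pM; rewrite ?sqr_ge0//.
  by rewrite ler_pXn2r ?nnegrE ?subr_ge0// ltW.
have [xu0|u0x] := ltP x u0.
  exists u0 => //; rewrite -sqrrN opprB; apply: key => //.
  - by rewrite in_itv/=; move: lam0 u01; lra.
  - exact: ltW.
  - by move: xin; rewrite in_itv/=; lra.
have [xu1|u1x] := leP x u1.
  exists x; first by rewrite in_itv/= u0x.
  rewrite subrr expr0n/= mulr_ge0 ?sqr_ge0// mulr_ge0 ?sqn_ge0//.
  by rewrite mulr_ge0 ?(ltW K0)// exprn_ge0// ltW.
exists u1 => //; apply: key => //.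
- by rewrite in_itv/=; move: lam0 u01; lra.
- exact: ltW.
- by move: xin; rewrite in_itv/=; lra.
Qed.

Section ball.
Variable beta : 'rV[R]_m.
Hypothesis hbeta : sqn (beta - bstar) <= M ^- 4.

Let betaE j x : scomb phi j beta x = scomb phi j bstar x + scomb phi j (beta - bstar) x.
Proof. by rewrite scombB; ring. Qed.

Let theta_bd j x : (j <= 1)%N -> x \in `[a, b] ->
  scomb phi j (beta - bstar) x ^+ 2 <= K * (M ^+ (1 + 2 * j) / M ^+ 4).
Proof.
move=> j1 xin; have := scomb_bound sb (beta - bstar) (leqW j1) xin.
move=> h; apply: le_trans h _.
have -> : K * (M ^+ (1 + 2 * j) / M ^+ 4) = M ^- 4 * (K * M ^+ (1 + 2 * j)) by ring.
by rewrite ler_wpM2r// mulr_ge0 ?exprn_ge0// ltW.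
Qed.

Let sq_le (x e : R) : 0 <= e -> x ^+ 2 <= e ^+ 2 -> `|x| <= e.
Proof. by move=> e0; rewrite -real_normK ?num_real// ler_pXn2r// nnegrE. Qed.

Let g80 : 0 <= gmin / 8. Proof. by rewrite divr_ge0// ltW. Qed.

Let pow_le i k : (i <= k)%N -> M ^+ i <= M ^+ k.
Proof. by move=> ik; rewrite ler_weXn2l. Qed.

(** Three errors of at most [gmin / 8] each: crossing the margin, the perturbation [beta - bstar],
    and the approximation of [g]. *)
Lemma ball_admissible : admissible phi lo hi (gmin / 2) (2 * gmax) beta.
Proof.
move=> x xin; have xab := lohi_ab xin.
have [u uin h] := scomb_near bstar (j := 0) isT xin.
have h1 : `|s bstar x - s bstar u| <= gmin / 8.
  apply: sq_le => //; apply: le_trans h _; rewrite muln0 addn0.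
  apply: (@le_trans _ _ ((marg / M ^+ 2) ^+ 2 * (bstar_bd * (K * M ^+ 3)))).
    rewrite ler_wpM2l ?sqr_ge0// ler_wpM2r ?bstar_bound//.
    by rewrite mulr_ge0 ?exprn_ge0// ltW.
  have -> : (marg / M ^+ 2) ^+ 2 * (bstar_bd * (K * M ^+ 3)) = bstar_bd * K * marg ^+ 2 / M.
    by field; rewrite gt_eqF.
  by rewrite ler_pdivrMr// [leRHS]mulrC.
have h2 : `|s (beta - bstar) x| <= gmin / 8.
  apply: sq_le => //; have := theta_bd (j := 0) isT xab.
  move=> h2; apply: le_trans h2 _; rewrite muln0 addn0.
  have -> : K * (M ^+ 1 / M ^+ 4) = K / M ^+ 3 by field; rewrite gt_eqF.
  rewrite ler_pdivrMr ?exprn_gt0//; apply: le_trans big1 _; rewrite [leLHS]mulrC.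
  by rewrite ler_wpM2l ?sqr_ge0//; have := @pow_le 1 3 isT; rewrite expr1.
have h3 := app0 uin; have h4 := app_le; have /andP[g0 g1] := hg uin.
have gg := le_trans g0 g1.
rewrite betaE; move: h1 h2 h3; rewrite !ler_norml; lra.
Qed.

(** The summands of [lip_cst] come from the slope of [g], its approximation, the crossing of the
    margin and the perturbation, whose slope is bounded thanks to the radius [M ^- 2]. *)
Lemma ball_lipschitz x : x \in `[lo, hi] -> `|scomb phi 1 beta x| <= lip_cst * M.
Proof.
move=> xin; have xab := lohi_ab xin.
have [u uin h] := scomb_near bstar (j := 1) isT xin.
have mb0 : 0 <= marg ^+ 2 * bstar_bd * K by rewrite mulr_ge0 ?(ltW K0)// mulr_ge0 ?sqr_ge0// ltW.
have h1 : `|scomb phi 1 bstar x - scomb phi 1 bstar u| <= (1 + marg ^+ 2 * bstar_bd * K) * M.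
  apply: sq_le; first by rewrite mulr_ge0// ?ler0n// addr_ge0.
  apply: le_trans h _; rewrite muln1.
  apply: (@le_trans _ _ ((marg / M ^+ 2) ^+ 2 * (bstar_bd * (K * M ^+ 5)))).
    rewrite ler_wpM2l ?sqr_ge0// ler_wpM2r ?bstar_bound//.
    by rewrite mulr_ge0 ?exprn_ge0// ltW.
  have -> : (marg / M ^+ 2) ^+ 2 * (bstar_bd * (K * M ^+ 5)) = marg ^+ 2 * bstar_bd * K * M.
    by field; rewrite gt_eqF.
  have e2 : M <= M ^+ 2 by have := @pow_le 1 2 isT; rewrite expr1.
  have e1 : marg ^+ 2 * bstar_bd * K <= (1 + marg ^+ 2 * bstar_bd * K) ^+ 2.
    by move: mb0; set z := _ * _ * _; have := sqr_ge0 z; nra.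
  have := ler_pM mb0 (ltW M0) e1 e2; by rewrite -exprMn.
have h2 : `|scomb phi 1 (beta - bstar) x| <= 1 + K.
  apply: sq_le; first by rewrite addr_ge0// ltW.
  have := theta_bd (j := 1) isT xab; move=> h2; apply: le_trans h2 _; rewrite muln1.
  have -> : K * (M ^+ 3 / M ^+ 4) = K / M by field; rewrite gt_eqF.
  rewrite ler_pdivrMr//.
  have : K <= (1 + K) ^+ 2 by move: K0; nra.
  move=> h3; apply: le_trans h3 _; rewrite ler_peMr// sqr_ge0//.
have h3 := app1 uin; have h4 := hg1 uin.
have G0 : 0 <= G1 by exact: le_trans h4.
have : `|scomb phi 1 beta x| <= G1 + K + (1 + marg ^+ 2 * bstar_bd * K) * M + (1 + K).
  rewrite betaE; move: h1 h2 h3 h4; rewrite !ler_norml; lra.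
move=> h5; apply: le_trans h5 _; rewrite /lip_cst.
have : G1 * 1 <= G1 * M by rewrite ler_wpM2l.
have : K * 1 <= K * M by rewrite ler_wpM2l// ltW.
by move: M1; lra.
Qed.

Lemma ball_exits_late v : `|v - u0| <= gmin / 2 / M ^+ 2 ->
  lo < v < hi /\ exits_late phi lo hi t0 t1 beta v.
Proof.
move=> hv; have M20 : 0 < M ^+ 2 by rewrite exprn_gt0.
have adm := ball_admissible.
have gG : gmin <= gmax by have /andP[h1 h2] := hg u0in; exact: le_trans h2.
have tc0 := time_cst_gt0.
have h0 : gmin / 2 / M ^+ 2 < marg / M ^+ 2.
  rewrite ltr_pM2r ?invr_gt0// /marg.
  have : 0 < gmax * time_cst by rewrite mulr_gt0.
  by move: gmax0 gmin0; lra.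
have hvin : lo < v < hi by move: hv; rewrite ler_norml => /andP[]; move: u01 lam0; lra.
split => //; rewrite /exits_late.
have io x : lo < x < hi -> x \in `[lo, hi] by rewrite in_itv/= => /andP[/ltW-> /ltW->].
have u0lh : u0 \in `[lo, hi] by rewrite in_itv/=; move: lam0 u01; lra.
have hi_in : hi \in `[lo, hi] by rewrite in_itv/=; move: lam0 u01; lra.
have gam0 : 0 < gmin / 2 by rewrite divr_gt0.
have gamGam : gmin / 2 <= 2 * gmax by move: gmax0 gmin0; lra.
have F1 : `|clockf phi lo hi beta v - clockf phi lo hi beta u0| <= M ^- 2.
  have [_ h] := clockf_dist sb alo lo_lt_hi hib gam0 gamGam adm u0lh (io _ hvin).
  by move: (le_trans h hv); rewrite ler_pM2l.
have F2 : marg / M ^+ 2 / (2 * gmax) <= clockf phi lo hi beta hi - clockf phi lo hi beta u1.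
  have u1h : u1 <= hi by move: lam0; lra.
  have lou : lo <= u1 by move: lam0 u01; lra.
  have := clockf_increment sb alo lo_lt_hi hib gam0 gamGam adm lou u1h (lexx hi).
  by rewrite addrAC subrr add0r => /andP[].
(* The clock of [beta] over [[u0, u1]] falls short of the true travel time by at most
   [time_cst / M ^ 2]; the difference of the integrands is [(s beta - g) / (g * s beta)]. *)
have F3 : t1 - t0 <= clockf phi lo hi beta u1 - clockf phi lo hi beta u0 + time_cst / M ^+ 2.
  rewrite -Fgt; pose c1 := (gmin / 2) ^- 2 * ((K + 2^-1) / M ^+ 2).
  pose c2 := (gmin / 2) ^- 2 * (M ^+ 2 / 2).
  pose Ph := sqprim a phi 0 (beta - bstar).
  pose f := clockf phi lo hi beta + ((fun x => c1 * x) + c2 \*: Ph).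
  have sub u : u \in `[u0, u1] -> u \in `[lo, hi].
    by rewrite !in_itv/=; move: lam0; lra.
  have df u : u \in `[u0, u1] -> is_derive u 1 f
     ((s beta u)^-1 + (c1 + c2 *: s (beta - bstar) u ^+ 2)).
    move=> uin; apply: is_deriveD.
      exact: (clockf_derive sb alo lo_lt_hi hib gam0 adm (sub _ uin)).
    apply: is_deriveD; first exact: is_derive_linear.
    apply: is_deriveZ; apply: (sqprim_derive sb ab) => //.
    by move: uin; rewrite !in_itv/=; move: alo hib lam0; lra.
  have := @derive_le R Fg f _ _ u0 u1 (ltW u01)
    (fun x xin => hFg (subset_itv_oo_cc xin)) (fun x xin => df x (subset_itv_oo_cc xin))
    (derive_within_continuous hFg) (derive_within_continuous df).
  have fE x : f x = clockf phi lo hi beta x + (c1 * x + c2 * Ph x) by [].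
  move=> h; have {}h : Fg u1 - Fg u0 <= f u1 - f u0.
    apply: h => x /subset_itv_oo_cc xin; rewrite /GRing.scale/=.
    have /andP[g0 g1] := hg xin; have /andP[s0 s1] := adm _ (sub _ xin).
    have gp : 0 < g x by exact: lt_le_trans g0.
    have sp : 0 < s beta x by exact: lt_le_trans s0.
    have e1 : (g x)^-1 = (s beta x)^-1 + (s beta x - g x) / (g x * s beta x).
      by field; rewrite !gt_eqF.
    rewrite e1 lerD2l.
    have e2 : s beta x - g x <= K / M ^+ 2 + `|s (beta - bstar) x|.
      have := app0 xin; rewrite betaE ler_norml => /andP[_ h1].
      have := ler_norm (s (beta - bstar) x); move: (app0 xin); rewrite ler_norml; lra.
    (* With weight [M ^ 2] both terms are of order [M ^- 2] after integration, as the energy of the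
       perturbation is at most [cu * M ^- 4]. Its pointwise bound would only give order
       [M ^ (-3/2)]. *)
    have e3 : `|s (beta - bstar) x| <= (M ^- 2 + M ^+ 2 * s (beta - bstar) x ^+ 2) / 2.
      rewrite -[s _ x ^+ 2]real_normK ?num_real//; set q := `|_|.
      have : 0 <= M ^+ 2 * (M ^- 2 - q) ^+ 2 by rewrite mulr_ge0 ?sqr_ge0// ltW.
      have -> : M ^+ 2 * (M ^- 2 - q) ^+ 2 = M ^- 2 - 2 * q + M ^+ 2 * q ^+ 2.
        by field; rewrite gt_eqF.
      lra.
    have Kp : 0 < K / M ^+ 2 by rewrite divr_gt0.
    apply: (@le_trans _ _ ((K / M ^+ 2 + `|s (beta - bstar) x|) / (g x * s beta x))).
      by rewrite ler_wpM2r// invr_ge0 mulr_ge0// ltW.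
    apply: (@le_trans _ _ ((K / M ^+ 2 + `|s (beta - bstar) x|) * (gmin / 2) ^- 2)).
      rewrite ler_wpM2l ?addr_ge0 ?(ltW Kp)// lef_pV2 ?posrE ?mulr_gt0 ?exprn_gt0//.
      by rewrite expr2 ler_pM ?(ltW gam0)// (le_trans _ g0)//; lra.
    have -> : c1 + c2 * s (beta - bstar) x ^+ 2 =
      (K / M ^+ 2 + (M ^- 2 + M ^+ 2 * s (beta - bstar) x ^+ 2) / 2) * (gmin / 2) ^- 2.
      by rewrite /c1 /c2; field; rewrite !gt_eqF.
    by rewrite ler_wpM2r ?invr_ge0 ?sqr_ge0// lerD2l.
  apply: le_trans h _; rewrite !fE.
  have au : a <= u0 by move: alo lam0; lra.
  have ub : u1 <= b by move: hib lam0; lra.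
  have /andP[_ h1] := sqprim_increment sb ab (beta - bstar) (j := 0) isT au (ltW u01) ub.
  have /andP[_ h2] := sqprim0_bounds sb (beta - bstar).
  have h3 : Ph u1 - Ph u0 <= cu * M ^- 4.
    by apply: le_trans h1 _; apply: le_trans h2 _; rewrite ler_wpM2l// ltW.
  have c20 : 0 <= c2 by rewrite mulr_ge0 ?invr_ge0 ?divr_ge0 ?exprn_ge0// ltW.
  have h4 := ler_wpM2l c20 h3.
  have h5 : c1 * (u1 - u0) + c2 * (cu * M ^- 4) = time_cst / M ^+ 2.
    by rewrite /c1 /c2 /time_cst; field; rewrite !gt_eqF.
  by rewrite -h5; lra.
have F4 : marg / M ^+ 2 / (2 * gmax) = (time_cst + 2) / M ^+ 2.
  by rewrite /marg; field; rewrite !gt_eqF.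
have F5 : (time_cst + 2) / M ^+ 2 = time_cst / M ^+ 2 + M ^- 2 + M ^- 2.
  by field; rewrite gt_eqF.
have F6 : 0 < M ^- 2 by rewrite invr_gt0.
by rewrite F4 F5 in F2; move: F1; rewrite ler_norml => /andP[]; lra.
Qed.

End ball.
End Localization.

(** * The objective function on a ball *)

Section MainInequality.
Context {R : realType}.
Variables (K cl cu a b : R) (m : nat) (phi : 'I_m -> R -> R).
Hypotheses (sb : sieve_basis K cl cu a b phi) (K0 : 0 < K) (cl0 : 0 < cl)
  (clcu : cl <= cu) (m0 : (0 < m)%N).
Variables (u0 u1 t0 t1 gmin gmax G1 : R) (g Fg : R -> R) (bstar : 'rV[R]_m).
Local Notation M := (m%:R : R).
Local Notation s := (scomb phi 0).
Local Notation gam := (gmin / 2).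
Local Notation Gam := (2 * gmax).

Hypotheses (u01 : u0 < u1) (t01 : t0 < t1) (gmin0 : 0 < gmin)
  (hg : forall u, u \in `[u0, u1] -> gmin <= g u <= gmax)
  (hg1 : forall u, u \in `[u0, u1] -> `|derive1n 1 g u| <= G1)
  (hFg : forall u, u \in `[u0, u1] -> is_derive u 1 Fg (g u)^-1)
  (Fgt : Fg u1 - Fg u0 = t1 - t0)
  (app0 : forall u, u \in `[u0, u1] -> `|g u - s bstar u| <= K / M ^+ 2)
  (app1 : forall u, u \in `[u0, u1] -> `|derive1n 1 g u - scomb phi 1 bstar u| <= K).

Local Notation bd := (bstar_bd cl u0 u1 gmax).
Local Notation mg := (marg K cu u0 u1 gmin gmax).
Local Notation CL := (lip_cst K cl cu u0 u1 gmin gmax G1).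
Local Notation lo := (u0 - mg / M ^+ 2).
Local Notation hi := (u1 + mg / M ^+ 2).

Variables (X : R -> R) (Xb : 'rV[R]_m -> R -> R -> R) (vh dv e0 : R).
(** With this choice [K * M * (kap / M) = cl / 4], half of the loss that [theta_le_sqdist]
    tolerates; the hypothesis [lost] below provides the other half. *)
Local Notation kap := (cl / (4 * K)).
(** Sieve bias plus the error of the initial value, amplified as in [traj_shift]. *)
Definition bias_bd : R := e0 + Gam / gam * dv.

Hypotheses (alo : a < lo) (hib : hi < b)
  (outside : K * M * ((u0 - a) + (b - u1)) <= cl / 2)
  (big0 : K <= M * (gmin / 8)) (big1 : K <= M * (gmin / 8) ^+ 2)
  (big2 : bd * K * mg ^+ 2 <= M * (gmin / 8) ^+ 2)
  (hode : forall beta v, solves_ode (gbeta a b phi beta) t0 t1 v (Xb beta v))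
  (hvh : `|vh - u0| <= dv) (hdv : dv <= gam / M ^+ 2)
  (Xt1 : X t1 = u1)
  (happ : forall t, t \in `[t0, t1] -> `|X t - Xb bstar u0 t| <= e0)
  (lost : K * M * ((vh - a) + (b - u1) + bias_bd) <= cl / 4)
  (short : dv + bias_bd + kap / M <= u1 - u0)
  (hab : b - a <= u1 - u0 + 1).

(** [cst1] is the constant of [theta_le_sqdist]; [cst2] and [cst3] are those of [diff_modulus] and
    [diff_lipschitz] once [|theta|^2] has been replaced by [cst1 * M ^ 2 * A2]. *)
Definition cst1 : R := 8 * Gam ^+ 4 / cl ^+ 2 * (K ^+ 2 + K / kap) * (Gam * gam ^- 2).
Definition cst2 : R := 2 * gam^-1 * cu * cst1 + 2 * CL ^+ 2.
Definition cst3 : R :=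
  2 * K * cst1 + 2 * CL ^+ 2 * (Gam ^+ 2 * ((u1 - u0 + 1) * (gam ^- 4 * (cu * cst1)))).

Let M1 : 1 <= M. Proof. by rewrite ler1n. Qed.
Let M0 : 0 < M. Proof. exact: lt_le_trans M1. Qed.
Let cu0 : 0 < cu. Proof. exact: lt_le_trans clcu. Qed.
Let gG : gmin <= gmax.
Proof.
have u0in : u0 \in `[u0, u1] by rewrite in_itv/= lexx ltW.
by have /andP[h1 h2] := hg u0in; exact: le_trans h2.
Qed.
Let gmax0 : 0 < gmax. Proof. exact: lt_le_trans gG. Qed.
Let gam0 : 0 < gam. Proof. by rewrite divr_gt0. Qed.
Let Gam0 : 0 < Gam. Proof. by rewrite mulr_gt0. Qed.
Let gamGam : gam <= Gam. Proof. by move: gmax0 gmin0 gG; lra. Qed.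
Let kap0 : 0 < kap. Proof. by rewrite divr_gt0// mulr_gt0. Qed.
Let lohi : lo < hi. Proof. exact: (lo_lt_hi K0 cl0 clcu m0 u01 gmin0 hg). Qed.
Let ab : a < b. Proof. exact: lt_trans (lt_trans alo lohi) hib. Qed.

Lemma cst1_gt0 : 0 < cst1.
Proof.
rewrite /cst1 mulr_gt0 ?mulr_gt0 ?invr_gt0 ?exprn_gt0 ?addr_gt0 ?exprn_gt0//.
by rewrite divr_gt0.
Qed.

Lemma cst2_gt0 : 0 < cst2.
Proof.
rewrite /cst2; apply: ltr_pwDl; last by rewrite mulr_ge0// sqr_ge0.
by rewrite mulr_gt0 ?cst1_gt0// mulr_gt0// mulr_gt0// invr_gt0.
Qed.

Lemma cst3_gt0 : 0 < cst3.
Proof.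
have L1 : 0 < u1 - u0 + 1 by move: u01; lra.
rewrite /cst3; apply: ltr_pwDl; first by rewrite mulr_gt0 ?cst1_gt0// mulr_gt0.
rewrite mulr_ge0//; first by rewrite mulr_ge0// sqr_ge0.
rewrite mulr_ge0 ?sqr_ge0// mulr_ge0 ?(ltW L1)// mulr_ge0//.
  by rewrite invr_ge0 exprn_ge0// ltW.
by rewrite mulr_ge0// ltW// cst1_gt0.
Qed.

Let adm beta (h : sqn (beta - bstar) <= M ^- 4) : admissible phi lo hi gam Gam beta :=
  ball_admissible sb K0 cl0 clcu m0 u01 gmin0 hg app0 alo hib outside big0 big1 big2 h.

Let late beta v (h : sqn (beta - bstar) <= M ^- 4) (hv : `|v - u0| <= gam / M ^+ 2) :=
  ball_exits_late sb K0 cl0 clcu m0 u01 gmin0 hg hFg Fgt app0 alo hib outside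
    big0 big1 big2 h hv.

Let bstar_ball : sqn (bstar - bstar) <= M ^- 4.
Proof. by rewrite subrr -(scale0r (0 : 'rV[R]_m)) sqnZ expr0n/= mul0r invr_ge0 exprn_ge0// ltW. Qed.

Let vh_near : `|vh - u0| <= gam / M ^+ 2. Proof. exact: le_trans hdv. Qed.
Let u0_near : `|u0 - u0| <= gam / M ^+ 2.
Proof. by rewrite subrr normr0 divr_ge0// ?exprn_ge0// ltW. Qed.

Lemma bias t : t \in `[t0, t1] -> `|X t - Xb bstar vh t| <= bias_bd.
Proof.
move=> tin; have [v1 l1] := late bstar_ball vh_near; have [v2 l2] := late bstar_ball u0_near.
have := traj_shift sb alo lohi hib gam0 gamGam t01 (adm bstar_ball) l2 v2 l1 v1
  (hode bstar u0) (hode bstar vh) tin.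
move=> h; rewrite -(subrK (Xb bstar u0 t) (X t)) -addrA.
apply: le_trans (ler_normD _ _) _; rewrite /bias_bd; apply: lerD; first exact: happ.
apply: le_trans h _; apply: ler_wpM2l; first exact: (ltW (divr_gt0 Gam0 gam0)).
by rewrite distrC.
Qed.

Section ball.
Variable beta : 'rV[R]_m.
Hypothesis hbeta : sqn (beta - bstar) <= M ^- 4.
Local Notation theta := (beta - bstar).
Let A2 := sqdist t0 (Xb beta vh) (Xb bstar vh) t1.
Let D t := Xb beta vh t - Xb bstar vh t.

(** The true trajectory ends at [u1], so the bias bound at time [t1] places the end of the
    trajectory of [bstar] close enough to [u1] for the conditions of the reverse inequality. *)
Lemma theta_bound : sqn theta <= cst1 * M ^+ 2 * A2.
Proof.
have [v1 l1] := late bstar_ball vh_near; have [v2 l2] := late hbeta vh_near.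
have t1in : t1 \in `[t0, t1] by rewrite in_itv/= lexx ltW.
have := bias t1in; rewrite Xt1 ler_norml => /andP[b1 b2].
have KM0 : 0 <= K * M by rewrite mulr_ge0// ltW.
have kK : K * M * (kap / M) = cl / 4 by field; rewrite !gt_eqF.
apply: (theta_le_sqdist sb ab K0 m0 alo lohi hib gam0 gamGam t01 v1
  (adm hbeta) (adm bstar_ball) l2 l1 (hode beta vh) (hode bstar vh) kap0 cl0).
  by move: hvh short; rewrite ler_norml => /andP[_]; lra.
have : K * M * (vh - a + (b - Xb bstar vh t1) + kap / M) <=
       K * M * (vh - a + (b - u1) + bias_bd) + K * M * (kap / M).
  by rewrite -mulrDr ler_wpM2l//; lra.
by rewrite kK; move: lost; lra.
Qed.

Lemma sqdist_ge0 : 0 <= A2.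
Proof.
have := le_trans (sqn_ge0 _) theta_bound.
by rewrite pmulr_rge0// mulr_gt0 ?exprn_gt0// cst1_gt0.
Qed.

Lemma path_modulus : exists2 B : R -> R,
  forall u t, t0 <= u -> u <= t -> t <= t1 ->
    (D t - D u) ^+ 2 <= (t - u) * (B t - B u)
  & B t1 - B t0 <= cst2 * M ^+ 2 * A2.
Proof.
have [v1 l1] := late bstar_ball vh_near; have [v2 l2] := late hbeta vh_near.
have [B hB BB] := diff_modulus sb ab alo lohi hib gam0 gamGam t01 v1
  (adm hbeta) (adm bstar_ball) l2 l1 (hode beta vh) (hode bstar vh)
  (ball_lipschitz sb K0 cl0 clcu m0 u01 gmin0 hg hg1 app0 app1 alo hib
     outside big0 hbeta).
exists B => //; apply: le_trans BB _; rewrite -/A2.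
have h : 2 * gam^-1 * (cu * sqn theta) <= 2 * gam^-1 * (cu * (cst1 * M ^+ 2 * A2)).
  by rewrite ler_wpM2l ?mulr_ge0 ?invr_ge0 ?(ltW gam0)// ler_wpM2l ?(ltW cu0)// theta_bound.
by rewrite /cst2; lra.
Qed.

Lemma path_lipschitz u t : t0 <= u -> u <= t -> t <= t1 ->
  (D t - D u) ^+ 2 <= (t - u) ^+ 2 * (cst3 * M ^+ 4 * A2).
Proof.
move=> t0u ut tt1.
have [v1 l1] := late bstar_ball vh_near; have [v2 l2] := late hbeta vh_near.
have := diff_lipschitz sb ab alo lohi hib gam0 gamGam t01 v1
  (adm hbeta) (adm bstar_ball) l2 l1 (hode beta vh) (hode bstar vh)
  (ball_lipschitz sb K0 cl0 clcu m0 u01 gmin0 hg hg1 app0 app1 alo hib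
     outside big0 hbeta) t0u ut tt1.
move=> h; apply: le_trans h _; rewrite ler_wpM2l ?sqr_ge0//.
have A0 := sqdist_ge0; have c10 := cst1_gt0.
have pw i : (i <= 4)%N -> M ^+ i <= M ^+ 4 by move=> ik; rewrite ler_weXn2l.
have e1 : 2 * (sqn theta * (K * M)) <= 2 * K * cst1 * M ^+ 4 * A2.
  apply: (@le_trans _ _ (2 * ((cst1 * M ^+ 2 * A2) * (K * M)))).
    by rewrite ler_wpM2l// ler_wpM2r ?theta_bound// mulr_ge0// ltW.
  have -> : 2 * (cst1 * M ^+ 2 * A2 * (K * M)) = 2 * K * cst1 * A2 * M ^+ 3 by ring.
  have -> : 2 * K * cst1 * M ^+ 4 * A2 = 2 * K * cst1 * A2 * M ^+ 4 by ring.
  rewrite ler_wpM2l ?pw//.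
  by rewrite mulr_ge0// mulr_ge0 ?(ltW c10)// mulr_ge0// ltW.
have e2 : Gam ^+ 2 * ((b - a) * (gam ^- 4 * (cu * sqn theta))) <=
    Gam ^+ 2 * ((u1 - u0 + 1) * (gam ^- 4 * (cu * cst1))) * (M ^+ 2 * A2).
  have -> : Gam ^+ 2 * ((u1 - u0 + 1) * (gam ^- 4 * (cu * cst1))) * (M ^+ 2 * A2) =
      Gam ^+ 2 * ((u1 - u0 + 1) * (gam ^- 4 * (cu * (cst1 * M ^+ 2 * A2)))) by ring.
  have g4 : 0 <= gam ^- 4 by rewrite invr_ge0 exprn_ge0// ltW.
  apply: ler_wpM2l; first exact: sqr_ge0.
  apply: ler_pM => //.
  - by rewrite subr_ge0 ltW.
  - by rewrite mulr_ge0// mulr_ge0 ?sqn_ge0// ltW.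
  - by rewrite ler_wpM2l// ler_wpM2l ?(ltW cu0)// theta_bound.
have e3 : 2 * (CL * M) ^+ 2 * (Gam ^+ 2 * ((b - a) * (gam ^- 4 * (cu * sqn theta)))) <=
    2 * (CL * M) ^+ 2 * (Gam ^+ 2 * ((u1 - u0 + 1) * (gam ^- 4 * (cu * cst1))) * (M ^+ 2 * A2)).
  by rewrite ler_wpM2l// mulr_ge0// sqr_ge0.
apply: le_trans (lerD e1 e3) _; rewrite /cst3 le_eqVlt; apply/orP; left; apply/eqP.
ring.
Qed.

Section sample.
Variables (n q : nat) (t e : nat -> R) (cT lam : R).
Local Notation N := (q * m)%N.
Hypotheses (mn : (m <= n)%N) (q0 : (0 < q)%N) (qbig : 4 * cst2 <= q%:R ^+ 2)
  (cT0 : 0 < cT) (t1t0 : t1 - t0 <= 1)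
  (count : forall k, (k < N)%N ->
     cT / 2 * n%:R * mesh t0 t1 N <= \sum_(j < n) \1_(cell t0 t1 N n k 0) (t j))
  (noise0 : \sum_(k < N) (\sum_(j < n) e j * \1_(cell t0 t1 N n k 0) (t j)) ^+ 2 <= n%:R * lam)
  (noise1 : \sum_(k < N) \sum_(i < n) (\sum_(j < n) e j * \1_(cell t0 t1 N n k i) (t j)) ^+ 2
            <= n%:R * (n%:R * lam))
  (noise2 : \sum_(j < n) e j ^+ 2 <= n%:R * lam).

(** [cst4] gathers the coefficients of [nu0 * n * A2] at the three scales of [noise_upper]; [cst5]
    gathers those of [M * lam], doubled since the noise enters the objective twice. *)
Definition cst4 : R := (5 / 2 + cst2 / q%:R + cst3) / 2.
Definition cst5 : R := 64 * cst4 / cT * (q%:R / (t1 - t0) + 2).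

Let inside (x : R) : R := \1_(`[t0, t1]) x.

Lemma objective_gap :
  cT / 32 * n%:R * A2 - 2 * n%:R * bias_bd ^+ 2 - cst5 * M * lam <=
  \sum_(j < n) (X (t j) + e j - Xb beta vh (t j)) ^+ 2 * inside (t j)
  - \sum_(j < n) (X (t j) + e j - Xb bstar vh (t j)) ^+ 2 * inside (t j).
Proof.
have n0 : (0 < n)%N by exact: leq_trans mn.
have N0 : (0 < N)%N by rewrite muln_gt0 q0.
have n0' : 0 < n%:R :> R by rewrite ltr0n.
have q0' : 0 < q%:R :> R by rewrite ltr0n.
have mn' : M <= n%:R by rewrite ler_nat.
have A0 := sqdist_ge0; have c20 := cst2_gt0; have c30 := cst3_gt0.
have [B hB BB] := path_modulus.
have D0 : D t0 = 0 by have [x _ _] := hode beta vh; have [y _ _] := hode bstar vh; rewrite /D x y subrr.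
have hmean := sqdist_mean t01 (hode beta vh) (hode bstar vh).
have HA : sqdist t0 (Xb beta vh) (Xb bstar vh) t1 - sqdist t0 (Xb beta vh) (Xb bstar vh) t0 = A2.
  by rewrite sqdist_start subr0.
set S := \sum_(j < n) D (t j) ^+ 2 * inside (t j).
set Z := \sum_(j < n) e j * (D (t j) * inside (t j)).
have dl : cT / 2 * n%:R * (A2 / 2 - mesh t0 t1 N ^+ 2 * (cst2 * M ^+ 2 * A2)) <= S.
  apply: (design_lower (D := D) t01 N0 n0 D0 hmean hB HA BB (n := n) (t := t)) => //.
  by rewrite divr_ge0// ltW.
have meshE : mesh t0 t1 N = (t1 - t0) / (q%:R * M) by rewrite /mesh natrM.
have tt0 : 0 < t1 - t0 by rewrite subr_gt0.
have tt1 : (t1 - t0) ^+ 2 <= 1 by rewrite expr_le1// ltW.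
(* The mesh [1 / (q M)] cancels the factor [M ^ 2] of the modulus, and [qbig] makes the remaining
   factor at most a quarter. *)
have mBB : mesh t0 t1 N ^+ 2 * (cst2 * M ^+ 2 * A2) <= A2 / 4.
  rewrite meshE.
  have -> : ((t1 - t0) / (q%:R * M)) ^+ 2 * (cst2 * M ^+ 2 * A2) =
     (t1 - t0) ^+ 2 * (cst2 / q%:R ^+ 2 * A2) by field; rewrite !gt_eqF.
  have h1 : cst2 / q%:R ^+ 2 <= 4^-1.
    by rewrite ler_pdivrMr ?exprn_gt0// mulrC; move: qbig; lra.
  have h2 : cst2 / q%:R ^+ 2 * A2 <= 4^-1 * A2 by rewrite ler_wpM2r.
  have h3 : 0 <= cst2 / q%:R ^+ 2 * A2.
    by rewrite mulr_ge0// divr_ge0 ?exprn_ge0// ltW.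
  have := ler_wpM2r h3 tt1; lra.
have SE : cT / 8 * n%:R * A2 <= S.
  apply: le_trans dl.
  have -> : cT / 8 * n%:R * A2 = cT / 2 * n%:R * (A2 / 4) by field.
  by rewrite ler_wpM2l ?mulr_ge0 ?divr_ge0 ?(ltW cT0)//; lra.
have c40 : 0 < cst4 by rewrite /cst4 divr_gt0// addr_gt0// addr_gt0// divr_gt0//.
(* Calibrated so that [2 * Z] takes at most [cT / 32 * n * A2] besides the term in [lam]: half of
   what is guaranteed by [S / 2], the other half of [S] going to the bias. *)
pose nu0 := cT / (64 * cst4).
have nu00 : 0 < nu0 by rewrite divr_gt0// mulr_gt0.
have Q0 : 0 <= cst3 * M ^+ 4 * A2.
  by rewrite mulr_ge0// mulr_ge0 ?exprn_ge0// ltW.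
have nz : `|Z| <= cT / 64 * n%:R * A2 + cst5 / 2 * M * lam.
  (* Each cell gets [n] inner nodes, which makes the remainder small. The three weights turn every
     noise term into a multiple of [M * lam / nu0] and every term in [D] into at most a multiple of
     [nu0 * n * A2]. *)
  have := @noise_upper R t0 t1 N n t01 N0 n0 D _ B (cst3 * M ^+ 4 * A2) A2
    (cst2 * M ^+ 2 * A2) D0 hmean hB path_lipschitz HA BB n t e (n%:R * lam)
    noise0 noise1 noise2 (nu0 * n%:R) (nu0 * n%:R ^+ 2 / M) (M / (nu0 * n%:R)).
  rewrite -/Z => h.
  have {}h := h (mulr_gt0 nu00 n0') (divr_gt0 (mulr_gt0 nu00 (exprn_gt0 2 n0')) M0)
    (divr_gt0 M0 (mulr_gt0 nu00 n0')) Q0.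
  apply: le_trans h _.
  have lam0 : 0 <= lam.
    have : 0 <= n%:R * lam.
      by apply: le_trans noise2; apply: sumr_ge0 => j _; exact: sqr_ge0.
    by rewrite pmulr_rge0.
  have T1 : nu0 * n%:R * (2 * A2 + 2 * (mesh t0 t1 N ^+ 2 * (cst2 * M ^+ 2 * A2)))
     <= nu0 * n%:R * (5 / 2 * A2).
    apply: ler_wpM2l; first by rewrite mulr_ge0// ltW.
    by move: mBB; set z := mesh _ _ _ ^+ 2 * _; lra.
  have T2 : n%:R * lam / (nu0 * n%:R * mesh t0 t1 N) = nu0^-1 * (q%:R / (t1 - t0)) * M * lam.
    by rewrite meshE; field; rewrite !gt_eqF.
  have T3 : nu0 * n%:R ^+ 2 / M * (mesh t0 t1 N / n%:R * (cst2 * M ^+ 2 * A2))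
     = (t1 - t0) * (nu0 * n%:R * (cst2 / q%:R * A2)).
    by rewrite meshE; field; rewrite !gt_eqF.
  have T3' : (t1 - t0) * (nu0 * n%:R * (cst2 / q%:R * A2)) <= nu0 * n%:R * (cst2 / q%:R * A2).
    have w0 : 0 <= nu0 * n%:R * (cst2 / q%:R * A2).
      apply: mulr_ge0; first exact: (ltW (mulr_gt0 nu00 n0')).
      by apply: mulr_ge0 => //; exact: (ltW (divr_gt0 c20 q0')).
    exact: ler_piMl.
  have T4 : n%:R * (n%:R * lam) / (nu0 * n%:R ^+ 2 / M) = nu0^-1 * M * lam.
    by field; rewrite !gt_eqF.
  have T5 : M / (nu0 * n%:R) * (n%:R * lam) = nu0^-1 * M * lam.
    by field; rewrite !gt_eqF.
  have T6 : n%:R * ((mesh t0 t1 N / n%:R) ^+ 2 * (cst3 * M ^+ 4 * A2)) / (M / (nu0 * n%:R))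
     = ((t1 - t0) ^+ 2 / q%:R ^+ 2) * (nu0 * (cst3 * A2) * M).
    by rewrite meshE; field; rewrite !gt_eqF.
  have T6' : ((t1 - t0) ^+ 2 / q%:R ^+ 2) * (nu0 * (cst3 * A2) * M) <=
      nu0 * n%:R * (cst3 * A2).
    have h1 : (t1 - t0) ^+ 2 / q%:R ^+ 2 <= 1.
      rewrite ler_pdivrMr ?exprn_gt0// mul1r; apply: le_trans tt1 _.
      by rewrite exprn_ege1// ler1n.
    have h2 : 0 <= nu0 * (cst3 * A2) by apply: mulr_ge0 (ltW nu00) (mulr_ge0 (ltW c30) A0).
    have h3 : nu0 * (cst3 * A2) * M <= nu0 * (cst3 * A2) * n%:R by apply: ler_wpM2l.
    have h4 : 0 <= nu0 * (cst3 * A2) * M by exact: mulr_ge0 h2 (ltW M0).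
    apply: le_trans (ler_wpM2r h4 h1) _; rewrite mul1r; apply: le_trans h3 _.
    by rewrite mulrAC.
  have nu0E : nu0 * cst4 = cT / 64 by rewrite /nu0; field; rewrite gt_eqF.
  have E4 : cT / 64 * n%:R * A2 =
     (nu0 * n%:R * (5 / 2 * A2) + nu0 * n%:R * (cst2 / q%:R * A2) + nu0 * n%:R * (cst3 * A2)) / 2.
    by rewrite -nu0E /cst4; field; rewrite gt_eqF.
  have E5 : cst5 / 2 * M * lam =
     (nu0^-1 * (q%:R / (t1 - t0)) * M * lam + nu0^-1 * M * lam + nu0^-1 * M * lam) / 2.
    by rewrite /cst5 /nu0; field; rewrite !gt_eqF.
  rewrite T2 T3 T4 T5 T6 E4 E5; lra.
have -> : \sum_(j < n) (X (t j) + e j - Xb beta vh (t j)) ^+ 2 * inside (t j)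
  - \sum_(j < n) (X (t j) + e j - Xb bstar vh (t j)) ^+ 2 * inside (t j)
  = S - 2 * Z - \sum_(j < n) 2 * ((X (t j) - Xb bstar vh (t j)) * (D (t j) * inside (t j))).
  by rewrite /S /Z mulr_sumr -!sumrB; apply: eq_bigr => j _; rewrite /D; ring.
have bz : \sum_(j < n) 2 * ((X (t j) - Xb bstar vh (t j)) * (D (t j) * inside (t j))) <=
    S / 2 + 2 * n%:R * bias_bd ^+ 2.
  have -> : 2 * n%:R * bias_bd ^+ 2 = \sum_(j < n) 2 * bias_bd ^+ 2.
    by rewrite sumr_const card_ord mulrAC mulr_natr.
  rewrite /S mulr_suml -big_split/=; apply: ler_sum => j _; rewrite /inside indicE.
  have [tin|_] := boolP (t j \in _); last first.
    by rewrite /= !mulr0 mul0r add0r mulr_ge0// sqr_ge0.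
  rewrite /= !mulr1.
  have := bias (set_mem tin); set x := X _ - _ => hx.
  have : x ^+ 2 <= bias_bd ^+ 2.
    rewrite -real_normK ?num_real// ler_pXn2r// nnegrE//; exact: le_trans hx.
  have := sqr_ge0 (D (t j) - 2 * x); nra.
have := ler_norm Z; lra.
Qed.

End sample.
End ball.

(** [traj_sqdist] applies to any two vectors of the ball, not only to comparisons with [bstar], and
    bounds the squared distance of the trajectories by a multiple of that of the coefficients. *)
Lemma traj_continuous t : t \in `[t0, t1] ->
  {within [set beta | sqn (beta - bstar) <= M ^- 4], continuous (fun beta => Xb beta vh t)}.
Proof.
move=> tin; apply/subspace_continuousP => beta hbeta.
pose c := Gam ^+ 2 * ((b - a) * (gam ^- 4 * cu)).
have sq0 : c * sqn (beta - y) @[y --> within [set y | sqn (y - bstar) <= M ^- 4] (nbhs beta)]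
    --> (0 : R).
  rewrite -[X in _ --> X](mulr0 c); apply: cvgMr.
  have -> : (0 : R) = sqn (beta - beta).
    by rewrite subrr -(scale0r (0 : 'rV[R]_m)) sqnZ expr0n/= mul0r.
  apply: cvg_trans; first exact: cvg_app (cvg_within _).
  apply: (@cvg_comp _ _ _ (fun y => beta - y) (@sqn R m) _ (nbhs (beta - beta))).
    by apply: cvgB; [exact: cvg_cst|exact: cvg_id].
  exact: sqn_continuous.
apply/cvgrPdist_le => e epos.
have e2 : 0 < e ^+ 2 by rewrite exprn_gt0.
move/cvgrPdist_le : sq0 => /(_ _ e2) near0.
near=> y.
have hy : sqn (y - bstar) <= M ^- 4.
  by near: y; exact: (withinT [set y : 'rV[R]_m | sqn (y - bstar) <= M ^- 4]).
have [v1 l1] := late hy vh_near; have [v2 l2] := late hbeta vh_near.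
have := traj_sqdist sb ab alo lohi hib gam0 gamGam t01 v1
  (adm hbeta) (adm hy) l2 l1 (hode beta vh) (hode y vh) tin.
have -> : Gam ^+ 2 * ((b - a) * (gam ^- 4 * (cu * sqn (beta - y)))) = c * sqn (beta - y).
  by rewrite /c; ring.
have h : `|0 - c * sqn (beta - y)| <= e ^+ 2 by near: y.
rewrite sub0r normrN in h.
move=> h1; have := le_trans (le_trans h1 (ler_norm _)) h.
by rewrite -real_normK ?num_real// ler_pXn2r// nnegrE// ltW.
Unshelve. all: by end_near.
Qed.

Section minimum.
Variables (n q : nat) (t e : nat -> R) (cT lam alp : R).
Local Notation N := (q * m)%N.
Hypotheses (mn : (m <= n)%N) (q0 : (0 < q)%N) (qbig : 4 * cst2 <= q%:R ^+ 2)
  (cT0 : 0 < cT) (t1t0 : t1 - t0 <= 1)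
  (count : forall k, (k < N)%N ->
     cT / 2 * n%:R * mesh t0 t1 N <= \sum_(j < n) \1_(cell t0 t1 N n k 0) (t j))
  (noise0 : \sum_(k < N) (\sum_(j < n) e j * \1_(cell t0 t1 N n k 0) (t j)) ^+ 2 <= n%:R * lam)
  (noise1 : \sum_(k < N) \sum_(i < n) (\sum_(j < n) e j * \1_(cell t0 t1 N n k i) (t j)) ^+ 2
            <= n%:R * (n%:R * lam))
  (noise2 : \sum_(j < n) e j ^+ 2 <= n%:R * lam)
  (alpM : alp <= M ^- 2) (alp0 : 0 < alp)
  (gap : 2 * n%:R * bias_bd ^+ 2 + cst5 q cT * M * lam <
         cT / 32 * n%:R * (alp ^+ 2 / (cst1 * M ^+ 2))).

Let obj beta :=
  \sum_(j < n) (X (t j) + e j - Xb beta vh (t j)) ^+ 2 * \1_(`[t0, t1]) (t j).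

Lemma objective_continuous :
  {within [set beta | sqn (beta - bstar) <= M ^- 4], continuous obj}.
Proof.
apply/subspace_continuousP => beta hbeta; apply: cvg_sumr => j; rewrite indicE.
have [tin|tout] := boolP (t j \in _); last first.
  by rewrite mulr0; under eq_fun do rewrite mulr0; exact: cvg_cst.
rewrite mulr1; under eq_fun do rewrite mulr1 expr2; rewrite expr2.
have /subspace_continuousP/(_ beta hbeta) h := traj_continuous (set_mem tin).
by apply: cvgM; apply: cvgB => //; exact: cvg_cst.
Qed.

Let enormE (v : 'rV[R]_m) : (enorm v <= M ^- 2) = (sqn v <= M ^- 4).
Proof.
have -> : M ^- 4 = (M ^- 2) ^+ 2 by field; rewrite gt_eqF.
have h : 0 <= M ^- 2 by rewrite invr_ge0 exprn_ge0// ltW.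
by rewrite -{1}(ger0_norm h) -sqrtr_sqr ler_sqrt ?sqr_ge0.
Qed.

Lemma objective_minimum : exists bh, [/\ local_min obj bh,
  global_min_within obj bstar (M ^- 2) bh & sqn (bh - bstar) <= alp ^+ 2].
Proof.
have cb : compact [set beta | sqn (beta - bstar) <= M ^- 4].
  apply: (@sqn_bounded_compact _ _ _ (2 * M ^- 4 + 2 * sqn bstar)).
    exact: closed_sqn_ball.
  move=> v /= h; apply: (@le_trans _ _ (2 * sqn (v - bstar) + 2 * sqn bstar)).
    rewrite /sqn !mulr_sumr -big_split/=; apply: ler_sum => k _; rewrite !mxE.
    by have := sqr_ge0 (v 0 k - 2 * bstar 0 k); lra.
  by lra.
have [bh /set_mem/= hbh bhmin] := EVT_min_rV (ex_intro _ bstar bstar_ball) cb objective_continuous.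
(* Since [bstar] competes in the minimisation, the objective at [bh] is not larger than at [bstar];
   coefficients at distance [alp] or more would make [A2] so large that [gap] contradicts this. *)
have bhs : sqn (bh - bstar) < alp ^+ 2.
  rewrite ltNge; apply/negP => big.
  have := objective_gap hbh mn q0 qbig cT0 t1t0 count noise0 noise1 noise2.
  rewrite -/(obj bh) -/(obj bstar); have := bhmin bstar (mem_set bstar_ball).
  set A2 := sqdist _ _ _ _; move: (obj bh) (obj bstar) => o1 o2 ho hgap.
  have h1 : alp ^+ 2 / (cst1 * M ^+ 2) <= A2.
    rewrite ler_pdivrMr; last by rewrite mulr_gt0 ?cst1_gt0 ?exprn_gt0.
    by rewrite mulrC; exact: le_trans big (theta_bound hbh).
  have c0 : 0 <= cT / 32 * n%:R by rewrite mulr_ge0 ?divr_ge0// ltW.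
  by have := ler_wpM2l c0 h1; move: gap ho hgap; lra.
have M4 : alp ^+ 2 <= M ^- 4.
  have -> : M ^- 4 = (M ^- 2) ^+ 2 by field; rewrite gt_eqF.
  by rewrite ler_pXn2r// nnegrE ?(ltW alp0)// invr_ge0 exprn_ge0// ltW.
exists bh; split; last exact: ltW.
  (* Strict inequality puts [bh] inside the open ball, so all nearby vectors are competitors too. *)
  have op : \forall y \near bh, sqn (y - bstar) < M ^- 4.
    have : sqn (y - bstar) @[y --> bh] --> sqn (bh - bstar).
      apply: (@cvg_comp _ _ _ (fun y => y - bstar) (@sqn R m) _ (nbhs (bh - bstar))).
        exact: (cvgB (f := id) cvg_id (cvg_cst bstar)).
      exact: sqn_continuous.
    by move=> hc; exact: (cvgr_lt _ hc _ (lt_le_trans bhs M4)).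
  by apply: filterS op => y hy; exact: (bhmin _ (mem_set (ltW hy))).
split; first by rewrite enormE.
by move=> y; rewrite enormE => hy; exact: (bhmin _ (mem_set hy)).
Qed.

End minimum.

(** The pointwise square is at most [2 * s (beta - bstar) ^ 2 + 2 * r ^ 2]; the first part is
    enlarged to the energy over the whole of [[a, b]], which the Gram matrix controls. *)
Lemma estimator_risk (cg : {within `[u0, u1], continuous g}) beta (r alp : R) :
  (forall u, u \in `[u0, u1] -> `|g u - s bstar u| <= r) ->
  sqn (beta - bstar) <= alp ^+ 2 ->
  (\int[lebesgue_measure]_(u in `[u0, u1]) (`|gbeta a b phi beta u - g u| ^+ 2)%:E <=
   (2 * cu * alp ^+ 2 + 2 * r ^+ 2 * (u1 - u0))%:E)%E.
Proof.
move=> hr halp; pose f x := (s beta x - g x) * (s beta x - g x).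
have mg0 : 0 < mg / M ^+ 2.
  by rewrite divr_gt0 ?exprn_gt0// (marg_gt0 K0 cl0 clcu u01 gmin0 hg).
have sub u : u \in `[u0, u1] -> u \in `[a, b].
  by rewrite !in_itv/=; move: alo hib mg0; lra.
have cs : {within `[u0, u1], continuous (s beta)}.
  apply: derive_within_continuous => x /sub; exact: (scomb_derive sb beta (j := 0) isT).
have cd : {within `[u0, u1], continuous (fun x => s beta x - g x)}.
  by move=> x; apply: cvgB; [exact: cs|exact: cg].
have cf : {within `[u0, u1], continuous f} by exact: within_continuousM.
have intf := within_integrable cf.
rewrite (_ : integral _ _ _ = \int[lebesgue_measure]_(u in `[u0, u1]) (f u)%:E)%E; last first.
  apply: eq_integral => u /set_mem/= uin.
  by rewrite /f (gbetaE _ _ (sub _ uin)) real_normK ?num_real// expr2.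
have fin : (\int[lebesgue_measure]_(u in `[u0, u1]) (f u)%:E)%E \is a fin_num.
  exact: integrable_fin_num.
have <- := fineK fin.
rewrite -[fine _]/(primitive f u0 u1) lee_fin.
pose Ph := sqprim a phi 0 (beta - bstar).
pose h := (fun x => 2 * r ^+ 2 * x) + 2 \*: Ph.
have hE x : h x = 2 * r ^+ 2 * x + 2 * Ph x by [].
have oo u : u \in `]u0, u1[ -> u \in `]a, b[.
  by rewrite !in_itv/=; move: alo hib mg0; lra.
have co u : u \in `[u0, u1] -> u \in `]a, b[.
  by rewrite !in_itv/=; move: alo hib mg0; lra.
have dh u : u \in `]a, b[ ->
    is_derive u 1 h (2 * r ^+ 2 + 2 *: s (beta - bstar) u ^+ 2).
  move=> uin; apply: is_deriveD; first exact: is_derive_linear.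
  apply: is_deriveZ; exact: (sqprim_derive sb ab (beta - bstar) (j := 0) isT uin).
have ch : {within `[u0, u1], continuous h}.
  exact: (derive_within_continuous (fun x xin => dh x (co x xin))).
have key := @derive_le R (primitive f u0) h _ _ u0 u1 (ltW u01)
  (fun x xin => primitive_derive u01 cf xin) (fun x xin => dh x (oo x xin))
  (primitive_continuous u01 cf) ch.
have {}key : primitive f u0 u1 - primitive f u0 u0 <= h u1 - h u0.
  apply: key => x /subset_itv_oo_cc xin; rewrite /GRing.scale/=.
  have := hr _ xin; rewrite /f scombB ler_norml => /andP[r1 r2].
  have -> : s beta x - g x = (s beta x - s bstar x) - (g x - s bstar x) by ring.
  set p := s beta x - s bstar x; set z := g x - s bstar x in r1 r2 *.
  have : 0 <= (r - z) * (r + z) by apply: mulr_ge0; move: r1 r2; rewrite -/z; lra.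
  by have := sqr_ge0 (p + z); lra.
rewrite primitive0 subr0 in key; apply: le_trans key _.
have au : a <= u0 by move: alo mg0; lra.
have ub : u1 <= b by move: hib mg0; lra.
have /andP[_ h1] := sqprim_increment sb ab (beta - bstar) (j := 0) isT au (ltW u01) ub.
have /andP[_ h2] := sqprim0_bounds sb (beta - bstar).
have := ler_wpM2l (ltW cu0) halp; rewrite !hE -/Ph.
by move: h1 h2; rewrite -/Ph; lra.
Qed.

End MainInequality.

(** * Rates *)

Section Rates.
Context {R : realType}.
Variables (p : nat) (sigma c1 : R) (M : nat -> nat) (eta : R^nat).
Hypotheses (hsigma : 0 < sigma) (hc1 : 0 < c1)
  (hM : M n @[n --> \oo] --> \oo)
  (hMlow : \forall n \near \oo,
     c1 * (n%:R / sigma ^+ 2) `^ ((2 * p + 3)%:R^-1) <= (M n)%:R)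
  (hMup : much_less (fun n => (M n)%:R : R)
            (fun n => (n%:R / (sigma ^+ 2 * ln n%:R)) `^ (7^-1)))
  (heta : forall m, 0 < eta m)
  (hetalow : much_less (fun n => (M n)%:R `^ (- (3 / 2))) (fun n => eta (M n)))
  (hetaup : much_less (fun n => eta (M n)) (fun n => (M n)%:R^-1)).

Local Notation "'m_ n" := ((M n)%:R : R) (at level 8, n at level 2, format "''m_' n").

Let s20 : 0 < sigma ^+ 2. Proof. exact: exprn_gt0. Qed.

Lemma much_less_le (a b : R^nat) c : 0 < c -> (\forall n \near \oo, 0 < b n) ->
  much_less a b -> \forall n \near \oo, a n <= c * b n.
Proof.
move=> c0 b0 /cvgrPdist_le /(_ c c0) h; near=> n.
have bn : 0 < b n by near: n.
have : `|0 - a n / b n| <= c by near: n.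
by rewrite sub0r normrN => /(le_trans (ler_norm _)); rewrite ler_pdivrMr.
Unshelve. all: by end_near.
Qed.

Lemma sieve_large c : \forall n \near \oo, c <= 'm_n.
Proof.
move/cvgnyPge : hM => /(_ (Num.bound `|c|)); apply: filterS => n h.
apply: le_trans (ler_norm c) _; apply: ltW; apply: lt_le_trans (archi_boundP (normr_ge0 c)) _.
by rewrite ler_nat.
Qed.

Lemma ln_large c : \forall n \near \oo, c <= ln (n%:R : R).
Proof.
near=> n; have : expR c <= n%:R by near: n; exact: nbhs_infty_ger.
move=> h; rewrite -(expRK c) ler_ln// posrE ?expR_gt0//.
exact: lt_le_trans (expR_gt0 c) h.
Unshelve. all: by end_near.
Qed.

Lemma eta_upper e : 0 < e -> \forall n \near \oo, 'm_n * eta (M n) <= e.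
Proof.
move=> e0; have M0 : \forall n \near \oo, 0 < ('m_n)^-1.
  by apply: filterS (sieve_large 1) => n h; rewrite invr_gt0 (lt_le_trans _ h).
near=> n; have Mn : 0 < ('m_n)^-1 by near: n.
have : eta (M n) <= e * ('m_n)^-1 by near: n; exact: much_less_le.
by rewrite ler_pdivlMr -?[0 < 'm_n]invr_gt0// mulrC.
Unshelve. all: by end_near.
Qed.

(** [M ^- 2] is at most [M ^ (-3/2)], hence negligible before [eta]; this leaves room for the margin
    [marg / M ^ 2] inside the sieve interval. *)
Lemma eta_lower e : 0 < e -> \forall n \near \oo, 'm_n ^- 2 <= e * eta (M n).
Proof.
move=> e0; have h0 : \forall n \near \oo, 0 < eta (M n) by near=> n.
near=> n; have Mn : 1 <= 'm_n by near: n; exact: sieve_large.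
have : 'm_n `^ (- (3 / 2)) <= e * eta (M n) by near: n; exact: much_less_le.
apply: le_trans; rewrite -powR_invn; last exact: le_trans Mn.
by apply: ler_powR => //; lra.
Unshelve. all: by end_near.
Qed.

Lemma sieve_power e : 0 < e ->
  \forall n \near \oo, 'm_n ^+ 7 * ln n%:R <= e / sigma ^+ 2 * n%:R.
Proof.
(* At most 1, so that its seventh power is still at most [e]. *)
move=> e0; pose c := Num.min 1 e.
have c0 : 0 < c by rewrite lt_min ltr01.
have y0 : \forall n \near \oo, 0 < n%:R / (sigma ^+ 2 * ln (n%:R : R)).
  near=> n; have n0 : 1 <= n%:R :> R by near: n; exact: nbhs_infty_ger.
  have l0 : 1 <= ln (n%:R : R) by near: n; exact: ln_large.
  by rewrite divr_gt0 ?mulr_gt0 ?(lt_le_trans _ n0) ?(lt_le_trans _ l0).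
have yp : \forall n \near \oo, 0 < (n%:R / (sigma ^+ 2 * ln (n%:R : R))) `^ (7^-1).
  by apply: filterS y0 => n; exact: powR_gt0.
near=> n; have l0 : 1 <= ln (n%:R : R) by near: n; exact: ln_large.
have l0' : 0 < ln (n%:R : R) by exact: lt_le_trans l0.
have y1 : 0 < n%:R / (sigma ^+ 2 * ln (n%:R : R)) by near: n.
have h : 'm_n <= c * (n%:R / (sigma ^+ 2 * ln (n%:R : R))) `^ (7^-1).
  by near: n; exact: much_less_le.
set y := n%:R / _ in y1 h.
have h7 : 'm_n ^+ 7 <= c ^+ 7 * y.
  have <- : (c * y `^ (7^-1)) ^+ 7 = c ^+ 7 * y.
    by rewrite exprMn -[(y `^ _) ^+ 7]powR_mulrn ?powR_ge0// -powRrM mulVf ?pnatr_eq0// powRr1// ltW.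
  by rewrite ler_pXn2r// nnegrE// mulr_ge0 ?powR_ge0// ltW.
have c7 : c ^+ 7 <= e.
  apply: (@le_trans _ _ c); last by rewrite ge_min lexx orbT.
  by rewrite -[leRHS]expr1 ler_wiXn2l// ?(ltW c0)// ge_min lexx.
have -> : e / sigma ^+ 2 * n%:R = e * y * ln n%:R.
  by rewrite /y; field; rewrite !gt_eqF.
apply: ler_wpM2r; first exact: ltW.
by apply: le_trans h7 _; apply: ler_wpM2r => //; exact: ltW.
Unshelve. all: by end_near.
Qed.

(** Squaring the left-hand side gives [sigma ^ 2 * M ^ 7 * ln n / n]: this is where the exponent
    [1 / 7] comes from. *)
Lemma noise_rate e : 0 < e ->
  \forall n \near \oo, 'm_n ^+ 3 * (sigma * Num.sqrt ('m_n * ln n%:R / n%:R)) <= e.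
Proof.
move=> e0; near=> n.
have n0 : 1 <= n%:R :> R by near: n; exact: nbhs_infty_ger.
have l0 : 1 <= ln (n%:R : R) by near: n; exact: ln_large.
have h : 'm_n ^+ 7 * ln n%:R <= e ^+ 2 / sigma ^+ 2 * n%:R.
  by near: n; apply: sieve_power; exact: exprn_gt0.
have n0' : 0 < n%:R :> R by exact: lt_le_trans n0.
have q0 : 0 <= 'm_n * ln n%:R / n%:R.
  by rewrite divr_ge0 ?mulr_ge0// (le_trans _ l0).
rewrite -(@ler_pXn2r _ 2)// ?nnegrE ?(ltW e0)//; last first.
  by rewrite mulr_ge0 ?exprn_ge0// mulr_ge0 ?sqrtr_ge0// ltW.
rewrite exprMn [(sigma * _) ^+ 2]exprMn sqr_sqrtr//.
have -> : ('m_n ^+ 3) ^+ 2 * (sigma ^+ 2 * ('m_n * ln n%:R / n%:R)) =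
   'm_n ^+ 7 * ln n%:R * (sigma ^+ 2 / n%:R) by ring.
have -> : e ^+ 2 = e ^+ 2 / sigma ^+ 2 * n%:R * (sigma ^+ 2 / n%:R).
  by field; rewrite !gt_eqF.
by apply: ler_wpM2r => //; rewrite divr_ge0// ltW.
Unshelve. all: by end_near.
Qed.

Lemma xi_sqr n : (0 < n)%N ->
  xi R p n ^+ 2 = ln n%:R / n%:R * n%:R `^ ((2 * p + 3)%:R^-1).
Proof.
move=> n0; have n1 : 1 <= n%:R :> R by rewrite ler1n.
have n0' : n%:R != 0 :> R by rewrite pnatr_eq0 -lt0n.
rewrite /xi exprMn sqr_sqrtr ?ln_ge0// -mulrA; congr (_ * _).
rewrite expr2 -powRD; last by rewrite n0' implybT.
rewrite -[n%:R^-1]powR_inv1// -powRD; last by rewrite n0' implybT.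
have pE : (2 * p + 3)%:R = 2 * p%:R + 3 :> R by rewrite natrD natrM.
have p0 : 2 * p%:R + 3 != 0 :> R by rewrite -pE pnatr_eq0 addn3.
by congr (_ `^ _); rewrite pE natrD; field.
Qed.

(** By [xi_sqr] the square carries the factor [n ^ (1 / (2 p + 3))], which the lower bound on [M]
    replaces by a multiple of [M]; what remains is again [M ^ 7 * ln n / n]. *)
Lemma xi_rate e : 0 < e -> \forall n \near \oo, 'm_n ^+ 3 * xi R p n <= e.
Proof.
move=> e0; set s := (2 * p + 3)%:R^-1 : R.
pose k := (sigma ^+ 2) `^ s / c1 / sigma ^+ 2.
have k0 : 0 < k by rewrite !divr_gt0// powR_gt0.
near=> n.
have n0 : 1 <= n%:R :> R by near: n; exact: nbhs_infty_ger.
have l0 : 1 <= ln (n%:R : R) by near: n; exact: ln_large.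
have m1 : 1 <= 'm_n by near: n; exact: sieve_large.
have h : 'm_n ^+ 7 * ln n%:R <= e ^+ 2 / k / sigma ^+ 2 * n%:R.
  by near: n; apply: sieve_power; rewrite divr_gt0// exprn_gt0.
have hl : c1 * (n%:R / sigma ^+ 2) `^ s <= 'm_n by near: n.
have n0' : 0 < n%:R :> R by exact: lt_le_trans n0.
have m0' : 0 < 'm_n by exact: lt_le_trans m1.
have nE : n%:R `^ s = (sigma ^+ 2) `^ s * (n%:R / sigma ^+ 2) `^ s.
  rewrite -powRM ?(ltW s20)// ?divr_ge0 ?(ltW s20)// mulrC divfK// gt_eqF//.
have {}hl : n%:R `^ s <= k * sigma ^+ 2 * 'm_n.
  have -> : k * sigma ^+ 2 * 'm_n = (sigma ^+ 2) `^ s * ('m_n / c1).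
    by rewrite /k; field; rewrite !gt_eqF.
  by rewrite nE ler_wpM2l ?powR_ge0// ler_pdivlMr// mulrC.
have x0 : 0 <= xi R p n by rewrite mulr_ge0 ?sqrtr_ge0 ?powR_ge0.
rewrite -(@ler_pXn2r _ 2)// ?nnegrE ?(ltW e0) ?mulr_ge0 ?exprn_ge0//.
rewrite exprMn xi_sqr; last by rewrite -(ltr_nat R).
rewrite -/s.
apply: (@le_trans _ _ (('m_n ^+ 3) ^+ 2 * (ln n%:R / n%:R * (k * sigma ^+ 2 * 'm_n)))).
  rewrite ler_wpM2l ?sqr_ge0// ler_wpM2l// divr_ge0// (le_trans _ l0)//.
have -> : ('m_n ^+ 3) ^+ 2 * (ln n%:R / n%:R * (k * sigma ^+ 2 * 'm_n)) =
   'm_n ^+ 7 * ln n%:R * (k * sigma ^+ 2 / n%:R) by ring.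
have -> : e ^+ 2 = e ^+ 2 / k / sigma ^+ 2 * n%:R * (k * sigma ^+ 2 / n%:R).
  by field; rewrite !gt_eqF.
by apply: ler_wpM2r => //; exact: (ltW (divr_gt0 (mulr_gt0 k0 s20) n0')).
Unshelve. all: by end_near.
Qed.

Lemma sample_large e : 0 < e ->
  \forall n \near \oo, (M n <= n)%N /\ 'm_n ^+ 2 / n%:R <= e.
Proof.
move=> e0; near=> n.
have n0 : 1 <= n%:R :> R by near: n; exact: nbhs_infty_ger.
have l0 : 1 <= ln (n%:R : R) by near: n; exact: ln_large.
have m1 : 1 <= 'm_n by near: n; exact: sieve_large.
have me : e^-1 <= 'm_n by near: n; exact: sieve_large.
have h : 'm_n ^+ 7 * ln n%:R <= sigma ^+ 2 / sigma ^+ 2 * n%:R by near: n; exact: sieve_power.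
have {}h : 'm_n ^+ 7 <= n%:R.
  rewrite divff ?mul1r ?gt_eqF// in h; apply: le_trans h.
  by rewrite ler_peMr// exprn_ge0.
have n0' : 0 < n%:R :> R by exact: lt_le_trans n0.
split.
  rewrite -(ler_nat R); apply: le_trans h.
  by rewrite -[leLHS]expr1 ler_weXn2l.
rewrite ler_pdivrMr//; apply: (@le_trans _ _ (e * 'm_n ^+ 7)); last by rewrite ler_wpM2l// ltW.
have -> : 'm_n ^+ 7 = 'm_n ^+ 3 * 'm_n ^+ 4 by rewrite -exprD.
have h3 : 'm_n ^+ 2 <= 'm_n ^+ 4 by rewrite ler_weXn2l.
have h4 : 1 <= e * 'm_n ^+ 3.
  rewrite mulrC -ler_pdivrMr// mul1r; apply: le_trans me _.
  by rewrite -[leLHS]expr1 ler_weXn2l.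
by apply: le_trans h3 _; rewrite mulrA ler_peMl// exprn_ge0.
Unshelve. all: by end_near.
Qed.

Lemma failure_rate A B : 0 < A -> 0 < B ->
  A / ln n%:R + B * ('m_n ^+ 2 / n%:R) @[n --> \oo] --> (0 : R).
Proof.
move=> A0 B0; apply/cvgrPdist_le => e e0.
have e20 : 0 < e / 2 by rewrite divr_gt0.
near=> n.
have l1 : 1 <= ln (n%:R : R) by near: n; exact: ln_large.
have l2 : A / (e / 2) <= ln (n%:R : R) by near: n; exact: ln_large.
have [_ h] : (M n <= n)%N /\ 'm_n ^+ 2 / n%:R <= e / 2 / B.
  by near: n; apply: sample_large; rewrite divr_gt0.
have l0 : 0 < ln (n%:R : R) by exact: lt_le_trans l1.
have h1 : A / ln n%:R <= e / 2.
  by rewrite ler_pdivrMr// mulrC -ler_pdivrMr.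
have h2 : B * ('m_n ^+ 2 / n%:R) <= e / 2 by rewrite mulrC -ler_pdivlMr.
have h3 : 0 <= A / ln n%:R by exact: (ltW (divr_gt0 A0 l0)).
have h4 : 0 <= B * ('m_n ^+ 2 / n%:R).
  by apply: mulr_ge0; [exact: ltW|apply: divr_ge0 => //; exact: sqr_ge0].
by rewrite sub0r normrN ger0_norm ?addr_ge0//; lra.
Unshelve. all: by end_near.
Qed.

(** Each entry of the maximum must be [O(M ^- 3)] with a small constant. For the sieve bias
    [M ^- (p + 1)] this holds because [p >= 3] makes it at most [M ^- 4]. *)
Lemma alpha_rate C0 : (3 <= p)%N -> 0 < C0 ->
  \forall n \near \oo, alpha p sigma C0 M n <= 'm_n ^- 2.
Proof.
move=> p3 C00; have iC0 : 0 < C0^-1 by rewrite invr_gt0.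
near=> n.
have m1 : 1 <= 'm_n by near: n; exact: sieve_large.
have mC : C0 <= 'm_n by near: n; exact: sieve_large.
have hA : 'm_n ^+ 3 * (sigma * Num.sqrt ('m_n * ln n%:R / n%:R)) <= C0^-1.
  by near: n; exact: noise_rate.
have hx : 'm_n ^+ 3 * xi R p n <= C0^-1 by near: n; exact: xi_rate.
have m0 : 0 < 'm_n by exact: lt_le_trans m1.
have m30 : 0 < 'm_n ^+ 3 by rewrite exprn_gt0.
have ht : 'm_n ^+ 3 * 'm_n ^- (p + 1) <= C0^-1.
  apply: (@le_trans _ _ ('m_n ^+ 3 * 'm_n ^- 4)).
    apply: ler_wpM2l; first exact: ltW.
    by rewrite lef_pV2 ?posrE ?exprn_gt0// ler_weXn2l// addn1 ltnS.
  have -> : 'm_n ^+ 3 * 'm_n ^- 4 = ('m_n)^-1 by field; rewrite gt_eqF.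
  by rewrite lef_pV2 ?posrE.
have e : C0 * 'm_n * ('m_n ^- 3 * C0^-1) = 'm_n ^- 2 by field; rewrite !gt_eqF.
rewrite /alpha -e ler_wpM2l ?mulr_ge0 ?(ltW C00)// !ge_max !(ler_pdivlMl _ _ m30) hA ht hx//.
Unshelve. all: by end_near.
Qed.

End Rates.

(** * The drift *)

Section Drift.
Context {R : realType}.
Variables (p : nat) (delta x0 x1 : R) (D : set R) (g X : R -> R).
Hypotheses (hp : (3 <= p)%N) (hdelta : 0 < delta < 1 / 2)
  (hX : solves_ode g 0 1 x0 X) (hXD : forall t : R, t \in `[0, 1] -> D (X t))
  (hx1 : x1 = X 1) (hxD : `[x0, x1] `<=` D) (hg : Ck_on p D g)
  (hg0 : forall x, D x -> 0 < g x).
Local Notation u0 := (X delta).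
Local Notation u1 := (X (1 - delta)).

Let dd : delta < 1 - delta. Proof. by move: hdelta; lra. Qed.

Lemma trajectory_increment s t : 0 <= s -> s <= t -> t <= 1 ->
  exists2 c, 0 < c & X t - X s = c * (t - s).
Proof.
have [_ cX dX] := hX; move=> s0 st t1.
have sub z : z \in `[s, t] -> z \in `[0, 1] by rewrite !in_itv/=; lra.
have cX' : {within `[s, t], continuous X}.
  by apply: continuous_subspaceW cX => z /=; exact: sub.
have dX' z : z \in `]s, t[ -> is_derive z 1 X (g (X z)).
  by rewrite in_itv/= => zst; apply: dX; move: zst; lra.
have [c /sub cin ->] := MVT_segment st dX' cX'.
by exists (g (X c)) => //; apply: hg0; exact: hXD.
Qed.

Lemma trajectory_mono s t : 0 <= s -> s <= t -> t <= 1 -> X s <= X t.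
Proof.
move=> s0 st t1; have [c c0 e] := trajectory_increment s0 st t1.
by rewrite -subr_ge0 e mulr_ge0 ?(ltW c0)// subr_ge0.
Qed.

Lemma trajectory_ends : u0 < u1.
Proof.
have [|||c c0 e] := @trajectory_increment delta (1 - delta); try by move: hdelta; lra.
by rewrite -subr_gt0 e mulr_gt0// subr_gt0.
Qed.

Lemma trajectory_domain u : u \in `[u0, u1] -> D u.
Proof.
rewrite in_itv/= => /andP[h0 h1]; have [X0 _ _] := hX; apply: hxD => /=; rewrite in_itv/=.
have := @trajectory_mono 0 delta; have := @trajectory_mono (1 - delta) 1.
rewrite hx1 -X0 => a b; apply/andP; split.
  by apply: le_trans h0; apply: b; move: hdelta; lra.
by apply: le_trans h1 _; apply: a; move: hdelta; lra.
Qed.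

Lemma drift_derivable j u : (j < p)%N -> u \in `[u0, u1] -> derivable (derive1n j g) u 1.
Proof. by move=> jp uin; have [h _] := hg; apply: h => //; exact: trajectory_domain. Qed.

Lemma drift_continuous j : (j < p)%N -> {within `[u0, u1], continuous (derive1n j g)}.
Proof.
by move=> jp; apply: derivable_within_continuous => u uin; exact: drift_derivable.
Qed.

Lemma drift_bounds : exists gmin gmax G1 : R, [/\ 0 < gmin,
  forall u, u \in `[u0, u1] -> gmin <= g u <= gmax &
  forall u, u \in `[u0, u1] -> `|derive1n 1 g u| <= G1].
Proof.
have u01 := ltW trajectory_ends.
have c0 := drift_continuous (ltn_trans (isT : 0 < 2)%N hp).
have [cM cMin hM] := EVT_max u01 c0; have [cm cmin hm] := EVT_min u01 c0.
have c1 := drift_continuous (ltn_trans (isT : 1 < 2)%N hp).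
have [dM _ hdM] := EVT_max u01 c1; have [dm _ hdm] := EVT_min u01 c1.
exists (g cm), (g cM), (`|derive1n 1 g dM| + `|derive1n 1 g dm|); split.
- by apply: hg0; exact: trajectory_domain.
- by move=> u uin; rewrite hM// hm.
move=> u uin; have := hdM u uin; have := hdm u uin.
have := ler_norm (derive1n 1 g dM); have := ler_norm (- derive1n 1 g dm); rewrite normrN.
have := normr_ge0 (derive1n 1 g dM); have := normr_ge0 (derive1n 1 g dm).
by move=> *; rewrite ler_norml; lra.
Qed.

(** The construction of [clockf] for the true drift. The path is monotone, hence already confined,
    so [clock_eq] applies directly and identifies the clock difference with the travel time. *)
Lemma drift_clock : exists2 F : R -> R,
  forall u, u \in `[u0, u1] -> is_derive u 1 F (g u)^-1 &
  F u1 - F u0 = (1 - delta) - delta.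
Proof.
have u01 := trajectory_ends.
pose f := extend_cst u0 u1 (fun u => (g u)^-1).
have cf : continuous f.
  apply: extend_cst_continuous; first exact: ltW.
  move=> u uin; apply: cvgV; first by rewrite gt_eqF// hg0//; exact: trajectory_domain.
  exact/differentiable_continuous/derivable1_diffP/(drift_derivable (ltn_trans (isT : 0 < 2)%N hp)).
have ab : u0 - 1 < u1 + 1 by lra.
have cf' : {within `[u0 - 1, u1 + 1], continuous f} by exact: continuous_subspaceT.
have dF u : u \in `[u0, u1] -> is_derive u 1 (primitive f (u0 - 1)) (g u)^-1.
  move=> uin; have uin' : u \in `]u0 - 1, u1 + 1[ by move: uin; rewrite !in_itv/=; lra.
  have -> : (g u)^-1 = f u.
    by move: uin; rewrite in_itv/= => /andP[h0 h1]; rewrite /f /extend_cst (min_idPl h1) (max_idPr h0).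
  exact: primitive_derive ab cf' _ uin'.
exists (primitive f (u0 - 1)) => //.
have [_ cX dX] := hX.
have h1 : {within `[delta, 1 - delta], continuous X}.
  by apply: continuous_subspaceW cX => z /=; rewrite !in_itv/=; move: hdelta; lra.
have h2 t : delta < t < 1 - delta -> is_derive t 1 X (g (X t)).
  by move=> ht; apply: dX; move: hdelta ht; lra.
have h3 u : u0 <= u <= u1 -> 0 < g u.
  by move=> uin; apply: hg0; apply: trajectory_domain; rewrite in_itv.
have h4 u : u0 <= u <= u1 -> is_derive u 1 (primitive f (u0 - 1)) (g u)^-1.
  by move=> uin; apply: dF; rewrite in_itv.
have h5 t : t \in `[delta, 1 - delta] -> u0 <= X t <= u1.
  rewrite in_itv/= => /andP[lt tu].
  by apply/andP; split; apply: trajectory_mono => //; move: hdelta; lra.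
have -> := clock_eq (ltW dd) h1 erefl h2 h3 h4 h5.
by rewrite addrAC subrr add0r.
Qed.

End Drift.

(** * Choice of the constants *)

Section Tuning.
Context {R : realType}.

(* The conditions of the localization, once [M eta], [M ^ 3 rho] and [1 / M]
   are below a small constant [e]; [rho] bounds the endpoint errors and [t] is
   the order of the bias of the sieve. *)
Lemma tuning (K cl gam W mg u0 u1 M eta rho t e v0 v1 : R) :
  0 < K -> 0 < cl -> 0 < gam -> 1 <= W -> 0 < mg -> u0 < u1 -> 1 <= M -> 0 < eta ->
  0 <= rho -> 0 <= t ->
  e <= gam -> e <= 4^-1 -> K * 8 * e <= cl -> K * (2 + W + K) * 4 * e <= cl ->
  (W + K + cl / (4 * K)) * e <= u1 - u0 ->
  M * eta <= e -> M ^+ 3 * rho <= e -> M^-1 <= e -> M * t <= M^-1 ->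
  2 * (mg + gam) * M ^- 2 <= eta ->
  `|v0 - u0| <= rho -> `|v1 - u1| <= rho ->
  [/\ v0 - eta < u0 - mg / M ^+ 2, u1 + mg / M ^+ 2 < v1 + eta,
      K * M * ((u0 - (v0 - eta)) + ((v1 + eta) - u1)) <= cl / 2 &
  [/\ rho <= gam / M ^+ 2,
      K * M * ((v0 - (v0 - eta)) + ((v1 + eta) - u1) + (K * t + (W - 1) * rho)) <= cl / 4,
      rho + (K * t + (W - 1) * rho) + cl / (4 * K) / M <= u1 - u0 &
      (v1 + eta) - (v0 - eta) <= u1 - u0 + 1]].
Proof.
move=> K0 cl0 gam0 W1 mg0 u01 M1 eta0 rho0 t0 e1 e2 e3 e4 e5 h1 h2 h3 h4 h5.
rewrite !ler_norml => /andP[v0l v0u] /andP[v1l v1u].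
have M0 : 0 < M by exact: lt_le_trans M1.
have M2 : 1 <= M ^+ 2 by rewrite exprn_ege1.
have M20 : 0 < M ^- 2 by rewrite invr_gt0 exprn_gt0.
have M22 : M ^+ 2 * M ^- 2 = 1 by rewrite divff// gt_eqF// exprn_gt0.
have k0 : 0 < cl / (4 * K) by rewrite divr_gt0// mulr_gt0.
have etae : eta <= e by apply: le_trans h1; rewrite ler_peMl// ltW.
have rM : M * rho <= e.
  apply: le_trans h2; rewrite exprS -mulrA ler_wpM2l ?(ltW M0)// ler_peMl//.
have re : rho <= e by apply: le_trans rM; rewrite ler_peMl.
have rM2 : rho <= gam * M ^- 2.
  have : M ^+ 2 * rho <= gam.
    apply: le_trans e1; apply: le_trans h2.
    by rewrite [M ^+ 3]exprS -mulrA ler_peMl// mulr_ge0// ltW// exprn_gt0.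
  by move=> h; rewrite -(mulr1 rho) -M22 mulrA (mulrC rho) ler_wpM2r// ltW.
have Mt : M * t <= e by exact: le_trans h3.
have te : t <= e by apply: le_trans Mt; rewrite ler_peMl.
have mgM : mg / M ^+ 2 + gam * M ^- 2 <= eta / 2 by move: h5; lra.
have W0 : 0 <= W - 1 by rewrite subr_ge0.
have Wr : (W - 1) * (M * rho) <= (W - 1) * e by rewrite ler_wpM2l.
have Wr' : (W - 1) * rho <= (W - 1) * e by rewrite ler_wpM2l.
have Kt : K * (M * t) <= K * e by rewrite ler_wpM2l// ltW.
have Kt' : K * t <= K * e by rewrite ler_wpM2l// ltW.
split; [by lra|by lra| |split; [exact: rM2| | |by lra]].
- have : K * (M * (u0 - (v0 - eta) + (v1 + eta - u1))) <= K * (4 * e).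
    rewrite ler_wpM2l ?(ltW K0)//.
    have : M * (u0 - (v0 - eta) + (v1 + eta - u1)) <= M * (2 * rho + 2 * eta).
      by rewrite ler_wpM2l ?(ltW M0)//; lra.
    by lra.
  by lra.
- have : K * (M * (v0 - (v0 - eta) + (v1 + eta - u1) + (K * t + (W - 1) * rho)))
      <= K * ((2 + W + K) * e).
    rewrite ler_wpM2l ?(ltW K0)//.
    have : M * (v0 - (v0 - eta) + (v1 + eta - u1) + (K * t + (W - 1) * rho)) <=
        M * (2 * eta + rho + (K * t + (W - 1) * rho)).
      by rewrite ler_wpM2l ?(ltW M0)//; lra.
    by lra.
  by lra.
have : cl / (4 * K) / M <= cl / (4 * K) * e by rewrite ler_wpM2l// ltW.
by lra.
Qed.

Lemma tuning_threshold (K cl gam W L : R) : 0 < K -> 0 < cl -> 0 < gam -> 0 < L -> 1 <= W ->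
  exists e, [/\ 0 < e, e <= gam, e <= 4^-1, K * 8 * e <= cl &
    K * (2 + W + K) * 4 * e <= cl /\ (W + K + cl / (4 * K)) * e <= L].
Proof.
move=> K0 cl0 gam0 L0 W1; have W0 : 0 < W by exact: lt_le_trans W1.
have k0 : 0 < cl / (4 * K) by rewrite divr_gt0// mulr_gt0.
have c3 : 0 < K * 8 by rewrite mulr_gt0.
have c4 : 0 < K * (2 + W + K) * 4 by rewrite mulr_gt0// mulr_gt0// !addr_gt0.
have c5 : 0 < W + K + cl / (4 * K) by rewrite !addr_gt0.
exists (Num.min gam (Num.min 4^-1 (Num.min (cl / (K * 8))
  (Num.min (cl / (K * (2 + W + K) * 4)) (L / (W + K + cl / (4 * K))))))).
set e := Num.min _ _; split.
- by rewrite /e !lt_min gam0 invr_gt0 ltr0n/= !divr_gt0.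
- by rewrite /e ge_min lexx.
- by rewrite /e !ge_min lexx orbT.
- by rewrite mulrC -ler_pdivlMr// /e !ge_min lexx !orbT.
by split; rewrite mulrC -ler_pdivlMr// /e !ge_min lexx !orbT.
Qed.

(** The first entry [A] of the maximum satisfies [n * A ^ 2 = sigma ^ 2 * M * l] and absorbs the
    noise; the other two absorb the bias. The factor [M] in front of the maximum cancels the loss
    [M ^ 2] of the reverse inequality, and the summand 1 in the condition on [C0] gives
    strictness. *)
Lemma gap_of_rate (n l M sigma C0 cT k1 k5 K c t x : R) :
  0 < n -> 0 < l -> 0 < M -> 0 < sigma -> 0 < cT -> 0 < k1 -> 0 <= K ->
  0 <= c -> 0 < t -> 0 <= x -> 0 <= k5 ->
  32 * k1 * (2 * (K + c) ^+ 2 + k5 / sigma ^+ 2 + 1) <= cT * C0 ^+ 2 ->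
  2 * n * (K * t + c * x) ^+ 2 + k5 * M * l <
  cT / 32 * n * ((C0 * M * Num.max (sigma * Num.sqrt (M * l / n)) (Num.max t x)) ^+ 2
                 / (k1 * M ^+ 2)).
Proof.
move=> n0 l0 M0 s0 cT0 k10 K0 c0 t0 x0 k50 hC.
set A := sigma * _; set mx := Num.max A _.
have mA : A <= mx by rewrite le_max lexx.
have mt : t <= mx by rewrite /mx !le_max lexx orbT.
have mxx : x <= mx by rewrite /mx !le_max lexx !orbT.
have mx0 : 0 < mx by exact: lt_le_trans mt.
have A0 : 0 <= A by rewrite mulr_ge0 ?sqrtr_ge0// ltW.
have nA : n * A ^+ 2 = sigma ^+ 2 * (M * l).
  rewrite exprMn sqr_sqrtr; last by rewrite divr_ge0 ?mulr_ge0// ltW.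
  by field; rewrite gt_eqF.
have -> : cT / 32 * n * ((C0 * M * mx) ^+ 2 / (k1 * M ^+ 2)) =
    cT * C0 ^+ 2 / (32 * k1) * (n * mx ^+ 2).
  by field; rewrite !gt_eqF.
have s20 : 0 < sigma ^+ 2 by rewrite exprn_gt0.
have nm0 : 0 < n * mx ^+ 2 by rewrite mulr_gt0// exprn_gt0.
have h1 : (2 * (K + c) ^+ 2 + k5 / sigma ^+ 2 + 1) * (n * mx ^+ 2) <=
    cT * C0 ^+ 2 / (32 * k1) * (n * mx ^+ 2).
  rewrite ler_wpM2r ?(ltW nm0)// ler_pdivlMr; last by rewrite mulr_gt0.
  by move: hC; lra.
apply: lt_le_trans h1.
have h2 : (K * t + c * x) ^+ 2 <= ((K + c) * mx) ^+ 2.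
  have Kt : K * t <= K * mx by rewrite ler_wpM2l.
  have cx : c * x <= c * mx by rewrite ler_wpM2l.
  have p1 : 0 <= K * t + c * x by rewrite addr_ge0// mulr_ge0// ltW.
  have p2 : 0 <= (K + c) * mx by rewrite mulr_ge0 ?addr_ge0// ltW.
  by rewrite ler_pXn2r//; lra.
have h3 : k5 * M * l <= k5 / sigma ^+ 2 * (n * mx ^+ 2).
  have -> : k5 * M * l = k5 / sigma ^+ 2 * (n * A ^+ 2).
    by rewrite nA; field; rewrite gt_eqF.
  rewrite ler_wpM2l ?divr_ge0 ?(ltW s20)// ler_wpM2l ?(ltW n0)//.
  by rewrite ler_pXn2r// nnegrE// ltW.
have := ler_wpM2l (ltW n0) h2; rewrite exprMn; move: h3 nm0.
set q := k5 / _; set r := (K + c) ^+ 2; set z := (K * t + _) ^+ 2; lra.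
Qed.

End Tuning.

Section Conclusion.
Context {R : realType} {d : measure_display} {Omega : measurableType d}.

Lemma whp_of_failure_bound (P : probability Omega R) (A : nat -> set Omega) (f : R^nat) :
  f n @[n --> \oo] --> (0 : R) ->
  (\forall n \near \oo, exists E, [/\ measurable E, E `<=` A n & ((1 - f n)%:E <= P E)%E]) ->
  whp P A.
Proof.
move=> f0 hE.
(* Suitable events are known for large [n] only; where none exists the empty set is taken, as [whp]
   asks for a measurable subset at every index. *)
have /choice[E hEn] : forall n, exists E : set Omega, [/\ measurable E, E `<=` A n &
    (exists E, [/\ measurable E, E `<=` A n & ((1 - f n)%:E <= P E)%E]) ->
    ((1 - f n)%:E <= P E)%E].
  move=> n; have [[E [mE EA hP]]|no] := pselect (exists E, [/\ measurable E, E `<=` A n &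
    ((1 - f n)%:E <= P E)%E]); first by exists E.
  by exists set0; split.
exists E; split=> [n|n|]; try by have [] := hEn n.
apply: (@squeeze_cvge _ _ _ _ (fun n => (1 - f n)%:E) _ (fun=> 1%E)).
- apply: filterS hE => n /(let: And3 _ _ h := hEn n in h) -> /=.
  by have [mE _ _] := hEn n; exact: probability_le1.
- apply: cvg_EFin; first exact: nearW.
  by rewrite -[X in _ --> X]subr0; apply: cvgB => //; exact: cvg_cst.
exact: cvg_cst.
Qed.

End Conclusion.

Theorem theorem3p1 (R : realType) (d : measure_display)
    (Omega : measurableType d) (P : probability Omega R)
    (p : nat) (delta x0 x1 : R) (D : set R) (g X : R -> R)
    (T eps : nat -> {RV P >-> R}) (Y : nat -> Omega -> R)
    (fT : R -> R) (cT cT' sigma : R)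
    (M : nat -> nat) (eta : R^nat) (c1 Cd K cl cu : R)
    (hp : (3 <= p)%N)
    (hdelta : 0 < delta < 1 / 2)
    (hX : solves_ode g 0 1 x0 X)
    (hXD : forall t : R, t \in `[0, 1] -> D (X t))
    (hx1 : x1 = X 1)
    (hD : open D /\ is_interval D)
    (hxD : `[x0, x1] `<=` D)
    (hg : Ck_on p D g)
    (hg0 : forall x, D x -> 0 < g x)
    (hY : forall j w, Y j w = X (T j w) + eps j w)
    (hind : mutually_independent
              (fun i : nat + nat =>
                 match i with inl j => T j | inr j => eps j end))
    (hfT : measurable_fun (`[0, 1]%classic : set R) fT)
    (hcT : 0 < cT <= cT')
    (hfTb : forall t : R, t \in `[0, 1] -> cT <= fT t <= cT')
    (hT : forall j, has_density_on `[0, 1] (T j) fT)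
    (heps : identically_distributed eps)
    (hsub : forall j, sub_gaussian (eps j))
    (hmean : forall j, ('E_P[eps j] = 0)%E)
    (hsigma : 0 < sigma)
    (hvar : forall j, ('V_P[eps j] = (sigma ^+ 2)%:E)%E)
    (hc1 : 0 < c1)
    (hM : M n @[n --> \oo] --> \oo)
    (hMlow : \forall n \near \oo,
       c1 * (n%:R / sigma ^+ 2) `^ ((2 * p + 3)%:R^-1) <= (M n)%:R)
    (hMup : much_less (fun n => (M n)%:R : R)
              (fun n => (n%:R / (sigma ^+ 2 * ln n%:R)) `^ (7^-1)))
    (heta : forall m, 0 < eta m)
    (hetalow : much_less (fun n => (M n)%:R `^ (- (3 / 2)))
                 (fun n => eta (M n)))
    (hetaup : much_less (fun n => eta (M n)) (fun n => (M n)%:R^-1))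
    (* Cd, K, cl, cu are the constants in the conditions on the endpoint
       estimates xh0, xh1 and on the sieve, which are stated below the
       existential: c2, C0, C1 do not depend on the values of the endpoint
       estimates, which are conditioned upon *)
    (hCd : 0 < Cd) (hK : 0 < K) (hcl : 0 < cl <= cu) :
  let x0d := X delta in
  let x1d := X (1 - delta) in
  exists c2 C0 C1 : R,
    [/\ 0 < c2, 0 < C0, 0 < C1,
      \forall n \near \oo, alpha p sigma C0 M n <= alpha_bar c2 M n &
      forall (xh0 xh1 : R^nat)
        (phi : forall n, 'I_(M n) -> R -> R)
        (Xb : forall n, 'rV[R]_(M n) -> R -> R -> R)
        (bstar : forall n, 'rV[R]_(M n)),
      let a n := xh0 n - eta (M n) in
      let b n := xh1 n + eta (M n) in
      let gb n (beta : 'rV[R]_(M n)) := gbeta (a n) (b n) (phi n) beta in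
      (\forall n \near \oo,
        Num.max `|xh0 n - x0d| `|xh1 n - x1d| <= Cd * xi R p n) ->
      (\forall n \near \oo, sieve_basis K cl cu (a n) (b n) (phi n)) ->
      (* Xb n beta v t is X(t; beta, v) *)
      (\forall n \near \oo, forall (beta : 'rV[R]_(M n)) (v : R),
        solves_ode (gb n beta) delta (1 - delta) v (Xb n beta v)) ->
      (\forall n \near \oo, forall t : R, t \in `[delta, 1 - delta] ->
        `|X t - Xb n (bstar n) x0d t| <= K * (M n)%:R ^- (p + 1)) ->
      (\forall n \near \oo, forall (j : nat) (u : R),
        (j <= 2)%N -> u \in `[x0d, x1d] ->
        `|derive1n j g u - derive1n j (gb n (bstar n)) u| <= K * (M n)%:R ^- (p - j)) ->
      whp P (fun n => [set w |
        let L := objective delta n (fun beta => Xb n beta (xh0 n))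
                   (fun j => T j w) (fun j => Y j w) in
        exists bhat : 'rV[R]_(M n),
          [/\ local_min L bhat,
              global_min_within L (bstar n) (alpha_bar c2 M n) bhat &
              (\int[lebesgue_measure]_(u in `[x0d, x1d])
                 (`|gb n bhat u - g u| ^+ 2)%:E
               <= (C1 * alpha p sigma C0 M n ^+ 2)%:E)%E]])].
Proof.
move=> x0d x1d.
have [gmin [gmax [G1 [gmin0 hgb hg1]]]] := drift_bounds hp hdelta hX hXD hx1 hxD hg hg0.
have [F hF Fgt] := drift_clock hp hdelta hX hXD hx1 hxD hg hg0.
have u01 : x0d < x1d := trajectory_ends hdelta hX hXD hg0.
have cg : {within `[x0d, x1d], continuous g}.
  exact: (drift_continuous hdelta hX hXD hx1 hxD hg hg0 (ltn_trans (isT : 0 < 2)%N hp)).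
have [cl0 clcu] := andP hcl; have cu0 : 0 < cu by exact: lt_le_trans clcu.
have [cT0 cTcT'] := andP hcT; have cT'0 : 0 < cT' by exact: lt_le_trans cTcT'.
have t01 : delta < 1 - delta by move: hdelta; lra.
have t00 : 0 <= delta by move: hdelta; lra.
have t11 : 1 - delta <= 1 by move: hdelta; lra.
have tt0 : 0 < (1 - delta) - delta by rewrite subr_gt0.
have tt1 : (1 - delta) - delta <= 1 by move: hdelta; lra.
have gmax0 : 0 < gmax.
  have u0in : x0d \in `[x0d, x1d] by rewrite in_itv/= lexx ltW.
  by have /andP[h1 h2] := hgb _ u0in; exact: lt_le_trans gmin0 (le_trans h1 h2).
pose gam := gmin / 2; have gam0 : 0 < gam by rewrite divr_gt0.
pose lipt := 2 * gmax / gam.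
have lipt0 : 0 < lipt by rewrite divr_gt0// mulr_gt0.
pose k1 := cst1 K cl gmin gmax.
have k10 : 0 < k1 := cst1_gt0 hK cl0 u01 gmin0 hgb.
pose k2 := cst2 K cl cu x0d x1d gmin gmax G1.
have k20 : 0 < k2 := cst2_gt0 hK cl0 clcu G1 u01 gmin0 hgb.
have k30 : 0 < cst3 K cl cu x0d x1d gmin gmax G1 := cst3_gt0 hK cl0 clcu G1 u01 gmin0 hgb.
(* Number of cells per basis function, a constant. Being at least 1 it satisfies [q <= q ^ 2], so
   [4 * k2 <= q] is enough. *)
pose q := (Num.bound (4 * k2)).+1.
have q1 : 1 <= q%:R :> R by rewrite ler1n.
have qbig : 4 * k2 <= q%:R ^+ 2.
  have h : 4 * k2 <= q%:R.
    have k40 : 0 <= 4 * k2 by rewrite mulr_ge0// ltW.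
    by apply: le_trans (ltW (archi_boundP k40)) _; rewrite ler_nat.
  by apply: le_trans h _; rewrite expr2 ler_peMl// (le_trans _ q1).
pose k5 := cst5 K cl cu x0d x1d delta (1 - delta) gmin gmax G1 q cT.
have q0 : 0 < q%:R :> R by rewrite ltr0n.
have k50 : 0 <= k5.
  rewrite /k5 /cst5 /cst4; apply: mulr_ge0.
    apply: divr_ge0; last exact: ltW.
    apply: mulr_ge0 => //; apply: divr_ge0 => //.
    by apply: addr_ge0; [apply: addr_ge0 => //; exact: (ltW (divr_gt0 k20 q0))|exact: ltW].
  by apply: addr_ge0 => //; exact: (ltW (divr_gt0 q0 tt0)).
pose Q := 32 * k1 * (2 * (K + lipt * Cd) ^+ 2 + k5 / sigma ^+ 2 + 1) / cT.
have Q0 : 0 <= Q.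
  apply: divr_ge0; last exact: ltW.
  apply: mulr_ge0; first by rewrite mulr_ge0// ltW.
  apply: addr_ge0 => //; apply: addr_ge0; first by rewrite mulr_ge0// sqr_ge0.
  by apply: divr_ge0 => //; exact: sqr_ge0.
(* The square of [1 + Q] dominates [Q] whether [Q] is small or large. *)
pose C0 := 1 + Q; have C00 : 0 < C0 by rewrite ltr_pwDl.
have hC0 : 32 * k1 * (2 * (K + lipt * Cd) ^+ 2 + k5 / sigma ^+ 2 + 1) <= cT * C0 ^+ 2.
  have -> : 32 * k1 * (2 * (K + lipt * Cd) ^+ 2 + k5 / sigma ^+ 2 + 1) = cT * Q.
    by rewrite /Q [RHS]mulrC divfK// gt_eqF.
  by rewrite ler_wpM2l ?(ltW cT0)// /C0; have := sqr_ge0 Q; move: Q0; lra.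
have s20 : 0 < sigma ^+ 2 by rewrite exprn_gt0.
(* The last witness adds the share of the estimation error, [2 * cu], to that of the sieve bias, for
   which [K * M ^- p] is at most [K / C0] times [alpha]. *)
exists 1, C0, (2 * cu + 2 * K ^+ 2 * (x1d - x0d) / C0 ^+ 2).
have arate := alpha_rate hsigma hc1 hM hMlow hMup hp C00.
have abE n : alpha_bar 1 M n = (M n)%:R ^- 2 by rewrite /alpha_bar mul1r.
split => //.
- apply: addr_gt0; first by rewrite mulr_gt0.
  apply: divr_gt0; last exact: exprn_gt0.
  by rewrite mulr_gt0 ?subr_gt0// mulr_gt0// exprn_gt0.
- by apply: filterS arate => n; rewrite abE.
move=> xh0 xh1 phi Xb bstar a b gb hend hsieve hode hbias happ.
pose A := sigma ^+ 2 * (2 * (cT' * ((1 - delta) - delta)) + 1).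
pose B := 4 * cT' / (cT ^+ 2 * ((1 - delta) - delta)) * q%:R ^+ 2.
have A0 : 0 < A.
  by rewrite mulr_gt0// addr_gt0// mulr_gt0// mulr_gt0.
have B0 : 0 < B.
  apply: mulr_gt0; last exact: exprn_gt0.
  by apply: divr_gt0; apply: mulr_gt0 => //; exact: exprn_gt0.
apply: (whp_of_failure_bound (failure_rate hsigma hM hMup A0 B0)).
pose W := 1 + lipt.
have W1 : 1 <= W by rewrite lerDl ltW.
have L0 : 0 < x1d - x0d by rewrite subr_gt0.
have [e [e0 e1 e2 e3 [e4 e5]]] := tuning_threshold hK cl0 gam0 L0 W1.
pose mg := marg K cu x0d x1d gmin gmax.
have mg0 : 0 < mg := marg_gt0 hK cl0 clcu u01 gmin0 hgb.
pose bd := bstar_bd cl x0d x1d gmax.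
have g80 : 0 < gmin / 8 by rewrite divr_gt0.
have g820 : 0 < (gmin / 8) ^+ 2 by rewrite exprn_gt0.
have mgg0 : 0 < (2 * (mg + gam))^-1 by rewrite invr_gt0 mulr_gt0// addr_gt0.
have eCd0 : 0 < e / Cd by rewrite divr_gt0.
have mbig := sieve_large hM (R := R).
near=> n.
have n1 : 1 <= n%:R :> R by near: n; exact: nbhs_infty_ger.
have l1 : 1 <= ln (n%:R : R) by near: n; exact: ln_large.
have m1 : 1 <= (M n)%:R :> R by near: n; exact: mbig.
have b0 : K / (gmin / 8) <= (M n)%:R by near: n; exact: mbig.
have b1 : K / (gmin / 8) ^+ 2 <= (M n)%:R by near: n; exact: mbig.
have b2 : bd * K * mg ^+ 2 / (gmin / 8) ^+ 2 <= (M n)%:R by near: n; exact: mbig.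
have be : e^-1 <= (M n)%:R by near: n; exact: mbig.
have [Mn _] : (M n <= n)%N /\ (M n)%:R ^+ 2 / n%:R <= 1 :> R.
  by near: n; exact: (sample_large hsigma hM hMup ltr01).
have hal : alpha p sigma C0 M n <= (M n)%:R ^- 2 by near: n.
have he1 : (M n)%:R * eta (M n) <= e by near: n; exact: (eta_upper hM hetaup e0).
have he2 : (M n)%:R ^- 2 <= (2 * (mg + gam))^-1 * eta (M n).
  by near: n; exact: (eta_lower hM heta hetalow mgg0).
have hxi : (M n)%:R ^+ 3 * xi R p n <= e / Cd.
  by near: n; exact: (xi_rate hsigma hc1 hM hMlow hMup eCd0).
have hd : Num.max `|xh0 n - x0d| `|xh1 n - x1d| <= Cd * xi R p n by near: n.
have hs : sieve_basis K cl cu (a n) (b n) (phi n) by near: n.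
have ho : forall beta v, solves_ode (gb n beta) delta (1 - delta) v (Xb n beta v) by near: n.
have hb : forall t : R, t \in `[delta, 1 - delta] ->
   `|X t - Xb n (bstar n) x0d t| <= K * (M n)%:R ^- (p + 1) by near: n.
have ha : forall (j : nat) (u : R), (j <= 2)%N -> u \in `[x0d, x1d] ->
   `|derive1n j g u - derive1n j (gb n (bstar n)) u| <= K * (M n)%:R ^- (p - j) by near: n.
have n0 : (0 < n)%N by rewrite -(ltr_nat R) (lt_le_trans _ n1).
have n0' : 0 < n%:R :> R by rewrite ltr0n.
have m0 : (0 < M n)%N by rewrite -(ltr_nat R) (lt_le_trans _ m1).
have m0' : 0 < (M n)%:R :> R by rewrite ltr0n.
have l0 : 0 < ln (n%:R : R) by exact: lt_le_trans l1.
have N0 : (0 < q * M n)%N by rewrite muln_gt0.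
have x0' : 0 <= xi R p n by rewrite mulr_ge0 ?sqrtr_ge0 ?powR_ge0.
have nl0 : 0 < n%:R * ln (n%:R : R) by rewrite mulr_gt0.
(* The threshold [n * ln n] exceeds the second moments, of order [n], by a factor [ln n], whence a
   failure probability of order [1 / ln n] for the noise. In [objective_minimum] this means
   [lam = ln n]. *)
have [E [mE PE EG]] := good_event hind hmean hvar hfT hcT hfTb hT t00 t01 t11 n0 N0 n0 nl0.
exists E; split => //; last first.
  apply: le_trans PE; rewrite lee_fin lerD2l lerN2 lerD//.
    have -> : n%:R / (n%:R * ln n%:R) = (ln n%:R)^-1 :> R.
      by field; rewrite !gt_eqF.
    by rewrite mulrC.
  by rewrite natrM /B exprMn !mulrA.
have := hd; rewrite ge_max => /andP[hd0 hd1].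
have r0 : 0 <= Cd * xi R p n by rewrite mulr_ge0// ltW.
have t0' : 0 < (M n)%:R ^- (p + 1) :> R by rewrite invr_gt0 exprn_gt0.
have h2 : (M n)%:R ^+ 3 * (Cd * xi R p n) <= e by rewrite mulrCA mulrC -ler_pdivlMr.
have h3 : (M n)%:R^-1 <= e.
  by rewrite -[e]invrK lef_pV2 ?posrE ?invr_gt0.
have Mp i j : (i <= j)%N -> (M n)%:R ^- j <= (M n)%:R ^- i :> R.
  by move=> ij; rewrite lef_pV2 ?posrE ?exprn_gt0// ler_weXn2l.
have h4 : (M n)%:R * (M n)%:R ^- (p + 1) <= (M n)%:R^-1 :> R.
  have -> : (M n)%:R^-1 = (M n)%:R * (M n)%:R ^- 2 :> R by field; rewrite gt_eqF.
  by apply: ler_wpM2l; [exact: ltW|apply: Mp; rewrite addn1 ltnS (leq_trans _ hp)].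
have h5 : 2 * (mg + gam) * (M n)%:R ^- 2 <= eta (M n).
  have c0 : 0 < 2 * (mg + gam) by rewrite mulr_gt0// addr_gt0.
  by rewrite mulrC -ler_pdivlMr// mulrC.
have [alo hib outside [hdv lost short hab]] := tuning hK cl0 gam0 W1 mg0 u01 m1
  (heta (M n)) r0 (ltW t0') e1 e2 e3 e4 e5 he1 h2 h3 h4 h5 hd0 hd1.
have WE : W - 1 = lipt by rewrite /W addrC addKr.
rewrite WE in lost short.
have big0 : K <= (M n)%:R * (gmin / 8) by rewrite -ler_pdivrMr.
have big1 : K <= (M n)%:R * (gmin / 8) ^+ 2 by rewrite -ler_pdivrMr.
have big2 : bd * K * mg ^+ 2 <= (M n)%:R * (gmin / 8) ^+ 2 by rewrite -ler_pdivrMr.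
have inab u : u \in `[x0d, x1d] -> u \in `]a n, b n[.
  have k0 : 0 < mg / (M n)%:R ^+ 2 by rewrite divr_gt0// exprn_gt0.
  rewrite !in_itv/= /a /b; move: alo hib k0; clear.
  by move: (mg / _) (xh0 n - _) (xh1 n + _) => k y z; lra.
have appp u : u \in `[x0d, x1d] -> `|g u - scomb (phi n) 0 (bstar n) u| <= K * (M n)%:R ^- p.
  move=> uin; have := ha 0 u isT uin; rewrite subn0.
  by rewrite -(gbetaE (phi n) (bstar n) (subset_itv_oo_cc (inab _ uin))).
have app0 u : u \in `[x0d, x1d] -> `|g u - scomb (phi n) 0 (bstar n) u| <= K / (M n)%:R ^+ 2.
  move=> uin; apply: le_trans (appp u uin) _; apply: ler_wpM2l; first exact: ltW.
  by apply: Mp; exact: leq_trans hp.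
have app1 u : u \in `[x0d, x1d] -> `|derive1n 1 g u - scomb (phi n) 1 (bstar n) u| <= K.
  move=> uin; have := ha 1%N u isT uin; rewrite (gbeta_derive1 hs _ (inab _ uin)).
  move=> h; apply: le_trans h _; rewrite ler_piMr ?(ltW hK)//.
  by rewrite -[leRHS](invr1) lef_pV2 ?posrE ?exprn_gt0// exprn_ege1.
have alp0 : 0 < alpha p sigma C0 M n.
  by rewrite /alpha mulr_gt0 ?mulr_gt0// !lt_max t0' orbT.
have gap := gap_of_rate n0' l0 m0' hsigma cT0 k10 (ltW hK)
  (ltW (mulr_gt0 lipt0 hCd)) t0' x0' k50 hC0.
rewrite -(mulrA lipt Cd) in gap.
move=> w /EG[count noise0 noise1 noise2] L.
have [bh [bh1 bh2 bh3]] := objective_minimum (n := n) (q := q)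
  (t := fun j => T j w) (e := fun j => eps j w) hs hK cl0 clcu m0 u01 t01 gmin0 hgb hg1 hF Fgt
  app0 app1 alo hib outside big0 big1 big2 ho hd0 hdv erefl hb lost short hab
  Mn isT qbig cT0 tt1 count noise0 noise1 noise2 hal alp0 gap.
have LE : L = fun beta => \sum_(j < n) (X (T j w) + eps j w - Xb n beta (xh0 n) (T j w)) ^+ 2
    * \1_(`[delta, 1 - delta]) (T j w).
  by apply/funext => beta; rewrite /L /objective; apply: eq_bigr => j _; rewrite hY.
exists bh; rewrite LE; split => //; first by rewrite abE.
have := estimator_risk hs hK cl0 clcu m0 u01 gmin0 hgb alo hib cg appp bh3.
move=> h; apply: le_trans h _; rewrite lee_fin.
(* The second entry of the maximum in [alpha], times the factor [M] in front, has the order [M ^- p]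
   of the pointwise bias of the sieve. *)
have hp' : C0 * (M n)%:R ^- p <= alpha p sigma C0 M n.
  have -> : C0 * (M n)%:R ^- p = C0 * (M n)%:R * (M n)%:R ^- (p + 1).
    by rewrite exprD expr1 invfM -mulrA; congr (_ * _); rewrite mulrCA divff ?mulr1// gt_eqF.
  by apply: ler_wpM2l; [rewrite mulr_ge0// ltW|rewrite !le_max lexx orbT].
have hp2 : (C0 * (M n)%:R ^- p) ^+ 2 <= alpha p sigma C0 M n ^+ 2.
  have z0 : 0 <= C0 * (M n)%:R ^- p :> R by rewrite mulr_ge0 ?invr_ge0 ?exprn_ge0// ltW.
  by rewrite ler_pXn2r// nnegrE// ltW.
rewrite [leRHS]mulrDl lerD2l.
have -> : 2 * (K * (M n)%:R ^- p) ^+ 2 * (x1d - x0d) =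
   2 * K ^+ 2 * (x1d - x0d) / C0 ^+ 2 * (C0 * (M n)%:R ^- p) ^+ 2.
  by field; rewrite !gt_eqF// exprn_gt0.
apply: ler_wpM2l => //; apply: divr_ge0; last exact: sqr_ge0.
by apply: mulr_ge0; [rewrite mulr_ge0// sqr_ge0|exact: ltW].
Unshelve. all: by end_near.
Qed.
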